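(* (1) Let $t>0$, let $(\nu_s)_{0\le s\le t}$ be a family of probability measures on $\mathbb{R}$ with Cauchy transforms $M_s(z)=\int_{\mathbb{R}}\frac{1}{z-u}\,\nu_s(du)$, and assume that $s\mapsto M_s(z)$ is measurable on $[0,t]$ for every $z\in\mathbb{H}$. Denote by $\varphi_{s,t}$ the solution to $$\frac{\partial}{\partial s}\varphi_{s,t}(z) = M_s(\varphi_{s,t}(z))\quad\text{for a.e. } s\in[0,t],\qquad \varphi_{t,t}(z)=z\in\mathbb{H}. \qquad (\mathrm{R})$$ Then, for each $s\in[0,t]$, $\varphi_{s,t}$ is the $F$-transform of a probability measure $\sigma_{s,t}$ on $\mathbb{R}$, and $(\sigma_{s,t})_{0\le s\le t}$ is part of a normal anti-monotone evolution family, i.e. there is a normal anti-monotone evolution family $(\tilde\sigma_{u,v})_{0\le u\le v}$ with $\tilde\sigma_{s,t}=\sigma_{s,t}$ for all $s\in[0,t]$. (2) Conversely, let $(\sigma_{s,t})_{0\le s\le t}$ be a normal anti-monotone evolution family and let $\varphi_{s,t}$ be the $F$-transform of $\sigma_{s,t}$. Then for every $t>0$ there exists a family $(\nu_s)_{0\le s\le t}$ of probability measures on $\mathbb{R}$, with Cauchy transforms $M_s$, such that $s\mapsto M_s(z)$ is measurable on $[0,t]$ for every $z\in\mathbb{H}$ and $\varphi_{s,t}$ satisfies (R).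
   Context: $\mathbb{H}=\{z\in\mathbb{C}: \operatorname{Im} z>0\}$. Measures are Borel measures on $\mathbb{R}$, with not necessarily bounded support. ''a.e.'' means almost every with respect to Lebesgue measure. The Cauchy transform of a probability measure $\mu$ on $\mathbb{R}$ is $G_\mu(z)=\int_{\mathbb{R}}\frac{1}{z-x}\,\mu(dx)$, $z\in\mathbb{C}\setminus\mathbb{R}$. Its $F$-transform is $F_\mu:\mathbb{H}\to\mathbb{H}$, $F_\mu(z)=1/G_\mu(z)$. The anti-monotone convolution $\mu\lhd\nu$ of probability measures $\mu,\nu$ on $\mathbb{R}$ is the probability measure defined by $F_{\mu\lhd\nu}=F_\nu\circ F_\mu$. A collection $(\sigma_{s,t})_{0\le s\le t}$ of probability measures on $\mathbb{R}$ (indexed by all pairs of reals $0\le s\le t$) is a normal anti-monotone evolution family if (a) $\sigma_{t,t}=\delta_0$ for all $t\ge 0$; (b') $\sigma_{s,t}=\sigma_{u,t}\lhd\sigma_{s,u}$ whenever $0\le s\le u\le t$; (c) $\sigma_{s,u}$ converges weakly to $\sigma_{s,t}$ as $u\to t$; (d) the first and second moments exist, and $\int_{\mathbb{R}}x\,\sigma_{s,t}(dx)=0$ and $\int_{\mathbb{R}}x^2\,\sigma_{s,t}(dx)=t-s$ for all $0\le s\le t$. Equation (R) is understood as a Carathéodory ODE in the variable $s$, with $t$ fixed: for each $z\in\mathbb{H}$, the function $s\mapsto\varphi_{s,t}(z)\in\mathbb{H}$ is absolutely continuous on $[0,t]$ and satisfies the equation for a.e. $s\in[0,t]$. *)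

(* Defs.v *)
From HB Require Import structures.
From mathcomp Require Import all_boot all_order all_algebra.
From mathcomp Require Import complex.
From mathcomp Require Import all_classical all_reals all_analysis.
From mathcomp Require Import measurable_realfun.
Import Order.TTheory GRing.Theory Num.Theory.
Import numFieldNormedType.Exports.
Set Implicit Arguments.
Unset Strict Implicit.
Unset Printing Implicit Defensive.
Local Open Scope classical_set_scope.
Local Open Scope ring_scope.
Local Open Scope complex_scope.

Notation borel_probability R := (probability (measurableTypeR R) R).

Definition upper_half_plane (R : realType) : set R[i] :=
  [set z | 0 < complex.Im z].

(* The values of a measure on nonmeasurable sets are junk, so that Leibniz
   equality of measures would be too strong. *)
Definition eq_on_measurable (R : realType)
    (mu nu : set (measurableTypeR R) -> \bar R) : Prop :=
  forall A : set (measurableTypeR R), measurable A -> mu A = nu A.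

Definition cauchy_transform (R : realType) (mu : borel_probability R)
    (z : R[i]) : R[i] :=
  (\int[mu]_x complex.Re (z - x%:C)^-1) +i*
  (\int[mu]_x complex.Im (z - x%:C)^-1).

Definition F_transform (R : realType) (mu : borel_probability R)
    (z : R[i]) : R[i] :=
  (cauchy_transform mu z)^-1.

(* rho is mu <| nu; a probability measure is determined by its F-transform. *)
Definition is_antimonotone_convolution (R : realType)
    (mu nu rho : borel_probability R) : Prop :=
  forall z : R[i], upper_half_plane z ->
    F_transform rho z = F_transform nu (F_transform mu z).

Definition weakly_cvg (R : realType) (T : Type) (F : set_system T)
    (mu_ : T -> borel_probability R) (mu : borel_probability R) : Prop :=
  forall f : R -> R, continuous f -> bounded_fun f ->
    \int[mu_ u]_x f x @[u --> F] --> (\int[mu]_x f x : R).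

Record normal_antimonotone_evolution_family (R : realType)
    (sigma : R -> R -> borel_probability R) : Prop := {
  naef_diag : forall t : R, 0 <= t ->
    eq_on_measurable (sigma t t) (\d_(0 : R)) ;
  naef_conv : forall s u t : R, 0 <= s -> s <= u -> u <= t ->
    is_antimonotone_convolution (sigma u t) (sigma s u) (sigma s t) ;
  (* sigma s u is only meaningful for s <= u *)
  naef_cvg : forall s t : R, 0 <= s -> s <= t ->
    weakly_cvg (within [set u : R | s <= u] (nbhs t)) (sigma s) (sigma s t) ;
  naef_moments : forall s t : R, 0 <= s -> s <= t ->
    [/\ (sigma s t).-integrable setT (fun x => x%:E),
        (sigma s t).-integrable setT (fun x => (x ^+ 2)%:E),
        \int[sigma s t]_x x = 0 &
        \int[sigma s t]_x (x ^+ 2) = t - s] }.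

(* Lebesgue measurability: the sigma-algebra on the domain is the completion of
   the Borel one with respect to Lebesgue measure. *)
Definition lebesgue_measurable_fun (R : realType) (D : set R) (f : R -> R)
    : Prop :=
  @measurable_fun _ _
    (g_sigma_algebraType (completed_algebra_gen (@lebesgue_measure R)))
    (measurableTypeR R) D f.

Definition absolutely_continuous (R : realType) (a b : R) (f : R -> R) : Prop :=
  forall e : R, 0 < e -> exists2 d : R, 0 < d &
    forall (n : nat) (x y : 'I_n -> R),
      (forall i, [/\ a <= x i, x i <= y i & y i <= b]) ->
      (forall i j, i != j -> y i <= x j \/ y j <= x i) ->
      \sum_(i < n) (y i - x i) < d ->
      \sum_(i < n) `|f (y i) - f (x i)| < e.

(* Regularity and derivatives of complex functions of a real variable are
   taken componentwise. *)
Definition complex_lebesgue_measurable (R : realType) (D : set R)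
    (f : R -> R[i]) : Prop :=
  lebesgue_measurable_fun D (fun s => complex.Re (f s)) /\
  lebesgue_measurable_fun D (fun s => complex.Im (f s)).

Definition complex_absolutely_continuous (R : realType) (a b : R)
    (f : R -> R[i]) : Prop :=
  absolutely_continuous a b (fun s => complex.Re (f s)) /\
  absolutely_continuous a b (fun s => complex.Im (f s)).

Definition complex_is_derive (R : realType) (s : R) (f : R -> R[i]) (v : R[i])
    : Prop :=
  is_derive s 1 (fun r => complex.Re (f r)) (complex.Re v) /\
  is_derive s 1 (fun r => complex.Im (f r)) (complex.Im v).

(* phi s z stands for phi_{s,t}(z), only meaningful for 0 <= s <= t and z in
   the upper half-plane; the exceptional null set may depend on z. *)
Record solves_loewner (R : realType) (t : R) (M phi : R -> R[i] -> R[i])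
    : Prop := {
  solves_half_plane : forall (s : R) (z : R[i]), s \in `[0, t] ->
    upper_half_plane z -> upper_half_plane (phi s z) ;
  solves_abs_cont : forall z : R[i], upper_half_plane z ->
    complex_absolutely_continuous 0 t (phi ^~ z) ;
  solves_ode : forall z : R[i], upper_half_plane z ->
    {ae @lebesgue_measure R, forall s : R, s \in `[0, t] ->
      complex_is_derive s (phi ^~ z) (M s (phi s z))} ;
  solves_terminal : forall z : R[i], upper_half_plane z -> phi t z = z }.

(* Main.v *)
Require Import Defs.
From HB Require Import structures.
From mathcomp Require Import all_boot all_order all_algebra.
From mathcomp Require Import complex.
From mathcomp Require Import all_classical all_reals all_analysis.
From mathcomp Require Import measurable_realfun ring lra.
Import Order.TTheory GRing.Theory Num.Theory.
Import numFieldNormedType.Exports.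
Import ComplexField.Normc.
Set Implicit Arguments.
Unset Strict Implicit.
Unset Printing Implicit Defensive.
Local Open Scope classical_set_scope.
Local Open Scope ring_scope.
Local Open Scope complex_scope.

(** Let K be the class [cauchy_limit] of the pointwise limits, on the upper
    half-plane, of Cauchy transforms of finitely supported probability measures.
    The proof rests on three facts.

    Stability.  If g and h are in K and v >= 0, then z |-> h (z - v g z) is in K
    ([cauchy_limit_comp]), and so are averages of elements of K
    ([cauchy_limit_average]).  For discrete measures this is linear algebra:
    1 / (z - a - v G z) is an entry of the resolvent of a real symmetric matrix,
    and the spectral theorem makes it a sum of simple poles
    ([symmetric_resolvent]).

    Representation.  By Helly selection, g in K is m G_rho, with G_rho the Cauchy
    transform of a probability measure rho and 0 <= m <= 1
    ([cauchy_limit_representation]); moreover m = 1 if y Im g(iy) tends to -1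
    ([cauchy_limit_prob]).

    Variance.  The F-transforms of the probability measures of mean 0 and
    variance w are the maps z - w G_rho ([F_transform_moments],
    [F_transform_exists], [F_transform_representation]).

    From measures to the evolution family.  An element g of K satisfies
    |g z| <= 1 / Im z, Im g <= 0, and is Lipschitz with constant 1 / c^2 on
    Im z >= c.  So the solutions of the equation, which is solved backwards in
    time, only move upwards, and Picard iteration converges.  By stability, its
    iterates have the form z - (t - s) g with g in K; the same is true of their
    limit, and no mass is lost, by dominated convergence
    ([flow_cauchy_transform]).  Hence the solution is the F-transform of a centred
    measure of variance t - s.  Uniqueness, and with it the semigroup property,
    follow from the bound on the increments of an absolutely continuous function
    by a bound on its derivative ([absolutely_continuous_increment]).  Cauchy
    transforms depend continuously on the terminal time; as the second moments
    are bounded, this implies weak continuity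
    ([weakly_cvg_of_cauchy_transform]).  Since the data are only Lebesgue
    measurable in time, they are first modified on a null set
    ([borel_modification]).

    From the evolution family to measures.  The F-transform phi_{s,t}(z) is
    Lipschitz in s, hence derivable for almost every s ([lipschitz_ae_derive]).
    By the variance fact, phi_{s,s+h}(z) = z - h G(z) for a Cauchy transform G; a
    limit point M_s of these G as h tends to 0 is in K, and the semigroup
    property shows that the derivative at s is M_s(phi_{s,t}(z)) wherever it
    exists ([generator_exists]).  Finally M_s = m_s G_{nu_s}, and the integral of
    m over [0, t] is the variance t of sigma_{0,t}, so that m_s = 1 for almost
    every s ([generator_mass]). *)

Notation Re := complex.Re.
Notation Im := complex.Im.
Notation uhp := (@upper_half_plane _).

(** * The upper half-plane *)

Section ComplexNorm.
Context {R : realType}.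
Implicit Types (z w : R[i]) (a b : R).

Lemma ReD z w : Re (z + w) = Re z + Re w. Proof. by case: z w => ? ? []. Qed.
Lemma ImD z w : Im (z + w) = Im z + Im w. Proof. by case: z w => ? ? []. Qed.
Lemma ReN z : Re (- z) = - Re z. Proof. by case: z. Qed.
Lemma ImN z : Im (- z) = - Im z. Proof. by case: z. Qed.
Lemma ReB z w : Re (z - w) = Re z - Re w. Proof. by rewrite ReD ReN. Qed.
Lemma ImB z w : Im (z - w) = Im z - Im w. Proof. by rewrite ImD ImN. Qed.
Lemma ReZ a z : Re (a%:C * z) = a * Re z.
Proof. by case: z => u v /=; rewrite mul0r subr0. Qed.
Lemma ImZ a z : Im (a%:C * z) = a * Im z.
Proof. by case: z => u v /=; rewrite mul0r addr0. Qed.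
Lemma Re_sum (I : Type) (r : seq I) (P : pred I) (F : I -> R[i]) :
  Re (\sum_(i <- r | P i) F i) = \sum_(i <- r | P i) Re (F i).
Proof. by elim/big_rec2 : _ => //= i x y _ <-; rewrite ReD. Qed.
Lemma Im_sum (I : Type) (r : seq I) (P : pred I) (F : I -> R[i]) :
  Im (\sum_(i <- r | P i) F i) = \sum_(i <- r | P i) Im (F i).
Proof. by elim/big_rec2 : _ => //= i x y _ <-; rewrite ImD. Qed.
Lemma eqC_ReIm z w : Re z = Re w -> Im z = Im w -> z = w.
Proof. by case: z w => ? ? [? ?] /= -> ->. Qed.

Lemma normc_ge0 z : 0 <= normc z.
Proof. by case: z => a b; apply: sqrtr_ge0. Qed.
Lemma sqr_normcE z : normc z ^+ 2 = Re z ^+ 2 + Im z ^+ 2.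
Proof. by case: z => a b /=; rewrite sqr_sqrtr// addr_ge0 ?sqr_ge0. Qed.
Lemma normc_normE z : `|z| = (normc z)%:C. Proof. by case: z. Qed.
Lemma normr_Re_le z : `|Re z| <= normc z.
Proof.
rewrite -(ler_pXn2r (ltn0Sn 1)) ?nnegrE ?normc_ge0//.
by rewrite sqr_normcE real_normK ?num_real// lerDl sqr_ge0.
Qed.
Lemma normr_Im_le z : `|Im z| <= normc z.
Proof.
rewrite -(ler_pXn2r (ltn0Sn 1)) ?nnegrE ?normc_ge0//.
by rewrite sqr_normcE real_normK ?num_real// lerDr sqr_ge0.
Qed.
Lemma normc_leD z : normc z <= `|Re z| + `|Im z|.
Proof.
rewrite -(ler_pXn2r (ltn0Sn 1)) ?nnegrE ?normc_ge0//.
rewrite sqr_normcE sqrrD !real_normK ?num_real// lerD2r lerDl.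
by rewrite mulrn_wge0// mulr_ge0.
Qed.
Lemma normc_real a : normc a%:C = `|a|.
Proof. by rewrite /= expr0n addr0 sqrtr_sqr. Qed.
Lemma normcB z w : normc (z - w) = normc (w - z).
Proof. by rewrite -normcN opprB. Qed.
Lemma normc_sum_le (I : Type) (r : seq I) (P : pred I) (F : I -> R[i]) :
  normc (\sum_(i <- r | P i) F i) <= \sum_(i <- r | P i) normc (F i).
Proof.
elim/big_rec2 : _ => [|i x y _ h]; first by rewrite normc0.
by rewrite (le_trans (le_normcD _ _))// lerD2l.
Qed.
Lemma normc_triangle z1 z2 z3 : normc (z1 - z3) <= normc (z1 - z2) + normc (z2 - z3).
Proof. by rewrite (le_trans _ (le_normcD _ _))// addrA subrK. Qed.

Lemma uhp_neq0 z : uhp z -> z != 0.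
Proof.
rewrite /upper_half_plane/= => h; apply/eqP => z0; move: h.
by rewrite z0 ltxx.
Qed.
Lemma uhp_sub_real z a : uhp z -> uhp (z - a%:C).
Proof. by rewrite /upper_half_plane/= ImB subr0. Qed.
Lemma Im_le_normc z : Im z <= normc z.
Proof. by rewrite (le_trans (ler_norm _))// normr_Im_le. Qed.
Lemma normcV_le z : uhp z -> normc z^-1 <= (Im z)^-1.
Proof.
move=> hz; rewrite normcV lef_pV2 ?posrE//; first exact: Im_le_normc.
by rewrite (lt_le_trans hz)// Im_le_normc.
Qed.
Lemma normc_subV z w : uhp z -> uhp w ->
  normc (z^-1 - w^-1) <= normc (z - w) / (Im z * Im w).
Proof.
move=> hz hw.
have -> : z^-1 - w^-1 = (w - z) * z^-1 * w^-1.
  by field; rewrite !uhp_neq0.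
rewrite !normcM normcB invfM mulrA ler_pM ?mulr_ge0 ?normc_ge0 ?normcV_le//.
by rewrite ler_wpM2l ?normc_ge0// normcV_le.
Qed.
Lemma ReV z : Re z^-1 = Re z / normc z ^+ 2.
Proof. by rewrite sqr_normcE; case: z. Qed.
Lemma ImV z : Im z^-1 = - (Im z / normc z ^+ 2).
Proof. by rewrite sqr_normcE; case: z => a b /=; rewrite ?mulNr. Qed.
Lemma normc_gt0 z : z != 0 -> 0 < normc z.
Proof.
move=> z0; rewrite lt_neqAle normc_ge0 andbT eq_sym.
by apply: contra z0 => /eqP/eq0_normc ->.
Qed.
Lemma ImV_lt0 z : uhp z -> Im z^-1 < 0.
Proof.
move=> hz; rewrite ImV oppr_lt0 divr_gt0// exprn_gt0//.
by rewrite normc_gt0// uhp_neq0.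
Qed.
End ComplexNorm.

(** * Discrete Cauchy transforms and symmetric matrices *)

Section Spectral.
Context {R : realType}.
Local Notation C := R[i].

Import ssrnum.Num.Def.
Local Open Scope sesquilinear_scope.

Lemma conjCE (z : C) : Num.conj z = z^*%C.
Proof. by []. Qed.

(** The form <b, (z - A)^-1 b> is a sum of simple poles with nonnegative
    residues at the eigenvalues of A: diagonalize A.  The resolvent enters
    through a solution y of the linear system, so that it is enough to exhibit y
    where the lemma is used. *)
Lemma symmetric_resolvent n (a : 'I_n -> 'I_n -> R) (b : 'I_n -> R) :
  (forall i j, a i j = a j i) ->
  exists p x : 'I_n -> R, [/\ forall k, 0 <= p k,
    \sum_k p k = \sum_k b k ^+ 2 &
    forall (z : C) (y : 'I_n -> C), uhp z ->
      (forall i, z * y i - \sum_j (a i j)%:C * y j = (b i)%:C) ->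
      \sum_i (b i)%:C * y i = \sum_k (p k)%:C * (z - (x k)%:C)^-1].
Proof.
move=> asym.
pose A : 'M[C]_n := \matrix_(i, j) (a i j)%:C.
have Ah : A \is hermsymmx.
  apply/is_hermitianmxP; rewrite expr0 scale1r; apply/matrixP => i j.
  by rewrite !mxE asym conjCE conjc_real.
have := hermitian_normalmx Ah => /orthomx_spectralP.
set P := spectralmx A; set sp := spectral_diag A => AE.
have Pu : P \is unitarymx by exact: spectral_unitarymx.
have spr : sp \is a realmx := hermitian_spectral_diag_real Ah.
have PPt : P *m P^t* = 1%:M by apply/unitarymxP.
have PtP : P^t* *m P = 1%:M by rewrite -invmx_unitary// mulVmx// unitarymx_unit.
pose v : 'cV[C]_n := \col_i (b i)%:C.
pose v' := P *m v.
have spE k : sp 0 k = (Re (sp 0 k))%:C.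
  by rewrite RRe_real//; exact: (mxOverP spr).
have vrE : v^t* = \row_i (b i)%:C.
  by apply/rowP => i; rewrite !mxE conjCE conjc_real.
have dotE (y : 'cV[C]_n) : (v^t* *m y) 0 0 = \sum_i (b i)%:C * y i 0.
  by rewrite mxE; apply: eq_bigr => i _; rewrite vrE mxE.
have dotP (y : 'cV[C]_n) : v^t* *m y = v'^t* *m (P *m y).
  rewrite /v' trmx_mul map_mxM -mulmxA; congr (_ *m _).
  by rewrite mulmxA PtP mul1mx.
exists (fun k => normc (v' k 0) ^+ 2), (fun k => Re (sp 0 k)); split.
- by move=> k; rewrite sqr_ge0.
- apply: (@complexI R); rewrite !rmorph_sum/=.
  transitivity ((v^t* *m v) 0 0).
    rewrite dotP -/v' mxE; apply: eq_bigr => k _.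
    rewrite !mxE conjCE mulrC -sqr_normc.
    by rewrite rmorphXn/= normc_normE.
  by rewrite dotE; apply: eq_bigr => i _; rewrite mxE rmorphXn/= expr2.
- move=> z y hz hy.
  pose Y : 'cV[C]_n := \col_i y i.
  have YE : z *: Y - A *m Y = v.
    apply/colP => i; rewrite !mxE -hy; congr (_ - _).
    by apply: eq_bigr => j _; rewrite !mxE.
  have : P *m (z *: Y - A *m Y) = v' by rewrite YE.
  rewrite mulmxBr -scalemxAr AE invmx_unitary// !mulmxA PPt mul1mx -mulmxA.
  set Y' := P *m Y => Y'E.
  transitivity ((v^t* *m Y) 0 0).
    by rewrite dotE; apply: eq_bigr => i _; rewrite mxE.
  rewrite dotP -/Y'; clearbody Y' v'; rewrite mxE; apply: eq_bigr => k _.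
  have -> : v'^t* 0 k = (v' k 0)^*%C by rewrite !mxE conjCE.
  have /(congr1 (fun m : 'cV[C]_n => m k 0)) := Y'E.
  rewrite mul_diag_mx !mxE [X in _ - X * _]spE => E.
  have z0 : z - (Re (sp 0 k))%:C != 0 by apply/uhp_neq0/uhp_sub_real.
  have -> : Y' k 0 = v' k 0 / (z - (Re (sp 0 k))%:C).
    by apply: (mulIf z0); rewrite divfK// -E; ring.
  rewrite mulrA [X in X / _]mulrC -sqr_normc normc_normE.
  by rewrite -rmorphXn.
Qed.
End Spectral.

Section Discrete.
Context {R : realType}.
Implicit Types (d : seq (R * R)) (z w : R[i]).

(** A finitely supported measure is encoded by the list of its pairs
    (weight, atom). *)
Definition fcauchy d z : R[i] := \sum_(q <- d) q.1%:C * (z - q.2%:C)^-1.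
Definition fprob d := all (fun q => 0 <= q.1) d && (\sum_(q <- d) q.1 == 1).

Lemma fprob_dirac (a : R) : fprob [:: (1, a)].
Proof. by rewrite /fprob/= ler01 big_seq1/= eqxx. Qed.

Lemma fcauchy_dirac (a : R) z : fcauchy [:: (1, a)] z = (z - a%:C)^-1.
Proof. by rewrite /fcauchy big_seq1/= mul1r. Qed.

Lemma fprob_ge0 d q : fprob d -> q \in d -> 0 <= q.1.
Proof. by move=> /andP[/allP h _]; exact: h. Qed.

Lemma fprob_sum d : fprob d -> \sum_(q <- d) q.1 = 1.
Proof. by move=> /andP[_ /eqP]. Qed.

Lemma le_sum_seq (T : eqType) (r : seq T) (F G : T -> R) :
  (forall q, q \in r -> F q <= G q) -> \sum_(q <- r) F q <= \sum_(q <- r) G q.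
Proof. by move=> h; rewrite big_seq [leRHS]big_seq; apply: ler_sum. Qed.

Lemma fcauchy_le d z : fprob d -> uhp z -> normc (fcauchy d z) <= (Im z)^-1.
Proof.
move=> dP hz; rewrite (le_trans (normc_sum_le _ _ _))//.
rewrite -[leRHS]mul1r -(fprob_sum dP) mulr_suml le_sum_seq// => q qd.
rewrite normcM normc_real ger0_norm ?(fprob_ge0 dP)// ler_wpM2l ?(fprob_ge0 dP)//.
rewrite (le_trans (normcV_le (uhp_sub_real _ hz)))//.
by rewrite ImB/= subr0.
Qed.

Lemma fcauchy_Im_lt0 d z : fprob d -> uhp z -> Im (fcauchy d z) < 0.
Proof.
move=> dP hz.
have h q : Im (z - q%:C)^-1 < 0 by apply/ImV_lt0/uhp_sub_real.
rewrite -oppr_gt0 Im_sum -sumrN.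
have h0 q : q \in d -> 0 <= - Im (q.1%:C * (z - q.2%:C)^-1).
  by move=> qd; rewrite ImZ -mulrN mulr_ge0 ?(fprob_ge0 dP)// oppr_ge0 ltW.
rewrite lt_neqAle; apply/andP; split; last first.
  by rewrite big_seq sumr_ge0.
apply/negP => /eqP/esym; rewrite big_seq => /eqP; rewrite psumr_eq0// => /allP d0.
have := fprob_sum dP; rewrite big_seq big1; last first.
  move=> q qd; have := d0 _ qd; rewrite qd/= ImZ oppr_eq0 mulf_eq0.
  by rewrite (lt_eqF (h _)) orbF => /eqP.
by move=> /eqP; rewrite eq_sym oner_eq0.
Qed.

(** Only the proportions of the weights matter; a family of zero weights is
    represented by the zero multiple of an arbitrary law. *)
Lemma fcauchy_normalize n (p x : 'I_n -> R) (w : R) :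
  (forall k, 0 <= p k) -> \sum_k p k = w ->
  exists2 d, fprob d & forall z,
    \sum_k (p k)%:C * (z - (x k)%:C)^-1 = w%:C * fcauchy d z.
Proof.
move=> p0 pw; have [w0|w0] := eqVneq w 0.
  exists [:: (1, 0)]; first exact: fprob_dirac.
  move=> z; rewrite w0 mul0r big1// => k _.
  move: pw; rewrite w0 => /eqP; rewrite psumr_eq0//.
  by move=> /allP/(_ k); rewrite mem_index_enum => /(_ isT)/eqP ->; rewrite mul0r.
have wp : 0 < w by rewrite lt_neqAle eq_sym w0 -pw sumr_ge0.
exists [seq (p k / w, x k) | k <- enum 'I_n].
  apply/andP; split.
    by apply/allP => _ /mapP[k _ ->]/=; rewrite divr_ge0// ltW.
  by rewrite big_map big_enum/= -mulr_suml pw divff.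
move=> z; rewrite /fcauchy big_map big_enum/= mulr_sumr; apply: eq_bigr => k _.
by rewrite mulrA -rmorphM/= mulrCA divff// mulr1.
Qed.

(** Bordering the diagonal matrix of the atoms by the corner entry a and by the
    vector of the sqrt (v p_i) gives a symmetric matrix; by Schur complement,
    the corner entry of its resolvent is the left-hand side. *)
Lemma fcauchy_shift d (a v : R) : fprob d -> 0 <= v ->
  exists2 d', fprob d' & forall z, uhp z ->
    (z - a%:C - v%:C * fcauchy d z)^-1 = fcauchy d' z.
Proof.
move=> dP v0; pose n := size d; pose q (i : 'I_n) := tnth (in_tuple d) i.
have qp i : 0 <= (q i).1 by rewrite (fprob_ge0 dP)// mem_tnth.
pose c i := Num.sqrt (v * (q i).1).
pose A (i j : 'I_n.+1) : R := match unlift ord0 i, unlift ord0 j with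
  | None, None => a | Some i, None => c i | None, Some j => c j
  | Some i, Some j => (i == j)%:R * (q i).2 end.
pose b (i : 'I_n.+1) : R := (i == ord0)%:R.
have [|p [x [p0 ps hp]]] := symmetric_resolvent (a := A) b.
  move=> i j; rewrite /A; case: unliftP => [i'|] _; case: unliftP => [j'|] _ //.
  by rewrite eq_sym; case: eqP => [->|]//; rewrite !mul0r.
have ps1 : \sum_k p k = 1.
  by rewrite ps big_ord_recl /b eqxx expr1n big1 ?addr0// => i _; rewrite expr0n.
have [d' d'P d'E] := fcauchy_normalize x p0 ps1.
exists d' => // z hz.
set y0 := (X in X = _).
pose y i := if unlift ord0 i is Some i then (c i)%:C * y0 / (z - ((q i).2)%:C) else y0.
have yl k : y (lift ord0 k) = (c k)%:C * y0 / (z - ((q k).2)%:C) by rewrite /y liftK.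
have y00 : y ord0 = y0 by rewrite /y unlift_none.
have zq i : z - ((q i).2)%:C != 0 by apply/uhp_neq0/uhp_sub_real.
have GE : v%:C * fcauchy d z = \sum_i (c i)%:C ^+ 2 / (z - ((q i).2)%:C).
  rewrite /fcauchy big_tnth mulr_sumr; apply: eq_bigr => i _.
  by rewrite -rmorphXn/= sqr_sqrtr ?mulr_ge0// rmorphM/= mulrA.
have D0 : z - a%:C - v%:C * fcauchy d z != 0.
  apply: uhp_neq0; rewrite /upper_half_plane/= ImB ImZ ImB subr0 -mulrN.
  rewrite ltr_wpDr// mulr_ge0// oppr_ge0 ltW//.
  exact: fcauchy_Im_lt0.
have := hp z y hz.
rewrite big_ord_recl /b eqxx big1 ?addr0; last by move=> i _; rewrite mul0r.
rewrite y00 mul1r => ->.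
  by rewrite d'E mul1r.
move=> i; rewrite big_ord_recl.
case: (unliftP ord0 i) => [j|] ->.
  rewrite yl y00 /A liftK unlift_none (bigD1 j)//= yl liftK eqxx mul1r big1.
    by rewrite addr0 -[RHS]/(0 : R[i]); field; exact: zq.
  by move=> k kj; rewrite liftK eq_sym (negbTE kj) mul0r mul0r.
rewrite y00 eqxx /A unlift_none.
rewrite (eq_bigr (fun k => y0 * ((c k)%:C ^+ 2 / (z - ((q k).2)%:C)))); last first.
  by move=> k _; rewrite liftK yl; field; exact: zq.
rewrite -mulr_sumr -GE opprD addrA (mulrC _ y0) (mulrC _ y0) -!mulrBr.
by rewrite /y0 mulVf.
Qed.

(** Let D be the diagonal matrix of the atoms and u the unit vector of the
    sqrt p_i, so that the Cauchy transform is <u, (z - D)^-1 u>.  Schur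
    complement along u gives its reciprocal as z - m - <b, (z - Q D Q)^-1 b>,
    with Q the projection onto the orthogonal of u and b = Q D u. *)
Lemma fcauchy_inv d : fprob d ->
  let m := \sum_(q <- d) q.1 * q.2 in
  exists2 d', fprob d' & forall z, uhp z ->
    (fcauchy d z)^-1 = z - m%:C
      - (\sum_(q <- d) q.1 * (q.2 - m) ^+ 2)%:C * fcauchy d' z.
Proof.
move=> dP m; pose n := size d; pose q (i : 'I_n) := tnth (in_tuple d) i.
have qp i : 0 <= (q i).1 by rewrite (fprob_ge0 dP)// mem_tnth.
pose u i := Num.sqrt (q i).1.
have uE i : u i ^+ 2 = (q i).1 by rewrite sqr_sqrtr.
pose A (i j : 'I_n) : R := (i == j)%:R * (q i).2
  - u i * u j * ((q i).2 + (q j).2) + m * u i * u j.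
pose b i := ((q i).2 - m) * u i.
have [|p [x [p0 ps hp]]] := symmetric_resolvent (a := A) b.
  move=> i j; rewrite /A eq_sym; case: eqP => [->//|_].
  by rewrite !mul0r; ring.
have ps1 : \sum_k p k = \sum_(q <- d) q.1 * (q.2 - m) ^+ 2.
  rewrite ps [RHS]big_tnth; apply: eq_bigr => i _.
  by rewrite /b exprMn uE mulrC.
have [d' d'P d'E] := fcauchy_normalize x p0 ps1.
exists d' => // z hz; rewrite -d'E.
have zq i : z - ((q i).2)%:C != 0 by apply/uhp_neq0/uhp_sub_real.
set G := fcauchy d z.
have G0 : G != 0.
  by apply/eqP => G0; have := fcauchy_Im_lt0 dP hz; rewrite -/G G0 ltxx.
have uEC i : (u i)%:C ^+ 2 = ((q i).1)%:C by rewrite -rmorphXn/= uE.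
have GE : G = \sum_i (u i)%:C ^+ 2 / (z - ((q i).2)%:C).
  by rewrite /G /fcauchy big_tnth; apply: eq_bigr => i _; rewrite uEC.
have sum1 : \sum_i (u i)%:C ^+ 2 = 1.
  under eq_bigr do rewrite uEC.
  rewrite -rmorph_sum/=.
  by rewrite -(big_tnth _ _ _ predT (fun q => q.1)) (fprob_sum dP).
have mE : m%:C = \sum_i (u i)%:C ^+ 2 * ((q i).2)%:C.
  rewrite /m big_tnth rmorph_sum/=; apply: eq_bigr => i _.
  by rewrite uEC rmorphM.
pose y i := (u i)%:C / (z - ((q i).2)%:C) / G - (u i)%:C.
have uy : \sum_j (u j)%:C * y j = 0.
  rewrite (eq_bigr (fun i => (u i)%:C ^+ 2 / (z - ((q i).2)%:C) / G - (u i)%:C ^+ 2)).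
    by rewrite sumrB -mulr_suml -GE sum1 divff// subrr.
  by move=> i _; rewrite /y; field; rewrite G0 zq.
have quy : \sum_j ((q j).2)%:C * (u j)%:C * y j = z - G^-1 - m%:C.
  rewrite mE (eq_bigr (fun i => z / G * ((u i)%:C ^+ 2 / (z - ((q i).2)%:C)) -
     (u i)%:C ^+ 2 / G - (u i)%:C ^+ 2 * ((q i).2)%:C)).
    rewrite !sumrB -mulr_sumr -GE -mulr_suml sum1 mul1r divfK//.
  by move=> i _; rewrite /y; field; rewrite G0 zq.
have -> : \sum_k (p k)%:C * (z - (x k)%:C)^-1 = z - G^-1 - m%:C.
  rewrite -(hp z y hz).
    rewrite (eq_bigr (fun i => ((q i).2)%:C * (u i)%:C * y i - m%:C * ((u i)%:C * y i))).
      by rewrite sumrB quy -mulr_sumr uy mulr0 subr0.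
    by move=> i _; rewrite /b rmorphM rmorphB/=; ring.
  move=> i.
  rewrite (eq_bigr (fun j => (i == j)%:R * ((q i).2)%:C * y j
    - (u i)%:C * ((q i).2)%:C * ((u j)%:C * y j)
    - (u i)%:C * (((q j).2)%:C * (u j)%:C * y j)
    + m%:C * (u i)%:C * ((u j)%:C * y j))); last first.
    move=> j _; rewrite /A !rmorphD rmorphN/= !rmorphM rmorphD/=.
    by rewrite rmorph_nat; ring.
  rewrite big_split/= !sumrB -!mulr_sumr uy quy !mulr0 addr0 subr0.
  rewrite (bigD1 i)//= eqxx mul1r big1 ?addr0; last first.
    by move=> j ji; rewrite eq_sym (negbTE ji) !mul0r.
  by rewrite /b /y rmorphM rmorphB/=; field; rewrite G0 zq.
ring.
Qed.

End Discrete.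

(** * Pointwise limits of discrete Cauchy transforms *)

Section CauchyLimits.
Context {R : realType}.
Implicit Types (d : seq (R * R)) (z w : R[i]) (g h : R[i] -> R[i]).

(** The closure of the discrete Cauchy transforms for pointwise convergence on
    the half-plane.  This class has the same stability properties as the Cauchy
    transforms of measures, but membership is elementary: the measures, and
    their masses, appear only at the end of a construction. *)
Definition cauchy_limit g := forall zs : seq R[i],
  (forall z, z \in zs -> uhp z) -> forall e : R, 0 < e ->
  exists2 d, fprob d & forall z, z \in zs -> normc (fcauchy d z - g z) < e.

Lemma cauchy_limit_fcauchy d : fprob d -> cauchy_limit (fcauchy d).
Proof. by move=> dP zs _ e e0; exists d => // z _; rewrite subrr normc0. Qed.

Lemma cauchy_limit_closed g : (forall zs : seq R[i],
  (forall z, z \in zs -> uhp z) -> forall e : R, 0 < e ->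
  exists2 h, cauchy_limit h & forall z, z \in zs -> normc (h z - g z) < e) ->
  cauchy_limit g.
Proof.
move=> H zs zsP e e0.
have e20 : 0 < e / 2 by rewrite divr_gt0.
have [h hP hg] := H zs zsP _ e20; have [d dP dh] := hP zs zsP _ e20.
exists d => // z zzs; rewrite (le_lt_trans (normc_triangle _ (h z) _))//.
by rewrite (splitr e) ltrD// ?dh// hg.
Qed.

Lemma eq_cauchy_limit g h : (forall z, uhp z -> g z = h z) ->
  cauchy_limit g -> cauchy_limit h.
Proof.
move=> gh gP zs zsP e e0; have [d dP dg] := gP zs zsP e e0.
by exists d => // z zzs; rewrite -gh; [exact: dg|exact: zsP].
Qed.

Lemma cauchy_limit_pole (x : R) : cauchy_limit (fun z => (z - x%:C)^-1).
Proof.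
apply: eq_cauchy_limit (cauchy_limit_fcauchy (fprob_dirac x)) => z _.
exact: fcauchy_dirac.
Qed.

Lemma fcauchy_scale (a : R) d z :
  fcauchy [seq (a * q.1, q.2) | q <- d] z = a%:C * fcauchy d z.
Proof.
rewrite /fcauchy big_map mulr_sumr; apply: eq_bigr => q _/=.
by rewrite rmorphM mulrA.
Qed.

Lemma cauchy_limit_convex n (p : 'I_n -> R) (g : 'I_n -> R[i] -> R[i]) :
  (forall i, 0 <= p i) -> \sum_i p i = 1 -> (forall i, cauchy_limit (g i)) ->
  cauchy_limit (fun z => \sum_i (p i)%:C * g i z).
Proof.
move=> p0 p1 gP zs zsP e e0.
have /choice[d dP] : forall i, exists d, fprob d /\
    forall z, z \in zs -> normc (fcauchy d z - g i z) < e.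
  by move=> i; have [d ? ?] := gP i zs zsP e e0; exists d.
exists (flatten [seq [seq (p i * q.1, q.2) | q <- d i] | i <- enum 'I_n]).
  apply/andP; split.
    apply/allP => q /flattenP[s /mapP[i _ ->] /mapP[q' q'd ->]]/=.
    by rewrite mulr_ge0// (fprob_ge0 (dP i).1).
  rewrite big_flatten/= big_map big_enum/= -p1; apply/eqP/eq_bigr => i _.
  by rewrite big_map/= -mulr_sumr (fprob_sum (dP i).1) mulr1.
move=> z zzs; rewrite /fcauchy big_flatten/= big_map big_enum/= -sumrB.
rewrite (eq_bigr (fun i => (p i)%:C * (fcauchy (d i) z - g i z))); last first.
  by move=> i _; rewrite -/(fcauchy _ z) fcauchy_scale mulrBr.
rewrite (le_lt_trans (normc_sum_le _ _ _))//.
rewrite (eq_bigr (fun i => p i * normc (fcauchy (d i) z - g i z))); last first.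
  by move=> i _; rewrite normcM normc_real ger0_norm.
have [i pi0] : exists i, 0 < p i.
  apply/not_existsP => h; have := p1; rewrite big1; first by move/eqP; rewrite eq_sym oner_eq0.
  by move=> i _; apply/eqP; rewrite eq_le p0 andbT leNgt; apply/negP/h.
rewrite -[ltRHS]mul1r -p1 mulr_suml (bigD1 i)//= [ltRHS](bigD1 i)//=.
rewrite ltr_leD ?ltr_pM2l ?(dP i).2// ler_sum// => j _.
by rewrite ler_wpM2l// ltW// (dP j).2.
Qed.

Lemma fcauchy_lipschitz d z w : fprob d -> uhp z -> uhp w ->
  normc (fcauchy d z - fcauchy d w) <= normc (z - w) / (Im z * Im w).
Proof.
move=> dP hz hw; rewrite /fcauchy -sumrB (le_trans (normc_sum_le _ _ _))//.
rewrite -[leRHS]mul1r -(fprob_sum dP) mulr_suml le_sum_seq// => q qd.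
rewrite -mulrBr normcM normc_real ger0_norm ?(fprob_ge0 dP)//.
rewrite ler_wpM2l ?(fprob_ge0 dP)//.
rewrite (le_trans (normc_subV (uhp_sub_real _ hz) (uhp_sub_real _ hw)))//.
by rewrite !ImB/= !subr0 opprB addrA subrK.
Qed.

Lemma cauchy_limit_le g z : cauchy_limit g -> uhp z -> normc (g z) <= (Im z)^-1.
Proof.
move=> gP hz; apply/ler_addgt0Pl => e e0.
have [|d dP dg] := gP [:: z] _ e e0; first by move=> w; rewrite inE => /eqP ->.
rewrite -[g z](subrK (fcauchy d z)) (le_trans (le_normcD _ _))//.
by rewrite lerD ?fcauchy_le// normcB ltW// dg// inE.
Qed.

Lemma cauchy_limit_Im_le0 g z : cauchy_limit g -> uhp z -> Im (g z) <= 0.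
Proof.
move=> gP hz; apply/ler_addgt0Pl => e e0.
have [|d dP dg] := gP [:: z] _ e e0; first by move=> w; rewrite inE => /eqP ->.
rewrite addr0 -[g z](subrK (fcauchy d z)) ImD -[e]addr0 lerD//.
  rewrite (le_trans (Im_le_normc _))// normcB ltW// dg// inE//.
exact/ltW/fcauchy_Im_lt0.
Qed.

Lemma cauchy_limit_lipschitz g z w : cauchy_limit g -> uhp z -> uhp w ->
  normc (g z - g w) <= normc (z - w) / (Im z * Im w).
Proof.
move=> gP hz hw; apply/ler_addgt0Pl => e e0.
have e20 : 0 < e / 2 by rewrite divr_gt0.
have [|d dP dg] := gP [:: z; w] _ _ e20.
  by move=> v; rewrite !inE => /orP[] /eqP ->.
have -> : g z - g w = (g z - fcauchy d z) + (fcauchy d w - g w) +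
    (fcauchy d z - fcauchy d w) by ring.
rewrite (le_trans (le_normcD _ _))// lerD ?fcauchy_lipschitz//.
rewrite (le_trans (le_normcD _ _))// (splitr e) lerD// ltW//.
  by rewrite normcB dg// inE eqxx.
by rewrite dg// !inE eqxx orbT.
Qed.

Lemma uhp_shift g (v : R) z : cauchy_limit g -> 0 <= v -> uhp z ->
  uhp (z - v%:C * g z).
Proof.
move=> gP v0 hz; rewrite /upper_half_plane/= ImB ImZ -mulrN ltr_wpDr//.
by rewrite mulr_ge0// oppr_ge0 cauchy_limit_Im_le0.
Qed.

Lemma Im_shift_ge g (v : R) z : cauchy_limit g -> 0 <= v -> uhp z ->
  Im z <= Im (z - v%:C * g z).
Proof.
move=> gP v0 hz; rewrite ImB ImZ -mulrN lerDl.
by rewrite mulr_ge0// oppr_ge0 cauchy_limit_Im_le0.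
Qed.

(** This is fcauchy_shift for discrete measures; inversion is Lipschitz on the
    values at finitely many points, whose imaginary parts are bounded below. *)
Lemma cauchy_limit_shift g (a v : R) : cauchy_limit g -> 0 <= v ->
  cauchy_limit (fun z => (z - a%:C - v%:C * g z)^-1).
Proof.
move=> gP v0; apply: cauchy_limit_closed => zs zsP e e0.
pose mx := \big[Num.max/1]_(z <- zs) (Im z)^-1.
have mx1 : 1 <= mx by rewrite /mx; elim/big_rec : _ => // i x _ h; rewrite le_max h orbT.
have mxP z : z \in zs -> (Im z)^-1 <= mx.
  rewrite /mx; elim: (zs) => //= w s IH; rewrite inE big_cons le_max.
  by move=> /orP[/eqP ->|/IH ->]; rewrite ?lexx ?orbT.
pose e' := e / ((v + 1) * mx ^+ 2).
have mx0 : 0 < mx by rewrite (lt_le_trans _ mx1).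
have v10 : 0 < v + 1 by rewrite ltr_wpDl.
have e'0 : 0 < e' by rewrite divr_gt0// mulr_gt0// exprn_gt0.
have [d dP dg] := gP zs zsP e' e'0.
have [d' d'P d'E] := fcauchy_shift a dP v0.
exists (fcauchy d'); first exact: cauchy_limit_fcauchy.
move=> z zzs; have hz := zsP z zzs; rewrite -d'E//.
set A := (X in normc (X^-1 - _)); set B := (X in normc (_ - X^-1)).
have hA0 : Im z <= Im A.
  rewrite /A addrAC ImB/= subr0 ImB ImZ -mulrN lerDl mulr_ge0// oppr_ge0.
  exact/ltW/fcauchy_Im_lt0.
have hA : uhp A by apply: lt_le_trans hA0.
have hB0 : Im z <= Im B by rewrite /B addrAC ImB/= subr0 Im_shift_ge.
have hB : uhp B by apply: lt_le_trans hB0.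
rewrite (le_lt_trans (normc_subV hA hB))//.
have -> : A - B = (- v)%:C * (fcauchy d z - g z) by rewrite /A /B rmorphN/=; ring.
rewrite normcM normc_real normrN ger0_norm// invfM.
apply: (@le_lt_trans _ _ (v * normc (fcauchy d z - g z) * (mx * mx))).
  rewrite ler_wpM2l ?mulr_ge0 ?normc_ge0// ler_pM ?invr_ge0 ?(ltW hA) ?(ltW hB)//.
    by rewrite (le_trans _ (mxP _ zzs))// lef_pV2 ?posrE.
  by rewrite (le_trans _ (mxP _ zzs))// lef_pV2 ?posrE.
apply: (@le_lt_trans _ _ (v * e' * (mx * mx))).
  by rewrite ler_wpM2r ?mulr_ge0 ?(ltW mx0)// ler_wpM2l// ltW// dg.
rewrite -(expr2 mx) (_ : v * e' * _ = e * (v / (v + 1))).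
  by rewrite gtr_pMr// ltr_pdivrMr// mul1r ltrDl.
by rewrite /e'; field; rewrite !gt_eqF.
Qed.

(** When h is a discrete Cauchy transform, the composition is a convex
    combination of reciprocals of shifts of g. *)
Lemma cauchy_limit_comp g h (v : R) : cauchy_limit g -> cauchy_limit h -> 0 <= v ->
  cauchy_limit (fun z => h (z - v%:C * g z)).
Proof.
move=> gP hP v0; apply: cauchy_limit_closed => zs zsP e e0.
have [|d dP dh] := hP [seq z - v%:C * g z | z <- zs] _ e e0.
  by move=> _ /mapP[z zzs ->]; apply: uhp_shift => //; exact: zsP.
exists (fun z => fcauchy d (z - v%:C * g z)); last first.
  by move=> z zzs; rewrite dh//; apply/mapP; exists z.
pose q (i : 'I_(size d)) := tnth (in_tuple d) i.
apply: (@eq_cauchy_limit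
    (fun z => \sum_i ((q i).1)%:C * (z - ((q i).2)%:C - v%:C * g z)^-1)).
  move=> z _; rewrite /fcauchy [RHS]big_tnth; apply: eq_bigr => i _.
  by rewrite addrAC.
apply: (@cauchy_limit_convex _ (fun i => (q i).1)
   (fun i z => (z - ((q i).2)%:C - v%:C * g z)^-1)).
- by move=> i; rewrite (fprob_ge0 dP)// mem_tnth.
- by rewrite -(big_tnth _ _ _ predT (fun q => q.1)) (fprob_sum dP).
- by move=> i; exact: cauchy_limit_shift.
Qed.

End CauchyLimits.

Section Sampling.
Context {R : realType}.

Lemma lipschitz_continuous (f : R -> R) (K : R) :
  (forall x y, `|f x - f y| <= K * `|x - y|) -> continuous f.
Proof.
move=> fK x; apply/cvgrPdist_lt => e e0.
have K1 : 0 < `|K| + 1 by rewrite ltr_wpDl.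
near=> y; rewrite (le_lt_trans (fK _ _))//.
apply: (@le_lt_trans _ _ ((`|K| + 1) * `|x - y|)).
  by rewrite ler_wpM2r// (le_trans (ler_norm _))// lerDl.
rewrite mulrC -ltr_pdivlMr//; near: y.
by apply: (cvgr_dist_lt (F := nbhs x)); rewrite ?divr_gt0//; exact: cvg_id.
Unshelve. all: by end_near. Qed.

Context d (T : measurableType d) (mu : {measure set T -> \bar R}).

Lemma bounded_Rintegrable (E : set T) (c : R) (f : T -> R) (K : R) :
  measurable E -> mu E = c%:E -> measurable_fun E f ->
  (forall t, E t -> `|f t| <= K) -> mu.-integrable E (EFin \o f).
Proof.
move=> mE muE mf fK; apply: measurable_bounded_integrable => //.
  by rewrite muE ltry.
exists K; split; first by rewrite num_real.
by move=> x Kx t Et; exact: le_trans (fK _ Et) (ltW Kx).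
Qed.

Lemma Rintegral_sum (E : set T) (I : Type) (s : seq I) (f : I -> T -> R) :
  measurable E -> (forall i, mu.-integrable E (EFin \o f i)) ->
  \int[mu]_(x in E) (\sum_(i <- s) f i x) = \sum_(i <- s) \int[mu]_(x in E) f i x.
Proof.
move=> mE fi; rewrite /Rintegral.
under eq_integral do rewrite -sumEFin.
rewrite integral_sum// (eq_bigr (fun i => (\int[mu]_(x in E) f i x)%:E)).
  by rewrite sumEFin.
by move=> i _; rewrite /Rintegral fineK//; exact: integrable_fin_num (fi i).
Qed.

(** Averages are approximated by finite sample means.  The points are chosen
    greedily: if the accumulated error is the vector S, some point has a
    deviation whose inner product with S is not positive (up to 1), since that
    inner product has mean zero; so the square of the error grows linearly in
    the number of points. *)
Lemma sample_mean (E : set T) (c : R) (I : finType) (f : I -> T -> R) (K : R) :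
  measurable E -> mu E = c%:E -> 0 < c ->
  (forall k, measurable_fun E (f k)) ->
  (forall k t, E t -> `|f k t| <= K) ->
  forall e : R, 0 < e -> exists N (t : 'I_N.+1 -> T), (forall i, E (t i)) /\
    forall k, `|\sum_i N.+1%:R^-1 * f k (t i) - c^-1 * \int[mu]_(x in E) f k x| < e.
Proof.
move=> mE muE c0 mf fK e e0.
have fi k : mu.-integrable E (EFin \o f k) := bounded_Rintegrable mE muE (mf k) (fK k).
pose a k := c^-1 * \int[mu]_(x in E) f k x.
have cint (r : R) : mu.-integrable E (EFin \o cst r).
  by apply: (bounded_Rintegrable mE muE (K := `|r|)).
have cE (r : R) : \int[mu]_(x in E) r = r * c by rewrite Rintegral_cst// muE.
have fai k : mu.-integrable E (EFin \o (fun x => f k x - a k)).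
  by apply: (@integrableB _ _ _ _ _ mE _ _ (fi k) (cint (a k))).
have fa0 k : \int[mu]_(x in E) (f k x - a k) = 0.
  rewrite (RintegralB mE (fi k) (cint (a k))).
  by rewrite cE /a mulrAC mulVf ?gt_eqF// mul1r subrr.
have aK k : `|a k| <= K.
  have K0 : 0 <= K.
    have [t Et] : exists t, E t.
      apply/not_existsP => h; have : mu E = 0%E.
        by rewrite (_ : E = set0) ?measure0//; apply/seteqP; split => x // /h.
      by rewrite muE => -[] /eqP; rewrite gt_eqF.
    exact: le_trans (fK k t Et).
  rewrite /a normrM normfV (gtr0_norm c0) ler_pdivrMl// mulrC.
  rewrite (le_trans (le_normr_Rintegral _ _))//.
  rewrite -cE le_Rintegral//; [exact: integrable_norm|exact: cint|exact: fK].
pose C := 2 + #|I|%:R * (K + K) ^+ 2.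
have C0 : 0 < C.
  by rewrite /C ltr_wpDr// mulr_ge0// sqr_ge0.
have step (S : I -> R) : exists2 t, E t & \sum_k S k * (f k t - a k) <= 1.
  apply/not_exists2P => h.
  have h1 t : E t -> 1 <= \sum_k S k * (f k t - a k).
    by move=> Et; case: (h t) => // /negP; rewrite -ltNge => /ltW.
  have hi k : mu.-integrable E (EFin \o (fun t => S k * (f k t - a k))).
    exact: (@integrableZl _ _ _ _ _ mE (S k) _ (fai k)).
  have : \int[mu]_(t in E) 1 <= \int[mu]_(t in E) (\sum_k S k * (f k t - a k)).
    apply: le_Rintegral => //; first exact: cint.
    have := @integrable_sum _ _ _ mu E mE I (index_enum I) predT _ (fun i _ => hi i).
    apply: eq_integrable => // x _.
    by rewrite /= sumEFin.
  rewrite cE mul1r Rintegral_sum// big1 ?leNgt ?c0// => k _.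
  by rewrite RintegralZl// fa0 mulr0.
have main N : exists t : 'I_N -> T, (forall i, E (t i)) /\
    \sum_k (\sum_i (f k (t i) - a k)) ^+ 2 <= N%:R * C.
  elim: N => [|N [t [tE tC]]].
    have [t Et _] := step (fun=> 0).
    exists (fun=> t); split => //; rewrite mul0r big1// => k _.
    by rewrite big_ord0 expr0n.
  have [u uE uS] := step (fun k => \sum_i (f k (t i) - a k)).
  exists (fun i => oapp t u (unlift ord_max i)); split.
    by move=> i; case: unliftP => [j|] _ /=; [exact: tE|exact: uE].
  rewrite (eq_bigr (fun k => (\sum_i (f k (t i) - a k)) ^+ 2 +
     (2 * ((\sum_i (f k (t i) - a k)) * (f k u - a k)) + (f k u - a k) ^+ 2))); last first.
    move=> k _; rewrite big_ord_recr/= unlift_none/=.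
    rewrite (eq_bigr (fun i => f k (t i) - a k)); last first.
      move=> i _; have -> : widen_ord (leqnSn N) i = lift ord_max i.
        by apply: val_inj; rewrite /= /bump leqNgt ltn_ord.
      by rewrite liftK.
    by rewrite sqrrD -mulr_natl -addrA.
  rewrite big_split/= -[N.+1]addn1 natrD mulrDl mul1r lerD//.
  rewrite big_split/= -mulr_sumr /C lerD//.
    by rewrite -[leRHS]mulr1 ler_wpM2l.
  rewrite mulr_natl -sumr_const ler_sum// => k _.
  rewrite -[leLHS]real_normK ?num_real// lerXn2r ?nnegrE//.
    by rewrite addr_ge0// (le_trans _ (aK k)).
  by rewrite (le_trans (ler_normB _ _))// lerD// fK.
have [N NC] : exists N : nat, C < N.+1%:R * e ^+ 2.
  exists (Num.trunc (C / e ^+ 2)); rewrite -ltr_pdivrMr ?exprn_gt0//.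
  by rewrite truncnS_gt.
have [t [tE tC]] := main N.+1.
exists N, t; split => // k; rewrite -/(a k).
rewrite -mulr_sumr -(ltr_pXn2r (ltn0Sn 1)) ?nnegrE ?(ltW e0)// real_normK ?num_real//.
have -> : N.+1%:R^-1 * \sum_i f k (t i) - a k = N.+1%:R^-1 * \sum_i (f k (t i) - a k).
  by rewrite sumrB sumr_const card_ord -[a k *+ _]mulr_natl mulrBr [_ * (_ * a k)]mulrA mulVf ?pnatr_eq0// mul1r.
have : (\sum_i (f k (t i) - a k)) ^+ 2 <= N.+1%:R * C.
  rewrite (le_trans _ tC)// (bigD1 k)//= lerDl.
  by rewrite sumr_ge0// => j _; rewrite sqr_ge0.
rewrite exprMn exprVn => h.
apply: (@le_lt_trans _ _ (N.+1%:R ^- 2 * (N.+1%:R * C))).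
  by rewrite ler_wpM2l// invr_ge0 sqr_ge0.
have -> (n : R) : n != 0 -> n ^- 2 * (n * C) = C / n by move=> n0; field.
  by rewrite ltr_pdivrMr// mulrC.
by rewrite pnatr_eq0.
Qed.

(** At finitely many points, an average is close to a convex combination, by
    sample_mean. *)
Lemma cauchy_limit_average (E : set T) (c : R) (g : T -> R[i] -> R[i]) (G : R[i] -> R[i]) :
  measurable E -> mu E = c%:E -> 0 < c ->
  (forall t, E t -> cauchy_limit (g t)) ->
  (forall z, uhp z -> measurable_fun E (fun t => Re (g t z))) ->
  (forall z, uhp z -> measurable_fun E (fun t => Im (g t z))) ->
  (forall z, uhp z -> Re (G z) = c^-1 * \int[mu]_(t in E) Re (g t z)) ->
  (forall z, uhp z -> Im (G z) = c^-1 * \int[mu]_(t in E) Im (g t z)) ->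
  cauchy_limit G.
Proof.
move=> mE muE c0 gP mRe mIm GRe GIm; apply: cauchy_limit_closed => zs zsP e e0.
pose z (i : 'I_(size zs)) := tnth (in_tuple zs) i.
have zP i : uhp (z i) by apply: zsP; rewrite mem_tnth.
pose f (k : 'I_(size zs) * bool) t := if k.2 then Re (g t (z k.1)) else Im (g t (z k.1)).
pose K := \sum_i (Im (z i))^-1.
have e20 : 0 < e / 2 by rewrite divr_gt0.
have [||N [t [tE tP]]] := @sample_mean E c _ f K mE muE c0 _ _ _ e20.
- by move=> -[i []]; rewrite /f/=; [exact: mRe|exact: mIm].
- move=> [i b] t Et; rewrite /f/=.
  apply: (@le_trans _ _ (Im (z i))^-1).
    have := cauchy_limit_le (gP t Et) (zP i).
    by case: b; apply: le_trans; rewrite ?normr_Re_le ?normr_Im_le.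
  rewrite /K (bigD1 i)//= lerDl sumr_ge0// => j _.
  by rewrite invr_ge0 ltW//; exact: zP.
exists (fun w => \sum_i (N.+1%:R^-1)%:C * g (t i) w).
  apply: cauchy_limit_convex => [i||i]; first by rewrite invr_ge0.
    by rewrite sumr_const card_ord -[LHS]mulr_natl divff// pnatr_eq0.
  exact/gP/tE.
move=> w /(tnthP (in_tuple zs))[i ->]; rewrite -/(z i).
rewrite (le_lt_trans (normc_leD _))// (splitr e) ltrD//.
  have := tP (i, true); rewrite ReB Re_sum (GRe _ (zP i)) /f/=.
  by under [in X in _ -> X]eq_bigr do rewrite ReZ.
have := tP (i, false); rewrite ImB Im_sum (GIm _ (zP i)) /f/=.
by under [in X in _ -> X]eq_bigr do rewrite ImZ.
Qed.

End Sampling.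

Section CauchyTransform.
Context {R : realType}.
Implicit Types (z w : R[i]) (mu nu : borel_probability R).

Lemma pole_lipschitz z (x y : R) : uhp z ->
  normc ((z - x%:C)^-1 - (z - y%:C)^-1) <= (Im z ^+ 2)^-1 * `|x - y|.
Proof.
move=> hz; rewrite mulrC (le_trans (normc_subV (uhp_sub_real _ hz) (uhp_sub_real _ hz)))//.
rewrite !ImB/= !subr0 -expr2 ler_wpM2r ?invr_ge0 ?sqr_ge0//.
have -> : z - x%:C - (z - y%:C) = (y - x)%:C by rewrite rmorphB/=; ring.
by rewrite normc_real distrC.
Qed.

Lemma pole_le z (x : R) : uhp z -> normc (z - x%:C)^-1 <= (Im z)^-1.
Proof.
move=> hz; rewrite (le_trans (normcV_le (uhp_sub_real _ hz)))//.
by rewrite ImB/= subr0.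
Qed.

Lemma Re_pole_continuous z : uhp z -> continuous (fun x : R => Re (z - x%:C)^-1).
Proof.
move=> hz; apply: lipschitz_continuous => x y.
by rewrite -ReB; exact: le_trans (normr_Re_le _) (pole_lipschitz _ _ hz).
Qed.

Lemma Im_pole_continuous z : uhp z -> continuous (fun x : R => Im (z - x%:C)^-1).
Proof.
move=> hz; apply: lipschitz_continuous => x y.
by rewrite -ImB; exact: le_trans (normr_Im_le _) (pole_lipschitz _ _ hz).
Qed.

(** The two names of the Borel sigma-algebra of the line are convertible but not
    syntactically equal. *)
Lemma continuous_borel_measurable (D : set R) (f : R -> R) : continuous f ->
  measurable D -> @measurable_fun _ _ (measurableTypeR R) R D f.
Proof.
move=> cf mD; have h := continuous_measurable_fun cf.
by apply: (@measurable_funS _ _ (measurableTypeR R) R setT).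
Qed.

Lemma measurable_Re_pole z D : uhp z ->
  measurable_fun D (fun x : measurableTypeR R => Re (z - x%:C)^-1).
Proof.
move=> hz mD; exact: (continuous_borel_measurable (Re_pole_continuous hz) mD).
Qed.

Lemma measurable_Im_pole z D : uhp z ->
  measurable_fun D (fun x : measurableTypeR R => Im (z - x%:C)^-1).
Proof.
move=> hz mD; exact: (continuous_borel_measurable (Im_pole_continuous hz) mD).
Qed.

(** The Cauchy transform of mu is an average of poles. *)
Lemma cauchy_limit_cauchy_transform mu : cauchy_limit (cauchy_transform mu).
Proof.
apply: (@cauchy_limit_average _ _ _ mu setT 1 (fun x z => (z - x%:C)^-1)) => //.
- exact: probability_setT.
- by move=> t _; exact: cauchy_limit_pole.
- by move=> z hz; exact: measurable_Re_pole.
- by move=> z hz; exact: measurable_Im_pole.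
- by move=> z hz; rewrite invr1 mul1r.
- by move=> z hz; rewrite invr1 mul1r.
Qed.

End CauchyTransform.

(** * Representation of the limits by measures *)

Section RightRegularization.
Context {R : realType}.
Variable F : R -> R.
Hypothesis Fnd : {homo F : x y / x <= y}.
Hypothesis F0 : forall x, 0 <= F x.
Hypothesis F1 : forall x, F x <= 1.

(** A pointwise limit of distribution functions is monotone but need not be
    right-continuous, as a Stieltjes measure requires. *)
Definition rreg (x : R) := inf (F @` `]x, +oo[).

Let hasinf x : has_inf (F @` `]x, +oo[).
Proof.
split; last by exists 0 => _ [y _ <-].
by exists (F (x + 1)); exists (x + 1) => //=; rewrite in_itv/= andbT ltrDl.
Qed.

Lemma rreg_le x y : x < y -> rreg x <= F y.
Proof.
move=> xy; apply: ge_inf; first by case: (hasinf x).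
by exists y => //=; rewrite in_itv/= xy.
Qed.

Lemma rreg_ge x : F x <= rreg x.
Proof.
apply: lb_le_inf; first by case: (hasinf x).
by move=> w [y /=]; rewrite in_itv/= andbT => /ltW xy <-; exact: Fnd.
Qed.

Lemma rreg_nd : {homo rreg : x y / x <= y}.
Proof.
move=> x y; rewrite le_eqVlt => /predU1P[->//|xy].
by rewrite (le_trans (rreg_le xy))// rreg_ge.
Qed.

Lemma rreg_rc : right_continuous rreg.
Proof.
move=> x; apply/cvgrPdist_lt => e e0.
have [_ [y /= + <-]] := inf_adherent e0 (hasinf x).
rewrite in_itv/= andbT -/(rreg x) => xy yx.
near=> u.
have xu : x < u by near: u; exact: nbhs_right_gt.
have uy : u < y by near: u; exact: nbhs_right_lt.
rewrite distrC ger0_norm ?subr_ge0 ?rreg_nd ?(ltW xu)//.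
by rewrite ltrBlDl (le_lt_trans (rreg_le uy)).
Unshelve. all: by end_near. Qed.

(** Nonnegative increments bounded by 1 are the increments of a multiple of a
    probability measure; the mass may have escaped to infinity. *)
Lemma rreg_measure : exists (m : R) (rho : borel_probability R),
  [/\ 0 <= m, m <= 1 & forall a b, a <= b ->
    rreg b - rreg a = m * fine (rho `]a, b]%classic)].
Proof.
pose C : cumulative R R := HB.pack rreg
  (@isCumulative.Build R _ R rreg rreg_nd rreg_rc).
pose mu : {measure set (measurableTypeR R) -> \bar R} := lebesgue_stieltjes_measure C.
have muE a b : a <= b -> mu `]a, b]%classic = (rreg b - rreg a)%:E.
  move=> ab; rewrite /mu/= /lebesgue_stieltjes_measure /measure_extension.
  by rewrite measurable_mu_extE/=; [rewrite wlength_itv_bnd|exact: is_ocitv].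
have mu1 : (mu setT <= 1)%E.
  pose I n : set R := `](- n%:R), n%:R]%classic.
  have cI : mu (I n) @[n --> \oo] --> mu (\bigcup_n I n).
    apply: nondecreasing_cvg_mu; rewrite /I//; first exact: bigcup_measurable.
    by move=> *; apply/subsetPset/subset_itv; rewrite leBSide/= ?lerN2 ler_nat.
  rewrite -(bigcup_itvT false false) -(cvg_lim _ cI)//.
  apply: lime_le; first by apply/cvg_ex; eexists; exact: cI.
  near=> n; rewrite /I muE ?ge0_cp// lee_fin.
  have h1 : rreg n%:R <= 1 by apply: (le_trans (rreg_le (y := n%:R + 1) _)) => //; rewrite ltrDl.
  have h2 : 0 <= rreg (- n%:R) by rewrite (le_trans _ (rreg_ge _)).
  by lra.
pose P0 : borel_probability R := @dirac _ (measurableTypeR R) (0 : R) R.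
exists (fine (mu setT)), (mnormalize mu P0); split.
- by rewrite fine_ge0.
- have -> : 1 = fine (1%E : \bar R) by [].
  apply: fine_le => //.
  by rewrite ge0_fin_numE// (le_lt_trans mu1)// ltry.
- move=> a b ab; rewrite /= /mnormalize.
  have /lt_eqF -> : (mu setT < +oo)%E by rewrite (le_lt_trans mu1)// ltry.
  rewrite orbF; have [mu0|m0] := eqVneq (mu setT) 0%E.
    rewrite mu0 mul0r.
    have : (mu `]a, b]%classic <= mu setT)%E by apply: le_measure; rewrite ?inE.
    rewrite mu0 muE// lee_fin => h; apply/eqP; rewrite eq_le h subr_ge0.
    exact: rreg_nd.
  rewrite muE//= mulrCA divff ?mulr1// fine_eq0//.
  by rewrite ge0_fin_numE// (le_lt_trans mu1)// ltry.
Unshelve. all: by end_near. Qed.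

End RightRegularization.

Section RiemannSums.
Context {R : realType}.

Definition riemann (f G : R -> R) (a : nat -> R) (N : nat) : R :=
  \sum_(i < N) f (a i) * (G (a i.+1) - G (a i)).

Definition step_fun (f : R -> R) (a : nat -> R) (N : nat) (x : R) : R :=
  \sum_(i < N) f (a i) * \1_(`]a i, a i.+1]%classic : set R) x.

Variables (f : R -> R) (a : nat -> R) (N : nat) (e : R).
Hypothesis a_nd : {homo a : i j / (i <= j)%N >-> i <= j}.
Hypothesis f_osc : forall i, (i < N)%N -> forall x, a i <= x -> x <= a i.+1 ->
  `|f x - f (a i)| <= e.
Hypothesis f_lo : forall x, x <= a 0%N -> `|f x| <= e.
Hypothesis f_hi : forall x, a N <= x -> `|f x| <= e.

Lemma step_fun_out n x : (x <= a 0%N) || (a n < x) -> step_fun f a n x = 0.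
Proof.
move=> h; rewrite /step_fun big1// => i _; rewrite indicE memNset ?mulr0//=.
rewrite in_itv/= => /andP[h1 h2]; case/orP: h => [h|h].
  by have := lt_le_trans h1 h; rewrite ltNge a_nd.
by have := lt_le_trans h h2; rewrite ltNge a_nd// ltn_ord.
Qed.

Lemma step_fun_approx x : `|f x - step_fun f a N x| <= e.
Proof.
have e0 : 0 <= e by rewrite (le_trans _ (f_lo (lexx _))).
have [xa0|a0x] := leP x (a 0%N).
  by rewrite step_fun_out ?xa0// subr0 f_lo.
have [xaN|aNx] := leP x (a N); last first.
  by rewrite step_fun_out ?aNx ?orbT// subr0 f_hi// ltW.
have : forall n, (n <= N)%N -> x <= a n -> exists2 i, (i < n)%N & a i < x <= a i.+1.
  elim=> [_|n IH nN xn]; first by rewrite leNgt a0x.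
  have [xn'|xn'] := leP x (a n).
    by have [i ni xi] := IH (ltnW nN) xn'; exists i => //; rewrite ltnS ltnW.
  by exists n => //; rewrite xn' xn.
move=> /(_ N (leqnn _) xaN) [i iN /andP[aix xai]].
rewrite /step_fun (bigD1 (Ordinal iN))//= indicE mem_set/= ?in_itv/= ?aix// mulr1.
rewrite big1 ?addr0; first by apply: f_osc => //; exact: ltW.
move=> j /eqP ji; rewrite indicE memNset ?mulr0//= in_itv/= => /andP[h1 h2].
apply: ji; apply: val_inj => /=; apply/eqP; rewrite eqn_leq; apply/andP; split.
  rewrite leqNgt; apply/negP => /a_nd h.
  by have := lt_le_trans h1 (le_trans xai h); rewrite ltxx.
rewrite leqNgt; apply/negP => /a_nd h.
by have := lt_le_trans aix (le_trans h2 h); rewrite ltxx.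
Qed.

Definition dcdf (d : seq (R * R)) (x : R) : R := \sum_(q <- d | q.2 <= x) q.1.
Definition dmean (d : seq (R * R)) (f : R -> R) : R := \sum_(q <- d) q.1 * f q.2.

Lemma dcdfE d x : dcdf d x = \sum_(q <- d) q.1 * (q.2 <= x)%R%:R.
Proof.
rewrite /dcdf big_mkcond; apply: eq_bigr => q _.
by case: ifP; rewrite ?mulr1 ?mulr0.
Qed.

Lemma dmean_riemann d : fprob d -> `|dmean d f - riemann f (dcdf d) a N| <= e.
Proof.
move=> dP.
have -> : riemann f (dcdf d) a N = \sum_(q <- d) q.1 * step_fun f a N q.2.
  rewrite /riemann /step_fun; under [RHS]eq_bigr do rewrite mulr_sumr.
  rewrite exchange_big/=; apply: eq_bigr => i _.
  rewrite !dcdfE -sumrB mulr_sumr; apply: eq_bigr => q _.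
  rewrite -mulrBr mulrCA; congr (_ * (_ * _)).
  rewrite indicE; have [q1|q1] := leP q.2 (a i.+1); have [q2|q2] := leP q.2 (a i).
  - rewrite subrr memNset//= in_itv/= => /andP[+ _].
    by rewrite ltNge q2.
  - by rewrite subr0 mem_set//= in_itv/= q2.
  - by have := lt_le_trans q1 (le_trans q2 (a_nd (leqnSn i))); rewrite ltxx.
  - by rewrite subrr memNset//= in_itv/= => /andP[_]; rewrite leNgt q1.
rewrite /dmean -sumrB (le_trans (ler_norm_sum _ _ _))//.
rewrite -[leRHS]mul1r -(fprob_sum dP) mulr_suml le_sum_seq// => q qd.
rewrite -mulrBr normrM ger0_norm ?(fprob_ge0 dP)//.
by rewrite ler_wpM2l ?(fprob_ge0 dP)// step_fun_approx.
Qed.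

Lemma Rintegral_riemann (G : R -> R) (m : R) (rho : borel_probability R) :
  continuous f -> 0 <= m -> m <= 1 ->
  (forall a b, a <= b -> G b - G a = m * fine (rho `]a, b]%classic)) ->
  `|m * \int[rho]_x f x - riemann f G a N| <= e.
Proof.
move=> cf m0 m1 GE.
have e0 : 0 <= e by rewrite (le_trans _ (f_lo (lexx _))).
have P1 := @probability_setT _ _ _ rho.
have mf : measurable_fun setT (f : measurableTypeR R -> R).
  exact: continuous_borel_measurable.
have mI i : measurable_fun setT
    (\1_(`]a i, a i.+1]%classic : set (measurableTypeR R)) : measurableTypeR R -> R).
  by apply: measurable_indic; exact: measurable_itv.
have mstep i : measurable_fun setT (fun x : measurableTypeR R =>
    f (a i) * \1_(`]a i, a i.+1]%classic : set R) x).
  by apply: measurable_funM => //; exact: mI.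
have istep i : rho.-integrable setT (EFin \o (fun x : measurableTypeR R =>
    f (a i) * \1_(`]a i, a i.+1]%classic : set R) x)).
  apply: (bounded_Rintegrable measurableT P1 (mstep i) (K := `|f (a i)|)).
  by move=> x _; rewrite normrM ler_piMr// indicE ger0_norm// lern1 leq_b1.
have SE : riemann f G a N = m * \int[rho]_x step_fun f a N x.
  rewrite /step_fun Rintegral_sum// mulr_sumr; apply: eq_bigr => i _.
  rewrite GE ?a_nd// mulrCA; congr (_ * _); rewrite RintegralZl//; last first.
    apply: (bounded_Rintegrable measurableT P1 (mI i) (K := 1)).
    by move=> x _; rewrite indicE ger0_norm// lern1 leq_b1.
  congr (_ * _); rewrite /Rintegral integral_indic ?setIT//.
have mS : measurable_fun setT (step_fun f a N : measurableTypeR R -> R).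
  exact: (measurable_sum (index_enum _) (fun i : 'I_N => mstep i)).
have fi : rho.-integrable setT (EFin \o (f : measurableTypeR R -> R)).
  have Sb x : `|step_fun f a N x| <= \sum_(i < N) `|f (a i)|.
    rewrite (le_trans (ler_norm_sum _ _ _))// ler_sum// => i _.
    by rewrite normrM ler_piMr// indicE ger0_norm// lern1 leq_b1.
  apply: (bounded_Rintegrable measurableT P1 mf
    (K := e + \sum_(i < N) `|f (a i)|)) => x _.
  rewrite -[f x](subrK (step_fun f a N x)) (le_trans (ler_normD _ _))//.
  by rewrite lerD// step_fun_approx.
have Si : rho.-integrable setT (EFin \o (step_fun f a N : measurableTypeR R -> R)).
  apply: (bounded_Rintegrable measurableT P1 mS
    (K := \sum_(i < N) `|f (a i)|)) => x _.
  rewrite (le_trans (ler_norm_sum _ _ _))// ler_sum// => i _.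
  by rewrite normrM ler_piMr// indicE ger0_norm// lern1 leq_b1.
have di : rho.-integrable setT (EFin \o (fun x : measurableTypeR R => f x - step_fun f a N x)).
  exact: (@integrableB _ _ _ _ _ measurableT _ _ fi Si).
rewrite SE -mulrBr -RintegralB// normrM ger0_norm//.
rewrite -[leRHS]mul1r ler_pM//.
rewrite (le_trans (le_normr_Rintegral _ _))//.
have eE : \int[rho]_x e = e * fine (rho setT) := Rintegral_cst rho measurableT e.
rewrite P1 mulr1 in eE; rewrite -[leRHS]eE.
apply: le_Rintegral => //.
- exact: integrable_norm.
- by apply: (bounded_Rintegrable measurableT P1 (K := `|e|)).
- by move=> x _; exact: step_fun_approx.
Qed.

(** Summation by parts: the jumps of [rreg F - F] over the grid add up to at
    most 1, so replacing F by its right-continuous version changes the sum by at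
    most three oscillations.  Hence no grid point need be a continuity point. *)
Lemma riemann_rreg F : {homo F : x y / x <= y} -> (forall x, 0 <= F x) ->
  (forall x, F x <= 1) -> (forall i, a i < a i.+1) ->
  `|riemann f (rreg F) a N - riemann f F a N| <= 3 * e.
Proof.
move=> Fnd F0 F1 alt.
have e0 : 0 <= e by rewrite (le_trans _ (f_lo (lexx _))).
pose E i := rreg F (a i) - F (a i).
have E0 i : 0 <= E i by rewrite subr_ge0 rreg_ge.
have Esum n : \sum_(i < n) E i <= F (a n) - F (a 0%N).
  elim: n => [|n IH]; first by rewrite big_ord0 subrr.
  rewrite big_ord_recr/= (le_trans (lerD IH (lexx _)))// /E.
  by have := rreg_le F0 (alt n); lra.
have Esum1 n : \sum_(i < n) E i <= 1.
  by rewrite (le_trans (Esum n))//; have := F0 (a 0%N); have := F1 (a n); lra.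
have E1 n : E n <= 1.
  rewrite (le_trans _ (Esum1 n.+1))// big_ord_recr/= lerDr.
  by apply: sumr_ge0 => i _.
have Esum1' n : \sum_(i < n) E i.+1 <= 1.
  rewrite (le_trans _ (Esum1 n.+1))// big_ord_recl/=.
  by rewrite (eq_bigr (fun i : 'I_n => E i.+1)) ?lerDr.
have -> : riemann f (rreg F) a N - riemann f F a N =
    (f (a N) * E N - f (a 0%N) * E 0%N) -
    \sum_(i < N) (f (a i.+1) - f (a i)) * E i.+1.
  rewrite -(big_mkord xpredT (fun i => (f (a i.+1) - f (a i)) * E i.+1)).
  rewrite -(telescope_sumr (fun i => f (a i) * E i) (leq0n N)) /riemann.
  rewrite -(big_mkord xpredT (fun i => f (a i) * (rreg F (a i.+1) - rreg F (a i)))).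
  rewrite -(big_mkord xpredT (fun i => f (a i) * (F (a i.+1) - F (a i)))) -!sumrB.
  by apply: eq_bigr => i _; rewrite /E; ring.
have h1 : `|f (a N) * E N| <= e.
  by rewrite normrM (ger0_norm (E0 _)) -[leRHS]mulr1 ler_pM// f_hi.
have h2 : `|f (a 0%N) * E 0%N| <= e.
  by rewrite normrM (ger0_norm (E0 _)) -[leRHS]mulr1 ler_pM// f_lo.
have h3 : `|\sum_(i < N) (f (a i.+1) - f (a i)) * E i.+1| <= e.
  rewrite (le_trans (ler_norm_sum _ _ _))//.
  rewrite (le_trans (y := e * \sum_(i < N) E i.+1))//; last first.
    by rewrite -[leRHS]mulr1 ler_wpM2l.
  rewrite mulr_sumr ler_sum// => i _.
  by rewrite normrM (ger0_norm (E0 _)) ler_wpM2r// f_osc// ltW.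
have := ler_normB (f (a N) * E N - f (a 0%N) * E 0%N)
  (\sum_(i < N) (f (a i.+1) - f (a i)) * E i.+1).
have := ler_normB (f (a N) * E N) (f (a 0%N) * E 0%N).
by lra.
Qed.

End RiemannSums.

Section Representation.
Context {R : realType}.

Lemma ultra_cvg_bounded (T : Type) (U : set_system T) (f : T -> R) (a b : R) :
  UltraFilter U -> (\forall t \near U, a <= f t <= b) ->
  exists2 l, a <= l <= b & f t @[t --> U] --> l.
Proof.
move=> UU fab.
have Uab : (f t @[t --> U]) `[a, b]%classic.
  by move: fab; apply: filterS => t /= h; rewrite in_itv.
have [l [lab lcl]] := @segment_compact R a b _ _ Uab.
exists l; first by move: lab => /=; rewrite in_itv.
move=> V lV; have [//|UnV] := in_ultra_setVsetC (f @^-1` V) UU.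
have [y [ynV Vy]] := lcl (~` V) V UnV lV.
by case: (ynV Vy).
Qed.

(** Every pointwise limit of discrete Cauchy transforms is the Cauchy transform
    of a subprobability measure: an ultrafilter makes the distribution functions
    converge, and both real and imaginary parts of the poles are continuous and
    vanish at infinity. *)
Theorem cauchy_limit_representation (g : R[i] -> R[i]) : cauchy_limit g ->
  exists (m : R) (rho : borel_probability R), [/\ 0 <= m, m <= 1 &
    forall z, uhp z -> g z = m%:C * cauchy_transform rho z].
Proof.
move=> gP.
pose I : set (seq R[i] * R) := [set p : seq R[i] * R | (forall z, z \in p.1 -> uhp z) /\ 0 < p.2].
pose B (p : seq R[i] * R) : set (seq (R * R)) :=
  [set d | fprob d /\ forall z, z \in p.1 -> normc (fcauchy d z - g z) < p.2].
have FF : Filter (filter_from I B).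
  apply: filter_from_filter; first by exists ([::], 1); split => //=; exact: ltr01.
  move=> [zs e] [zs' e'] [/= h1 h2] [/= h1' h2'].
  exists (zs ++ zs', Num.min e e').
    split => /=; last by rewrite lt_min h2.
    by move=> z; rewrite mem_cat => /orP[/h1|/h1'].
  move=> d [dP dg]; split; split => //= z zzs.
    by have := dg z; rewrite mem_cat zzs lt_min => /(_ isT)/andP[].
  by have := dg z; rewrite mem_cat zzs orbT lt_min => /(_ isT)/andP[].
have FP : ProperFilter (filter_from I B).
  by apply: filter_from_proper => -[zs e] [/= h1 h2]; have [d ? ?] := gP zs h1 e h2; exists d.
have [U [UU sU]] := ultraFilterLemma FP.
have Uprob : \forall d \near U, fprob d.
  by apply: sU; exists ([::], 1) => [|d []//]; split => //=; exact: ltr01.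
have dcdf01 d x : fprob d -> 0 <= dcdf d x <= 1.
  move=> dP; rewrite dcdfE big_seq sumr_ge0/=; last first.
    by move=> q qd; rewrite mulr_ge0// (fprob_ge0 dP).
  rewrite -big_seq -[leRHS](fprob_sum dP) le_sum_seq// => q qd.
  by case: (q.2 <= x)%R; rewrite /= ?mulr1n ?mulr0n ?mulr1 ?mulr0 ?(fprob_ge0 dP qd) ?lexx.
have /choice[F FP'] : forall x : R, exists l : R, (0 <= l <= 1) /\ dcdf d x @[d --> U] --> l.
  move=> x; have [|l l01 h] := @ultra_cvg_bounded _ U (dcdf ^~ x) 0 1 UU.
  - by move: Uprob; apply: filterS => d dP; exact: dcdf01.
  - by exists l.
have F0 x : 0 <= F x by have [/andP[]] := FP' x.
have F1 x : F x <= 1 by have [/andP[]] := FP' x.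
have Fnd : {homo F : x y / x <= y}.
  move=> x y xy; rewrite -subr_ge0.
  apply: (cvgr_to_ge (cvgB (FP' y).2 (FP' x).2)).
  move: Uprob; apply: filterS => d dP; rewrite subr_ge0 !dcdfE le_sum_seq// => q qd.
  rewrite ler_wpM2l ?(fprob_ge0 dP)// ler_nat.
  by case: (leP q.2 x) => // /le_trans/(_ xy) ->.
have [m [rho [m0 m1 mrho]]] := rreg_measure Fnd F0 F1.
exists m, rho; split => //.
have key (f : R -> R) (K M : R) : 0 < K -> 0 < M -> (forall x y, `|f x - f y| <= K * `|x - y|) ->
    (forall x, M < `|x| -> `|f x| * (`|x| - M) <= 1) ->
    dmean d f @[d --> U] --> m * \int[rho]_x f x.
  move=> K0 M0 fK fM.
  have cf := lipschitz_continuous fK.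
  apply/cvgrPdist_le => e e0; pose e' := e / 6.
  have e'0 : 0 < e' by rewrite divr_gt0.
  pose A := M + e'^-1.
  have A0 : 0 < A by rewrite addr_gt0// invr_gt0.
  pose n := (Num.trunc (K * (2 * A) / e')).+1.
  pose dl := 2 * A / n%:R.
  pose a (i : nat) := - A + i%:R * dl.
  have n0 : 0 < n%:R :> R by rewrite ltr0n.
  have dl0 : 0 < dl by rewrite divr_gt0// mulr_gt0.
  have Kdl : K * dl <= e'.
    rewrite /dl mulrA ler_pdivrMr// -ler_pdivrMl// mulrC ltW//.
    exact: truncnS_gt.
  have a_nd : {homo a : i j / (i <= j)%N >-> i <= j}.
    by move=> i j ij; rewrite /a lerD2l ler_wpM2r ?(ltW dl0)// ler_nat.
  have alt i : a i < a i.+1 by rewrite /a ltrD2l ltr_pM2r// ltr_nat.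
  have aD i : a i.+1 - a i = dl by rewrite /a -natr1; ring.
  have fout x : A <= `|x| -> `|f x| <= e'.
    move=> Ax; have xM : e'^-1 <= `|x| - M by rewrite /A in Ax; lra.
    have e'V : 0 < e'^-1 by rewrite invr_gt0.
    have := fM x; rewrite -subr_gt0 (lt_le_trans e'V xM) => /(_ isT) h.
    rewrite -[e']invrK -[leRHS]mul1r ler_pdivlMr//.
    by rewrite (le_trans _ h)// ler_wpM2l.
  have f_osc i : (i < n)%N -> forall x, a i <= x -> x <= a i.+1 -> `|f x - f (a i)| <= e'.
    move=> _ x ax xa; rewrite (le_trans (fK _ _))// (le_trans _ Kdl)//.
    rewrite ler_wpM2l ?(ltW K0)// ger0_norm ?subr_ge0// -(aD i).
    by rewrite lerD2r.
  have a0E : a 0%N = - A by rewrite /a mul0r addr0.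
  have anE : a n = A by rewrite /a /dl mulrCA divff ?gt_eqF// mulr1; ring.
  have f_lo x : x <= a 0%N -> `|f x| <= e'.
    rewrite a0E => h; apply: fout; rewrite ler0_norm; first by lra.
    by rewrite (le_trans h)// oppr_le0 ltW.
  have f_hi x : a n <= x -> `|f x| <= e'.
    rewrite anE => h; apply: fout; rewrite ger0_norm//.
    by rewrite (le_trans _ h)// ltW.
  have hS : riemann f (dcdf d) a n @[d --> U] --> riemann f F a n.
    have hi (i : 'I_n) : f (a i) * (dcdf d (a i.+1) - dcdf d (a i)) @[d --> U] -->
        f (a i) * (F (a i.+1) - F (a i)).
      by apply: cvgMl_tmp; apply: cvgB; apply: (FP' _).2.
    rewrite /riemann; elim: (index_enum _) => [|i s IH].
      by under eq_fun do rewrite big_nil; rewrite big_nil; exact: cvg_cst.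
    by under eq_fun do rewrite big_cons; rewrite big_cons; exact: cvgD.
  move/cvgrPdist_le : hS => /(_ e' e'0); move: Uprob; apply: filterS2 => d dP hS.
  have h1 := dmean_riemann a_nd f_osc f_lo f_hi dP.
  have h2 := Rintegral_riemann a_nd f_osc f_lo f_hi cf m0 m1 mrho.
  have h3 := riemann_rreg f_osc f_lo f_hi Fnd F0 F1 alt.
  have e'E : e = 6 * e' by rewrite /e' mulrC divfK.
  move: h1 h2 h3 hS; rewrite !ler_norml => /andP[? ?] /andP[? ?] /andP[? ?] /andP[? ?].
  by rewrite e'E; apply/andP; split; lra.
move=> z hz.
have gU : normc (fcauchy d z - g z) @[d --> U] --> (0 : R).
  apply/cvgrPdist_lt => e e0; apply: sU; exists ([:: z], e).
    by split => //= w; rewrite inE => /eqP ->.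
  move=> d [dP dg]; rewrite sub0r normrN ger0_norm ?normc_ge0// dg//.
  by rewrite inE.
have pole_far (p : R[i] -> R) : (forall w, `|p w| <= normc w) ->
    forall x : R, normc z + 1 < `|x| -> `|p (z - x%:C)^-1| * (`|x| - (normc z + 1)) <= 1.
  move=> pw x xM; rewrite (le_trans (ler_wpM2r _ (pw _)))//.
    by rewrite subr_ge0 ltW.
  have zx : normc (z - x%:C) >= `|x| - normc z.
    rewrite lerBlDr -normc_real normcB (le_trans _ (le_normcD _ _))//.
    by rewrite subrK.
  have zx0 : 0 < normc (z - x%:C).
    by rewrite (lt_le_trans _ zx)// subr_gt0 (le_lt_trans _ xM)// lerDl.
  by rewrite normcV mulrC ler_pdivrMr// mul1r (le_trans _ zx)// lerD2l lerN2 lerDl.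
have M0 : 0 < normc z + 1 by rewrite ltr_wpDl ?normc_ge0.
have K0 : 0 < (Im z ^+ 2)^-1 by rewrite invr_gt0 exprn_gt0.
have hRe : dmean d (fun x => Re (z - x%:C)^-1) @[d --> U] -->
    m * \int[rho]_x Re (z - x%:C)^-1.
  apply: (key _ _ _ K0 M0); last exact: pole_far normr_Re_le.
  move=> x y; rewrite -ReB; exact: le_trans (normr_Re_le _) (pole_lipschitz _ _ hz).
have hIm : dmean d (fun x => Im (z - x%:C)^-1) @[d --> U] -->
    m * \int[rho]_x Im (z - x%:C)^-1.
  apply: (key _ _ _ K0 M0); last exact: pole_far normr_Im_le.
  move=> x y; rewrite -ImB; exact: le_trans (normr_Im_le _) (pole_lipschitz _ _ hz).
have limU (p : R[i] -> R) (h : R -> R) (l : R) :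
    (forall w w', p (w - w') = p w - p w') -> (forall w, `|p w| <= normc w) ->
    (forall d, p (fcauchy d z) = dmean d h) ->
    dmean d h @[d --> U] --> l -> p (g z) = l.
  move=> pB pw pE hl.
  have : dmean d h @[d --> U] --> p (g z).
    apply/cvgrPdist_lt => e e0; move/cvgrPdist_lt : gU => /(_ e e0); apply: filterS => d.
    rewrite sub0r normrN (ger0_norm (normc_ge0 _)); apply: le_lt_trans.
    by rewrite -pE -pB normcB pw.
  by move=> hp; exact: (cvg_unique _ hp hl).
apply: eqC_ReIm.
- rewrite ReZ; apply: (limU _ _ _ (@ReB R) (@normr_Re_le R) _ hRe).
  by move=> d; rewrite Re_sum; apply: eq_bigr => q _; rewrite ReZ.
- rewrite ImZ; apply: (limU _ _ _ (@ImB R) (@normr_Im_le R) _ hIm).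
  by move=> d; rewrite Im_sum; apply: eq_bigr => q _; rewrite ImZ.
Qed.

End Representation.

(** * Asymptotics along the imaginary axis *)

Section IntegrationLemmas.
Context {R : realType}.

Lemma cvg_harmonic_scale (C : R) : C / n.+1%:R @[n --> \oo] --> (0 : R).
Proof.
rewrite [X in _ --> X](_ : _ = C * 0); last by rewrite mulr0.
exact: (cvgMl_tmp (@cvg_harmonic R)).
Qed.

Lemma cvg_by_harmonic (u : nat -> R) (l C : R) :
  (forall n, `|u n - l| <= C / n.+1%:R) -> u n @[n --> \oo] --> l.
Proof.
move=> h; apply/cvgrPdist_le => e e0.
have /cvgrPdist_le /(_ e e0) := cvg_harmonic_scale C; apply: filterS => n.
rewrite sub0r normrN distrC => hn; rewrite (le_trans (h n))//.
exact: le_trans (ler_norm _) hn.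
Qed.

Context d (T : measurableType d) (mu : {measure set T -> \bar R}).

Lemma Rintegral_dominated_cvg (D : set T) (f_ : nat -> T -> R) (f g : T -> R) :
  measurable D -> (forall n, measurable_fun D (f_ n)) ->
  (forall x, D x -> f_ n x @[n --> \oo] --> f x) ->
  mu.-integrable D (EFin \o g) ->
  (forall n x, D x -> `|f_ n x| <= g x) ->
  \int[mu]_(x in D) f_ n x @[n --> \oo] --> \int[mu]_(x in D) f x.
Proof.
move=> mD mf ff ig fg.
have mfl : measurable_fun D f by apply: measurable_fun_cvg mf ff.
have [||||i _ h] := @dominated_convergence _ _ R mu D mD (fun n => EFin \o f_ n)
  (EFin \o f) (EFin \o g) _ _ _ ig _.
- by move=> n; exact/measurable_EFinP.
- exact/measurable_EFinP.
- by apply: aeW => x Dx; apply: cvg_EFin; [exact: nearW|exact: ff].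
- by apply: aeW => x n Dx; rewrite /= lee_fin fg.
apply: fine_cvg; rewrite /= fineK; last exact: integrable_fin_num.
exact: h.
Qed.

Lemma Rintegral_gt0 (f : T -> R) : (0 < mu setT)%E ->
  mu.-integrable setT (EFin \o f) -> (forall x, 0 < f x) -> 0 < \int[mu]_x f x.
Proof.
move=> mu0 fi f0; rewrite lt_neqAle Rintegral_ge0 ?andbT; last first.
  by move=> x _; exact: ltW.
apply/negP => /eqP/esym f00.
have : (\int[mu]_x (EFin \o f) x = 0)%E.
  by rewrite -[LHS]fineK; [rewrite [fine _]f00|exact: integrable_fin_num].
rewrite (eq_integral (fun x => `|(EFin \o f) x|)%E); last first.
  by move=> x _; rewrite /= ger0_norm// ltW.
move=> /(ae_eq_integral_abs mu measurableT (measurable_int mu fi)).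
have -> : (ae_eq mu setT (EFin \o f) (cst 0%E)) = (mu.-negligible setT).
  apply/propext; split => [[N [mN N0 hN]]|hT].
    exists N; split => // x _; apply: hN => /= h.
    by have /eqP := h Logic.I; rewrite eqe gt_eqF.
  by apply: (negligibleS _ hT).
by move=> /(measure_negligible measurableT) h; move: mu0; rewrite h ltxx.
Qed.

End IntegrationLemmas.

Section Asymptotics.
Context {R : realType}.
Implicit Types (mu sigma rho : borel_probability R) (z : R[i]).

(** All limits at infinity are taken along this sequence. *)
Definition iy (n : nat) : R[i] := 0 +i* n.+1%:R.

Lemma uhp_iy (n : nat) : uhp (iy n). Proof. by rewrite /upper_half_plane/= ltr0n. Qed.

Lemma Re_pole_iy n (x : R) :
  n.+1%:R * Re (iy n - x%:C)^-1 = - (x * (n.+1%:R / (x ^+ 2 + n.+1%:R ^+ 2))).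
Proof.
rewrite ReV sqr_normcE ReB ImB/= sub0r subr0 sqrrN.
by move: (_ ^+ 2 + _) => w; ring.
Qed.

Lemma Im_pole_iy n (x : R) :
  n.+1%:R * Im (iy n - x%:C)^-1 = - (n.+1%:R ^+ 2 / (x ^+ 2 + n.+1%:R ^+ 2)).
Proof.
rewrite ImV sqr_normcE ReB ImB/= sub0r subr0 sqrrN.
by move: (x ^+ 2 + _) => w; ring.
Qed.

Lemma den_gt0 n (x : R) : 0 < x ^+ 2 + n.+1%:R ^+ 2.
Proof. by rewrite ltr_wpDl ?sqr_ge0// exprn_gt0. Qed.

Lemma frac_le1 n (x : R) : 0 <= n.+1%:R ^+ 2 / (x ^+ 2 + n.+1%:R ^+ 2) <= 1.
Proof.
rewrite divr_ge0 ?sqr_ge0 ?(ltW (den_gt0 _ _))//=.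
by rewrite ler_pdivrMr ?den_gt0// mul1r lerDr sqr_ge0.
Qed.

Lemma frac_approx n (x : R) :
  `|n.+1%:R ^+ 2 / (x ^+ 2 + n.+1%:R ^+ 2) - 1| <= x ^+ 2 / n.+1%:R.
Proof.
have -> : n.+1%:R ^+ 2 / (x ^+ 2 + n.+1%:R ^+ 2) - 1 =
    - (x ^+ 2 / (x ^+ 2 + n.+1%:R ^+ 2)).
  have := den_gt0 n x; move: (n.+1%:R) => y y0; field.
  by rewrite gt_eqF.
rewrite normrN ger0_norm; last by rewrite divr_ge0 ?sqr_ge0// ltW ?den_gt0.
rewrite ler_wpM2l ?sqr_ge0// lef_pV2 ?posrE ?den_gt0//.
rewrite -[leLHS]add0r lerD ?sqr_ge0// expr2 ler_peMl// ler1n//.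
Qed.

Lemma Re_frac_le n (x : R) :
  `|x * (n.+1%:R / (x ^+ 2 + n.+1%:R ^+ 2))| <= `|x| / n.+1%:R.
Proof.
have y0 : 0 < n.+1%:R :> R by [].
have d0 := den_gt0 n x.
rewrite normrM ler_wpM2l// ger0_norm; last by rewrite divr_ge0 ?(ltW y0) ?(ltW d0).
by rewrite ler_pdivrMr// ler_pdivlMl// -expr2 lerDr sqr_ge0.
Qed.

Lemma Re_frac_le1 n (x : R) :
  `|x * (n.+1%:R / (x ^+ 2 + n.+1%:R ^+ 2))| <= 1.
Proof.
have d0 := den_gt0 n x.
rewrite mulrA normrM normfV (gtr0_norm d0) ler_pdivrMr// mul1r.
rewrite ler_norml; move: (n.+1%:R) => y.
have h1 := sqr_ge0 (x + y); have h2 := sqr_ge0 (x - y).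
have h3 := sqr_ge0 x; have h4 := sqr_ge0 y.
by apply/andP; split; nra.
Qed.

Lemma Re_pole_cvg (x : R) :
  n.+1%:R * Re (iy n - x%:C)^-1 @[n --> \oo] --> (0 : R).
Proof.
apply: (@cvg_by_harmonic _ _ _ `|x|) => n.
by rewrite subr0 Re_pole_iy normrN Re_frac_le.
Qed.

Lemma Im_pole_cvg (x : R) :
  n.+1%:R * Im (iy n - x%:C)^-1 @[n --> \oo] --> (-1 : R).
Proof.
apply: (@cvg_by_harmonic _ _ _ (x ^+ 2)) => n.
by rewrite Im_pole_iy -opprD normrN frac_approx.
Qed.

Lemma integrable_bounded_prob mu (f : measurableTypeR R -> R) (K : R) :
  measurable_fun setT f -> (forall x, `|f x| <= K) -> mu.-integrable setT (EFin \o f).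
Proof.
move=> mf fK; apply: (bounded_Rintegrable measurableT (@probability_setT _ _ _ mu) mf).
by move=> x _; exact: fK.
Qed.

Lemma integrable_Re_pole mu z : uhp z ->
  mu.-integrable setT (EFin \o (fun x : measurableTypeR R => Re (z - x%:C)^-1)).
Proof.
move=> hz; apply: (integrable_bounded_prob _ (K := (Im z)^-1)).
  exact: measurable_Re_pole.
by move=> x; exact: le_trans (normr_Re_le _) (pole_le _ hz).
Qed.

Lemma integrable_Im_pole mu z : uhp z ->
  mu.-integrable setT (EFin \o (fun x : measurableTypeR R => Im (z - x%:C)^-1)).
Proof.
move=> hz; apply: (integrable_bounded_prob _ (K := (Im z)^-1)).
  exact: measurable_Im_pole.
by move=> x; exact: le_trans (normr_Im_le _) (pole_le _ hz).
Qed.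

Lemma Re_cauchy_iy mu n : n.+1%:R * Re (cauchy_transform mu (iy n)) =
  \int[mu]_x (n.+1%:R * Re (iy n - x%:C)^-1).
Proof. by rewrite RintegralZl//; exact/integrable_Re_pole/uhp_iy. Qed.

Lemma Im_cauchy_iy mu n : n.+1%:R * Im (cauchy_transform mu (iy n)) =
  \int[mu]_x (n.+1%:R * Im (iy n - x%:C)^-1).
Proof. by rewrite RintegralZl//; exact/integrable_Im_pole/uhp_iy. Qed.

Lemma Rintegral_cst_prob mu (c : R) : \int[mu]_x c = c.
Proof.
have h : \int[mu]_x c = c * fine (mu setT) := Rintegral_cst mu measurableT c.
by rewrite h probability_setT mulr1.
Qed.

(** At z = i y, the integrand z / (z - x) of z G(z) tends to 1 boundedly as y
    grows; the two components of this limit are treated separately. *)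
Lemma Re_cauchy_cvg mu :
  n.+1%:R * Re (cauchy_transform mu (iy n)) @[n --> \oo] --> (0 : R).
Proof.
under eq_fun do rewrite Re_cauchy_iy.
rewrite (_ : (0 : R) = \int[mu]_x (0)); last by rewrite Rintegral_cst_prob.
apply: (@Rintegral_dominated_cvg _ _ _ mu _ _ _ (cst 1)) => //.
- by move=> n; apply: measurable_funM; [exact: measurable_cst|exact: (measurable_Re_pole (@uhp_iy n))].
- by move=> x _; exact: Re_pole_cvg.
- by apply: (integrable_bounded_prob _ (K := `|1|)).
- by move=> n x _; rewrite Re_pole_iy normrN Re_frac_le1.
Qed.

Lemma Im_cauchy_cvg mu :
  n.+1%:R * Im (cauchy_transform mu (iy n)) @[n --> \oo] --> (-1 : R).
Proof.
under eq_fun do rewrite Im_cauchy_iy.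
rewrite (_ : (-1 : R) = \int[mu]_x (-1)); last by rewrite Rintegral_cst_prob.
apply: (@Rintegral_dominated_cvg _ _ _ mu _ _ _ (cst 1)) => //.
- by move=> n; apply: measurable_funM; [exact: measurable_cst|exact: (measurable_Im_pole (@uhp_iy n))].
- by move=> x _; exact: Im_pole_cvg.
- by apply: (integrable_bounded_prob _ (K := `|1|)).
- by move=> n x _; rewrite Im_pole_iy normrN ger0_norm; case/andP: (frac_le1 n x).
Qed.

(** A limit of Cauchy transforms comes from a probability measure as soon as it
    behaves like 1/z along the imaginary axis: no mass escaped. *)
Lemma cauchy_limit_prob (g : R[i] -> R[i]) : cauchy_limit g ->
  n.+1%:R * Im (g (iy n)) @[n --> \oo] --> (-1 : R) ->
  exists rho, forall z, uhp z -> g z = cauchy_transform rho z.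
Proof.
move=> gP g1; have [m [rho [m0 m1 gE]]] := cauchy_limit_representation gP.
have hm : n.+1%:R * Im (g (iy n)) @[n --> \oo] --> m * (-1).
  have h n : n.+1%:R * Im (g (iy n)) = m * (n.+1%:R * Im (cauchy_transform rho (iy n))).
    by rewrite gE; [rewrite ImZ mulrCA|exact: uhp_iy].
  under eq_fun do rewrite h.
  exact: cvgMl_tmp (Im_cauchy_cvg rho).
have mE : m = 1.
  have h' : m * (-1) = -1 by exact: (cvg_unique _ hm g1).
  by lra.
by exists rho => z hz; rewrite (gE z hz) mE mul1r.
Qed.

Lemma Im_cauchy_transform_lt0 mu z : uhp z -> Im (cauchy_transform mu z) < 0.
Proof.
move=> hz; rewrite -oppr_gt0.
have h : 0 < \int[mu]_x (- Im (z - x%:C)^-1).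
  apply: Rintegral_gt0; first exact: (eq_ind_r (fun e => (0 < e)%E) (@lte01 R) (@probability_setT _ _ _ mu)).
    exact: (integrableN (integrable_Im_pole mu hz)).
  by move=> x; rewrite oppr_gt0; apply/ImV_lt0/uhp_sub_real.
move: h; under eq_Rintegral do rewrite -mulN1r.
by rewrite RintegralZl// ?mulN1r//; exact: integrable_Im_pole.
Qed.

Lemma cauchy_transform_neq0 mu z : uhp z -> cauchy_transform mu z != 0.
Proof.
move=> hz; apply/eqP => h; have := Im_cauchy_transform_lt0 mu hz.
by rewrite h ltxx.
Qed.

End Asymptotics.

(** * F-transforms and moments *)

Section Moments.
Context {R : realType}.
Implicit Types (mu sigma rho : borel_probability R) (z : R[i]).

Lemma measurable_id_borel : measurable_fun setT (fun x : measurableTypeR R => x : R).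
Proof. by apply: (@continuous_borel_measurable R setT idfun) => // x; exact: cvg_id. Qed.

Lemma measurable_sqr_borel : measurable_fun setT (fun x : measurableTypeR R => x ^+ 2 : R).
Proof. exact: measurable_funX measurable_id_borel. Qed.

Lemma measurable_frac n : measurable_fun setT
  (fun x : measurableTypeR R => n.+1%:R ^+ 2 / (x ^+ 2 + n.+1%:R ^+ 2) : R).
Proof.
have h : (fun x : measurableTypeR R => n.+1%:R ^+ 2 / (x ^+ 2 + n.+1%:R ^+ 2) : R) =
    (fun x => - (n.+1%:R * Im (@iy R n - x%:C)^-1)).
  by apply/funext => x; rewrite Im_pole_iy opprK.
rewrite h; apply: measurableT_comp => //; apply: measurable_funM => //.
exact: (measurable_Im_pole (@uhp_iy R n)).
Qed.

Lemma integrable_frac mu n : mu.-integrable setT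
  (EFin \o (fun x : measurableTypeR R => n.+1%:R ^+ 2 / (x ^+ 2 + n.+1%:R ^+ 2) : R)).
Proof.
apply: (integrable_bounded_prob _ (measurable_frac n) (K := 1)) => x.
by rewrite ger0_norm; case/andP: (frac_le1 n x).
Qed.

Lemma integrable_id_of_sqr mu :
  mu.-integrable setT (fun x : measurableTypeR R => (x ^+ 2)%:E) ->
  mu.-integrable setT (fun x : measurableTypeR R => x%:E).
Proof.
move=> h.
have h1 : mu.-integrable setT (EFin \o (fun x : measurableTypeR R => 1 + x ^+ 2)).
  have c1 : mu.-integrable setT (EFin \o cst (1 : R)).
    by apply: (integrable_bounded_prob _ (K := `|1|)).
  exact: (@integrableD _ _ _ _ _ measurableT _ _ c1 h).
apply: (@le_integrable _ _ _ mu setT measurableT _ _ _ _ h1).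
  by apply/measurable_EFinP; exact: measurable_id_borel.
move=> x _; rewrite /= lee_fin [leRHS]ger0_norm ?addr_ge0 ?sqr_ge0//.
rewrite ler_norml; have := sqr_ge0 (x - 1); have := sqr_ge0 (x + 1).
by move=> h2 h3; apply/andP; split; nra.
Qed.

(** The second-order behaviour of F along the imaginary axis gives the first two
    moments.  Writing G for the Cauchy transform of sigma and G' for that of rho,
    iy G(iy) = 1 + w G'(iy) G(iy), and both iy G(iy) and iy G'(iy) tend to 1. *)
Lemma F_transform_moments sigma rho (w : R) :
  (forall z, uhp z -> F_transform sigma z = z - w%:C * cauchy_transform rho z) ->
  [/\ sigma.-integrable setT (fun x : measurableTypeR R => x%:E),
      sigma.-integrable setT (fun x : measurableTypeR R => (x ^+ 2)%:E),
      \int[sigma]_x x = 0 & \int[sigma]_x (x ^+ 2) = w].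
Proof.
move=> FE; pose G n := cauchy_transform sigma (@iy R n).
pose G' n := cauchy_transform rho (@iy R n).
pose y n : R := n.+1%:R.
have y0 n : y n != 0 by rewrite pnatr_eq0.
have GE n : @iy R n * G n = 1 + w%:C * (G' n * G n).
  have := FE _ (@uhp_iy R n); rewrite /F_transform -/(G n) -/(G' n) => h.
  have G0 : G n != 0 by exact/cauchy_transform_neq0/uhp_iy.
  rewrite mulrA -[X in X + _](mulVf G0) h; ring.
have ReGE n : - (y n * Im (G n)) = 1 + w * Re (G' n * G n).
  by have /(congr1 (@complex.Re R)) := GE n; rewrite ReD ReZ => <-; rewrite /iy/y; case: (G n) => a b/=; ring.
have ImGE n : y n * Re (G n) = w * Im (G' n * G n).
  by have /(congr1 (@complex.Im R)) := GE n; rewrite ImD ImZ/= add0r => <-; rewrite /iy/y; case: (G n) => a b/=; ring.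
have cR := Re_cauchy_cvg sigma; have cI := Im_cauchy_cvg sigma.
have cR' := Re_cauchy_cvg rho; have cI' := Im_cauchy_cvg rho.
pose fr n (x : R) := y n ^+ 2 / (x ^+ 2 + y n ^+ 2).
have ifr n : \int[sigma]_x fr n x = - (y n * Im (G n)).
  rewrite /y Im_cauchy_iy; under [in RHS]eq_Rintegral do rewrite Im_pole_iy -mulN1r.
  by rewrite [in RHS]RintegralZl; [rewrite mulN1r opprK|by []|exact: integrable_frac].
(* u n increases to x^2, so that monotone convergence gives the second moment
   without supposing that it exists; the first moment then follows by dominated
   convergence *)
pose u n (x : R) := x ^+ 2 * fr n x.
have uE n x : u n x = y n ^+ 2 * (1 - fr n x).
  have h (a b : R) : 0 < a + b -> a * (b / (a + b)) = b * (1 - b / (a + b)).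
    by move=> ab; field; rewrite gt_eqF.
  exact/h/den_gt0.
have u0 n x : 0 <= u n x.
  by rewrite mulr_ge0 ?sqr_ge0//; case/andP: (frac_le1 n x).
have mu_ n : measurable_fun setT (u n : measurableTypeR R -> R).
  apply: measurable_funM; first exact: measurable_sqr_borel.
  exact: measurable_frac.
have iu n : sigma.-integrable setT (EFin \o (u n : measurableTypeR R -> R)).
  apply: (integrable_bounded_prob _ (mu_ n) (K := y n ^+ 2)) => x.
  rewrite ger0_norm// uE ler_piMr ?sqr_ge0// gerBl.
  by case/andP: (frac_le1 n x).
have c1 : sigma.-integrable setT (EFin \o (cst (1 : R) : measurableTypeR R -> R)).
  by apply: (integrable_bounded_prob _ (K := `|1|)).
have Iu n : \int[sigma]_x u n x = - w * (y n * Re (G' n) * (y n * Re (G n))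
    - y n * Im (G' n) * (y n * Im (G n))).
  rewrite (@eq_Rintegral _ _ _ _ _ (fun x : measurableTypeR R => y n ^+ 2 * (1 - fr n x))); last by move=> x _; exact: uE.
  rewrite RintegralZl//; last first.
    exact: (@integrableB _ _ _ _ _ measurableT _ _ c1 (integrable_frac sigma n)).
  rewrite RintegralB//; last exact: integrable_frac.
  rewrite Rintegral_cst_prob ifr ReGE.
  by case: (G n) (G' n) => a b [c d]/=; ring.
have cu : \int[sigma]_x u n x @[n --> \oo] --> w.
  under eq_fun do rewrite Iu.
  have := cvgMl_tmp (a := - w) (cvgB (cvgM cR' cR) (cvgM cI' cI)).
  by rewrite (_ : - w * (0 * 0 - (-1) * (-1)) = w); [exact|ring].
have cu2 : (\int[sigma]_x (u n x)%:E)%E @[n --> \oo] -->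
    (\int[sigma]_x ((x : measurableTypeR R) ^+ 2)%:E)%E.
  have lu x : limn (fun n => (u n x)%:E) = (x ^+ 2)%:E.
    apply/cvg_lim => //; apply: cvg_EFin; first exact: nearW.
    apply: (@cvg_by_harmonic _ _ _ (x ^+ 2 * x ^+ 2)) => n.
    rewrite /u -[X in _ - X]mulr1 -mulrBr normrM ger0_norm ?sqr_ge0//.
    by rewrite -mulrA ler_wpM2l ?sqr_ge0// frac_approx.
  under eq_integral do rewrite -lu.
  apply: (@cvg_monotone_convergence _ _ _ sigma setT measurableT
      (fun n (x : measurableTypeR R) => (u n x)%:E)) => //.
  - by move=> n; apply/measurable_EFinP; exact: mu_.
  - by move=> n x _; rewrite lee_fin u0.
  - move=> x _ n m nm; rewrite lee_fin /u ler_wpM2l ?sqr_ge0// /fr.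
    rewrite ler_pdivrMr ?den_gt0// mulrAC ler_pdivlMr ?den_gt0//.
    rewrite !mulrDr [leLHS]addrC [leRHS]addrC [y m ^+ 2 * y n ^+ 2]mulrC lerD2l.
    rewrite ler_wpM2r ?sqr_ge0// lerXn2r ?nnegrE//.
    by rewrite ler_nat.
have isq : (\int[sigma]_x ((x : measurableTypeR R) ^+ 2)%:E = w%:E)%E.
  have eu : (fun n => \int[sigma]_x (u n x)%:E)%E = EFin \o (fun n => \int[sigma]_x u n x).
    by apply/funext => n /=; rewrite fineK//; exact: integrable_fin_num (iu n).
  rewrite eu in cu2.
  have cu3 : (\int[sigma]_x u n x)%:E @[n --> \oo] --> w%:E.
    by apply: cvg_EFin; [exact: nearW|exact: cu].
  exact: (cvg_unique _ cu2 cu3).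
have sq_int : sigma.-integrable setT (fun x : measurableTypeR R => (x ^+ 2)%:E).
  apply/integrableP; split; first by apply/measurable_EFinP; exact: measurable_sqr_borel.
  under eq_integral do rewrite /= ger0_norm ?sqr_ge0//.
  by rewrite isq ltry.
have id_int := integrable_id_of_sqr sq_int.
split => //; last by rewrite /Rintegral isq.
have cx : \int[sigma]_x (x * fr n x) @[n --> \oo] --> \int[sigma]_x x.
  apply: (@Rintegral_dominated_cvg _ _ _ sigma _ _ _ (fun x : measurableTypeR R => `|x|)) => //.
  - move=> n; apply: measurable_funM; first exact: measurable_id_borel.
    exact: measurable_frac.
  - move=> x _; apply: (@cvg_by_harmonic _ _ _ (`|x| * x ^+ 2)) => n.
    rewrite -[X in _ - X]mulr1 -mulrBr normrM -mulrA ler_wpM2l//.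
    exact: frac_approx.
  - exact: integrable_norm id_int.
  - move=> n x _; rewrite normrM ler_piMr// ger0_norm; case/andP: (frac_le1 n x) => //.
have xE n x : x * fr n x = - y n * (y n * Re (@iy R n - x%:C)^-1).
  by rewrite Re_pole_iy /fr -/(y n); ring.
have Ix n : \int[sigma]_x (x * fr n x) = - w * ((y n)^-1 *
    (y n * Re (G' n) * (y n * Im (G n)) + y n * Im (G' n) * (y n * Re (G n)))).
  rewrite (@eq_Rintegral _ _ _ _ _ (fun x : measurableTypeR R => - y n * (y n * Re (@iy R n - x%:C)^-1))); last first.
    by move=> x _; exact: xE.
  rewrite RintegralZl//; last first.
    exact: (@integrableZl _ _ _ _ _ measurableT (y n) _
      (integrable_Re_pole sigma (@uhp_iy R n))).
  rewrite -Re_cauchy_iy -/(G n) [in LHS]ImGE.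
  case: (G n) (G' n) => a b [c d]/=; move: (y n) (y0 n) => Y Y0; by field.
have c0 : \int[sigma]_x (x * fr n x) @[n --> \oo] --> (0 : R).
  under eq_fun do rewrite Ix.
  have := cvgMl_tmp (a := - w) (cvgM cvg_harmonic (cvgD (cvgM cR' cI) (cvgM cI' cR))).
  by rewrite mul0r mulr0; exact.
exact: (cvg_unique _ cx c0).
Qed.

(** The reciprocal of z - w G(z) is a limit of Cauchy transforms, and it is close
    to 1 / z at infinity, so that its mass is 1. *)
Lemma F_transform_exists rho (w : R) : 0 <= w ->
  exists sigma, forall z, uhp z ->
    F_transform sigma z = z - w%:C * cauchy_transform rho z.
Proof.
move=> w0; have gP := cauchy_limit_cauchy_transform rho.
have [|sigma sE] := cauchy_limit_prob (cauchy_limit_shift 0 gP w0).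
  apply: (@cvg_by_harmonic _ _ _ w) => n.
  set v := w%:C * _; set z := @iy R n.
  rewrite (_ : z - 0%:C - v = z - v); last by rewrite subr0.
  have hz : uhp z := @uhp_iy R n.
  have hzv : uhp (z - v) by exact: uhp_shift.
  have -> : -1 = n.+1%:R * Im z^-1 :> R.
    by have := Im_pole_iy n (0 : R); rewrite subr0 expr0n add0r divff// expf_neq0.
  rewrite -mulrBr normrM ger0_norm// -ImB.
  rewrite -ler_pdivlMl// (le_trans (normr_Im_le _))//.
  rewrite (le_trans (normc_subV hzv hz))//.
  rewrite (_ : z - v - z = - v); last by ring.
  have y0 : 0 < n.+1%:R :> R by [].
  have zv : n.+1%:R <= Im (z - v) by exact: (Im_shift_ge gP w0 hz).
  rewrite normcN normcM normc_real ger0_norm//.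
  have hG : normc (cauchy_transform rho z) <= n.+1%:R^-1.
    by have := cauchy_limit_le gP hz.
  have D0 : 0 < Im (z - v) * Im z by rewrite mulr_gt0//; exact: lt_le_trans zv.
  rewrite [leRHS]mulrCA -mulrA ler_wpM2l// ler_pM ?normc_ge0 ?invr_ge0 ?(ltW D0)//.
  rewrite lef_pV2 ?posrE// (le_trans (y := n.+1%:R * n.+1%:R))//.
    by rewrite ler_peMl// ler1n.
  by rewrite ler_wpM2r.
exists sigma => z hz; rewrite /F_transform -sE// subr0 invrK//.
Qed.

End Moments.

(** * F-transforms of centred measures *)

Section Converse.
Context {R : realType}.
Implicit Types (mu sigma rho : borel_probability R) (z : R[i]).

Lemma near_all_seq (T : Type) (F : set_system T) (FF : Filter F) (I : eqType) (s : seq I)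
    (P : I -> T -> Prop) :
  (forall i, i \in s -> \forall t \near F, P i t) ->
  \forall t \near F, forall i, i \in s -> P i t.
Proof.
elim: s => [|i s IH] h; first by apply: filterE.
have h1 := h i (mem_head _ _).
have h2 : \forall t \near F, forall i, i \in s -> P i t.
  by apply: IH => j js; have := h j; rewrite inE js orbT => /(_ isT).
by move: h1 h2; apply: filterS2 => t hi hs j; rewrite inE => /predU1P[->//|/hs].
Qed.

Lemma minr_lipschitz (c u v : R) : `|Num.min u c - Num.min v c| <= `|u - v|.
Proof.
have h1 := ler_norm (u - v); have h2 := ler_norm (v - u); rewrite distrC in h2.
have h3 := normr_ge0 (u - v).
by rewrite ler_norml; case: (leP u c) => ?; case: (leP v c) => ?; apply/andP; split; lra.
Qed.

Lemma maxr_lipschitz (c u v : R) : `|Num.max c u - Num.max c v| <= `|u - v|.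
Proof.
have h1 := ler_norm (u - v); have h2 := ler_norm (v - u); rewrite distrC in h2.
have h3 := normr_ge0 (u - v).
by rewrite ler_norml; case: (leP c u) => ?; case: (leP c v) => ?; apply/andP; split; lra.
Qed.

Definition clip (n : nat) (x : R) : R := Num.max (- n%:R) (Num.min x n%:R).

Lemma clip_lipschitz n (x y : R) : `|clip n x - clip n y| <= 1 * `|x - y|.
Proof.
by rewrite mul1r /clip (le_trans (maxr_lipschitz _ _ _))// minr_lipschitz.
Qed.

Lemma normr_clip_le n (x : R) : `|clip n x| <= `|x|.
Proof.
have := clip_lipschitz n x 0; rewrite mul1r subr0 => h.
have e0 : clip n 0 = 0.
  rewrite /clip (min_idPl _)//; apply/max_idPr.
  by rewrite oppr_le0.
by rewrite e0 subr0 in h.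
Qed.

Lemma normr_clip_le_nat n (x : R) : `|clip n x| <= n%:R.
Proof.
have n0 : 0 <= n%:R :> R by [].
rewrite /clip ler_norml le_max lexx/= ge_max ge_min lexx orbT andbT.
by rewrite (le_trans _ n0)// oppr_le0.
Qed.

Lemma clip_id n (x : R) : `|x| <= n%:R -> clip n x = x.
Proof.
by rewrite ler_norml => /andP[h1 h2]; rewrite /clip (min_idPl h2) (max_idPr h1).
Qed.

Lemma clip_near (x : R) : \forall n \near \oo, clip n x = x.
Proof.
near=> n; apply: clip_id; near: n; exact: nbhs_infty_ger.
Unshelve. all: by end_near. Qed.

Lemma measurable_clip n : measurable_fun setT (clip n : measurableTypeR R -> R).
Proof.
by apply: continuous_borel_measurable => //; apply: lipschitz_continuous (clip_lipschitz n).
Qed.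

Lemma clip_cvg mu (f g : R -> R) :
  measurable_fun setT (f : measurableTypeR R -> R) ->
  mu.-integrable setT (EFin \o (g : measurableTypeR R -> R)) ->
  (forall n x, `|f (clip n x)| <= g x) ->
  \int[mu]_x f (clip n x) @[n --> \oo] --> \int[mu]_x f x.
Proof.
move=> mf gi fg; apply: (@Rintegral_dominated_cvg _ _ _ mu _ _ _ g) => //.
  by move=> n; exact: measurableT_comp mf (measurable_clip n).
move=> x _; apply: cvg_near_cst.
by have := clip_near x; apply: filterS => n ->.
Qed.

Lemma dist_quarter (x y z e : R) : `|x - y| < e / 4 -> `|z - y| < e / 4 ->
  `|x - z| < e / 2.
Proof. by move=> xy; rewrite distrC => yz; have := ler_distD y x z; lra. Qed.

(** Truncation makes the poles and the moments bounded; a sample mean then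
    approximates all of them at once. *)
Lemma discretization sigma (w : R) :
  sigma.-integrable setT (fun x : measurableTypeR R => x%:E) ->
  sigma.-integrable setT (fun x : measurableTypeR R => (x ^+ 2)%:E) ->
  \int[sigma]_x x = 0 -> \int[sigma]_x (x ^+ 2) = w ->
  forall zs : seq R[i], (forall z, z \in zs -> uhp z) -> forall e : R, 0 < e ->
  exists d, [/\ fprob d,
    forall z, z \in zs -> normc (fcauchy d z - cauchy_transform sigma z) < e,
    `|\sum_(q <- d) q.1 * q.2| < e &
    `|\sum_(q <- d) q.1 * q.2 ^+ 2 - w| < e].
Proof.
move=> i1 i2 m1 m2 zs zsP e e0.
have e4 : 0 < e / 4 by rewrite divr_gt0.
have [n [nz nm nv]] : exists n, [/\ forall z, z \in zs ->
      (`|\int[sigma]_x Re (z - x%:C)^-1 - \int[sigma]_x Re (z - (clip n x)%:C)^-1| < e / 4) /\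
      (`|\int[sigma]_x Im (z - x%:C)^-1 - \int[sigma]_x Im (z - (clip n x)%:C)^-1| < e / 4),
    `|\int[sigma]_x x - \int[sigma]_x clip n x| < e / 4 &
    `|\int[sigma]_x (x ^+ 2) - \int[sigma]_x (clip n x ^+ 2)| < e / 4].
  have h1 : \forall n \near \oo, forall z, z \in zs ->
      (`|\int[sigma]_x Re (z - x%:C)^-1 - \int[sigma]_x Re (z - (clip n x)%:C)^-1| < e / 4) /\
      (`|\int[sigma]_x Im (z - x%:C)^-1 - \int[sigma]_x Im (z - (clip n x)%:C)^-1| < e / 4).
    apply: near_all_seq => z /zsP hz.
    have hc : sigma.-integrable setT (EFin \o (cst ((Im z)^-1) : measurableTypeR R -> R)).
      by apply: (integrable_bounded_prob _ (K := `|(Im z)^-1|)).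
    have hre := clip_cvg (measurable_Re_pole hz) hc
       (fun n x => le_trans (normr_Re_le _) (pole_le (clip n x) hz)).
    have him := clip_cvg (measurable_Im_pole hz) hc
       (fun n x => le_trans (normr_Im_le _) (pole_le (clip n x) hz)).
    move/cvgrPdist_lt : hre => /(_ _ e4) hre; move/cvgrPdist_lt : him => /(_ _ e4).
    by move: hre; apply: filterS2 => n.
  have h2 : \forall n \near \oo, `|\int[sigma]_x x - \int[sigma]_x clip n x| < e / 4.
    have := @clip_cvg sigma id _ measurable_id_borel (integrable_norm i1) normr_clip_le.
    by move=> /cvgrPdist_lt; exact.
  have h3 : \forall n \near \oo, `|\int[sigma]_x (x ^+ 2) - \int[sigma]_x (clip n x ^+ 2)| < e / 4.
    have := @clip_cvg sigma (fun x => x ^+ 2) _ measurable_sqr_borel i2.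
    have hs n x : `|clip n x ^+ 2| <= x ^+ 2.
      rewrite normrX -[leRHS]real_normK ?num_real// lerXn2r ?nnegrE//.
      exact: normr_clip_le.
    by move=> /(_ hs)/cvgrPdist_lt; exact.
  near \oo => n; exists n; split.
  - by near: n.
  - by near: n.
  - by near: n.
pose I := ('I_(size zs) * bool + bool)%type.
pose z (i : 'I_(size zs)) := tnth (in_tuple zs) i.
have zP i : uhp (z i) by apply: zsP; rewrite mem_tnth.
pose f (k : I) (x : measurableTypeR R) : R := match k with
  | inl (i, true) => Re (z i - (clip n x)%:C)^-1
  | inl (i, false) => Im (z i - (clip n x)%:C)^-1
  | inr true => clip n x | inr false => clip n x ^+ 2 end.
pose K : R := \sum_i (Im (z i))^-1 + n%:R + n%:R ^+ 2.
have n0 : 0 <= n%:R :> R by [].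
have n20 : 0 <= n%:R ^+ 2 :> R by rewrite sqr_ge0.
have S0 : 0 <= \sum_i (Im (z i))^-1.
  by apply: sumr_ge0 => j _; rewrite invr_ge0 ltW//; exact: zP.
have ziK i : (Im (z i))^-1 <= K.
  rewrite /K -addrA (bigD1 i)//= -addrA lerDl addr_ge0 ?addr_ge0// sumr_ge0// => j _.
  by rewrite invr_ge0 ltW//; exact: zP.
have [||N [t [_ tP]]] := @sample_mean R _ _ sigma setT 1 I f K measurableT
    (@probability_setT _ _ _ sigma) ltr01 _ _ _ e4.
- case=> [[i []]|[]]; rewrite /f.
  + exact: (measurableT_comp (measurable_Re_pole (zP i)) (measurable_clip n)).
  + exact: (measurableT_comp (measurable_Im_pole (zP i)) (measurable_clip n)).
  + exact: measurable_clip.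
  + exact: (measurableT_comp measurable_sqr_borel (measurable_clip n)).
- move=> k x _; case: k => [[i b]|b]; rewrite /f.
    apply: le_trans (ziK i); case: b.
      exact: le_trans (normr_Re_le _) (pole_le _ (zP i)).
    exact: le_trans (normr_Im_le _) (pole_le _ (zP i)).
  case: b.
    by rewrite (le_trans (normr_clip_le_nat _ _))// /K addrAC lerDr addr_ge0.
  rewrite normrX (le_trans (y := n%:R ^+ 2))//; last by rewrite /K lerDr addr_ge0.
  by rewrite lerXn2r ?nnegrE// normr_clip_le_nat.
exists [seq (N.+1%:R^-1, clip n (t i)) | i <- enum 'I_N.+1]; split.
- apply/andP; split.
    by apply/allP => _ /mapP[i _ ->]/=; rewrite invr_ge0.
  rewrite big_map big_enum/= sumr_const card_ord -[X in X == _]mulr_natl divff//.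
- move=> w' /(tnthP (in_tuple zs))[i ->]; rewrite -/(z i).
  have [hre him] := nz (z i) (mem_tnth i (in_tuple zs)).
  have := tP (inl (i, true)); have := tP (inl (i, false)).
  rewrite /f invr1 !mul1r => h1 h2.
  rewrite /fcauchy big_map big_enum/= (le_lt_trans (normc_leD _))//.
  rewrite ReB ImB Re_sum Im_sum.
  under eq_bigr do rewrite ReZ; under [X in _ + `|X - _|]eq_bigr do rewrite ImZ.
  rewrite (splitr e); apply: ltrD; first exact: dist_quarter h2 hre.
  exact: dist_quarter h1 him.
- rewrite big_map big_enum/=; have := tP (inr true); rewrite /f invr1 mul1r => h.
  move: nm; rewrite m1 => nm; rewrite -[X in `|X|]subr0.
  apply: lt_trans (dist_quarter h nm) _; by rewrite ltr_pdivrMr// ltr_pMr// ltr1n.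
- rewrite big_map big_enum/=; have := tP (inr false); rewrite /f invr1 mul1r => h.
  move: nv; rewrite m2 => nv.
  apply: lt_trans (dist_quarter h nv) _; by rewrite ltr_pdivrMr// ltr_pMr// ltr1n.
Unshelve. all: by end_near. Qed.

Lemma fcauchy_variance (d : seq (R * R)) (m : R) : fprob d ->
  m = \sum_(q <- d) q.1 * q.2 ->
  \sum_(q <- d) q.1 * (q.2 - m) ^+ 2 = \sum_(q <- d) q.1 * q.2 ^+ 2 - m ^+ 2.
Proof.
move=> dP mE.
rewrite (eq_bigr (fun q => q.1 * q.2 ^+ 2 - 2 * m * (q.1 * q.2) + m ^+ 2 * q.1)).
  by rewrite big_split sumrB/= -!mulr_sumr -mE (fprob_sum dP); ring.
by move=> q _; ring.
Qed.

(** The discrete measure of discretization has an exact expansion by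
    fcauchy_inv, with mean close to 0 and variance close to w. *)
Lemma F_transform_limit sigma (w : R) :
  sigma.-integrable setT (fun x : measurableTypeR R => x%:E) ->
  sigma.-integrable setT (fun x : measurableTypeR R => (x ^+ 2)%:E) ->
  \int[sigma]_x x = 0 -> \int[sigma]_x (x ^+ 2) = w ->
  forall zs : seq R[i], (forall z, z \in zs -> uhp z) -> forall e : R, 0 < e ->
  exists2 d, fprob d & forall z, z \in zs ->
    normc (F_transform sigma z - (z - w%:C * fcauchy d z)) < e.
Proof.
move=> i1 i2 m1 m2 zs zsP h h0.
pose G := cauchy_transform sigma.
pose X := \big[Num.max/1]_(z <- zs) Num.max (- Im (G z))^-1 (Im z)^-1.
have X1 : 1 <= X by rewrite /X; elim/big_rec : _ => // i x _ hx; rewrite le_max hx orbT.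
have XP z : z \in zs -> (- Im (G z))^-1 <= X /\ (Im z)^-1 <= X.
  rewrite /X; elim: (zs) => //= a s IH; rewrite inE big_cons !le_max.
  by move=> /predU1P[->|/IH[-> ->]]; rewrite ?lexx ?orbT.
have X0 : 0 < X by rewrite (lt_le_trans _ X1).
(* the first bound keeps the discrete Cauchy transform away from 0, the second
   one makes the errors 2 X^2 e + e + 2 e X smaller than h *)
pose e := Num.min (2 * X)^-1 (h / (10 * X ^+ 2)).
have e0 : 0 < e by rewrite lt_min invr_gt0 mulr_gt0//= divr_gt0// mulr_gt0// exprn_gt0.
have eX : e <= (2 * X)^-1 by rewrite ge_min lexx.
have eh : e <= h / (10 * X ^+ 2) by rewrite ge_min lexx orbT.
have e1 : e <= 1.
  rewrite (le_trans eX)// invf_le1 ?mulr_gt0//; lra.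
have [d [dP dG dm dv]] := discretization i1 i2 m1 m2 zsP e0.
have [d' d'P d'E] := fcauchy_inv dP.
exists d' => // z zzs; have hz := zsP z zzs.
have [XG Xz] := XP z zzs.
have G0 : 0 < - Im (G z) by rewrite oppr_gt0; exact: Im_cauchy_transform_lt0.
have GX : X^-1 <= - Im (G z).
  by rewrite -[leRHS]invrK lef_pV2 ?posrE ?invr_gt0.
have dGz := dG z zzs.
have dX : (2 * X)^-1 <= - Im (fcauchy d z).
  have : `|Im (fcauchy d z) - Im (G z)| < e.
    by rewrite -ImB (le_lt_trans (normr_Im_le _)).
  rewrite ltr_norml => /andP[_ h1].
  have e2 : X^-1 = (2 * X)^-1 + (2 * X)^-1 by field; rewrite gt_eqF.
  by lra.
have hG : uhp (- G z) by change (is_true (0 < Im (- G z))); rewrite ImN.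
have hd : uhp (- fcauchy d z).
  by change (is_true (0 < Im (- fcauchy d z))); rewrite ImN (lt_le_trans _ dX)// invr_gt0 mulr_gt0.
have b1 : normc ((G z)^-1 - (fcauchy d z)^-1) <= 2 * X ^+ 2 * e.
  have -> : (G z)^-1 - (fcauchy d z)^-1 = (- fcauchy d z)^-1 - (- G z)^-1.
    by rewrite !invrN opprK addrC.
  rewrite (le_trans (normc_subV hd hG))// opprK addrC normcB -/(G z).
  rewrite (_ : 2 * X ^+ 2 * e = e * (2 * X * X)); last by ring.
  rewrite ler_pM ?normc_ge0 ?invr_ge0//.
  - by rewrite mulr_ge0// ltW.
  - by move: dGz; rewrite -/(G z) normcB addrC => /ltW.
  - rewrite -[leRHS]invrK lef_pV2 ?posrE ?invr_gt0 ?mulr_gt0// invfM !ImN.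
    by rewrite ler_pM ?invr_ge0 ?mulr_ge0 ?(ltW X0).
set m := \sum_(q <- d) q.1 * q.2 in dm d'E *.
set v := \sum_(q <- d) q.1 * (q.2 - m) ^+ 2 in d'E *.
have vw : `|v - w| <= 2 * e.
  rewrite /v (fcauchy_variance dP (erefl m)).
  have m2e : m ^+ 2 <= e.
    rewrite -[leLHS]real_normK ?num_real// expr2 -[leRHS]mulr1 ler_pM// ltW//.
    exact: lt_le_trans dm e1.
  have := sqr_ge0 m; move: dv; rewrite ltr_norml ler_norml => /andP[? ?] ?.
  by apply/andP; split; lra.
have b2 : normc (fcauchy d' z) <= X by rewrite (le_trans (fcauchy_le d'P hz)).
have -> : F_transform sigma z - (z - w%:C * fcauchy d' z) =
    ((G z)^-1 - (fcauchy d z)^-1) + (- m%:C + (w - v)%:C * fcauchy d' z).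
  by rewrite d'E// /F_transform -/(G z) rmorphB/=; ring.
rewrite (le_lt_trans (le_normcD _ _))//.
apply: (@le_lt_trans _ _ (2 * X ^+ 2 * e + (e + 2 * e * X))).
  rewrite lerD// (le_trans (le_normcD _ _))// lerD//.
    by rewrite normcN normc_real ltW.
  by rewrite normcM normc_real distrC ler_pM ?normc_ge0.
have XX : X <= X ^+ 2 by rewrite expr2 ler_peMl// ltW.
have X20 : 0 < X ^+ 2 by rewrite exprn_gt0.
have : e * (10 * X ^+ 2) <= h by rewrite -ler_pdivlMr// mulr_gt0.
by nra.
Qed.

(** The limits of F_transform_limit give a subprobability measure of mass m;
    then the variance of sigma is w m by F_transform_moments, so that m = 1. *)
Theorem F_transform_representation sigma (w : R) :
  sigma.-integrable setT (fun x : measurableTypeR R => x%:E) ->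
  sigma.-integrable setT (fun x : measurableTypeR R => (x ^+ 2)%:E) ->
  \int[sigma]_x x = 0 -> \int[sigma]_x (x ^+ 2) = w ->
  exists rho, forall z, uhp z ->
    F_transform sigma z = z - w%:C * cauchy_transform rho z.
Proof.
move=> i1 i2 m1 m2.
have H := F_transform_limit i1 i2 m1 m2.
have w0 : 0 <= w by rewrite -m2; apply: Rintegral_ge0 => x _; rewrite sqr_ge0.
have [w00|wN0] := eqVneq w 0.
  exists sigma => z hz; rewrite w00 mul0r subr0.
  apply/eqP; rewrite -subr_eq0; apply/eqP/eq0_normc.
  apply/eqP; rewrite eq_le normc_ge0 andbT; apply/ler_addgt0Pl => e e0.
  have [|d dP /(_ z)] := H [:: z] _ e e0; first by move=> ?; rewrite inE => /eqP ->.
  by rewrite inE eqxx w00 mul0r subr0 addr0 => /(_ isT)/ltW.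
have wp : 0 < w by rewrite lt_neqAle eq_sym wN0.
have wC : w%:C != 0 :> R[i] by rewrite (inj_eq (@complexI R) w 0).
pose g z := (z - F_transform sigma z) / w%:C.
have gP : cauchy_limit g.
  move=> zs zsP e e0; have [d dP dg] := H zs zsP _ (mulr_gt0 wp e0).
  exists d => // z zzs; have := dg z zzs.
  rewrite (_ : F_transform sigma z - _ = w%:C * (fcauchy d z - g z)); last first.
    by rewrite /g; field.
  by rewrite normcM normc_real ger0_norm// ltr_pM2l.
have [m [rho [m0 m1' gE]]] := cauchy_limit_representation gP.
have FE z : uhp z -> F_transform sigma z = z - (w * m)%:C * cauchy_transform rho z.
  move=> hz; have := gE z hz; rewrite /g rmorphM/= -mulrA => <-.
  by field.
have [_ _ _] := F_transform_moments FE; rewrite m2 => wm.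
have m1E : m = 1 by apply: (mulfI wN0); rewrite mulr1.
by exists rho => z hz; rewrite FE// m1E mulr1.
Qed.

End Converse.

(** * Weak convergence from Cauchy transforms *)

Section PoissonApproximation.
Context {R : realType}.

Lemma uniform_continuity_segment (h : R -> R) (a b e : R) : continuous h -> 0 < e ->
  exists2 dl, 0 < dl & forall x y, a <= x <= b -> `|x - y| <= dl -> `|h x - h y| < e.
Proof.
move=> ch e0; apply/not_exists2P => H.
have {}H n : exists xy : R * R,
    [/\ a <= xy.1 <= b, `|xy.1 - xy.2| <= n.+1%:R^-1 & e <= `|h xy.1 - h xy.2|].
  case: (H n.+1%:R^-1) => [|/existsNP[x /existsNP[y /not_implyP[xab /not_implyP[xy /negP]]]]].
    by rewrite invr_gt0.
  by rewrite -leNgt => he; exists (x, y).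
have [u uP] := choice H.
have [U [UU sU]] := @ultraFilterLemma _ (@nbhs nat _ \oo) _.
have [|l lab xl] := @ultra_cvg_bounded R nat U (fun n => (u n).1) a b UU.
  by apply: filterE => n; case: (uP n).
have yl : (u n).2 @[n --> U] --> l.
  have : ((u n).1 - ((u n).1 - (u n).2)) @[n --> U] --> l - 0.
    apply: cvgB => //; apply/cvgrPdist_le => d d0; apply: sU.
    have /cvgrPdist_le /(_ d d0) := @cvg_harmonic R; apply: filterS => n.
    rewrite !sub0r !normrN => hn; have [_ h2 _] := uP n.
    by rewrite (le_trans h2)// (le_trans (ler_norm _)).
  by rewrite subr0; under eq_fun do rewrite opprB addrC subrK.
have hx : h (u n).1 @[n --> U] --> h l by apply: continuous_cvg xl; exact: ch.
have hy : h (u n).2 @[n --> U] --> h l by apply: continuous_cvg yl; exact: ch.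
have h0 : (h (u n).1 - h (u n).2) @[n --> U] --> (0 : R).
  by rewrite -(subrr (h l)); exact: cvgB.
move/cvgrPdist_lt : h0 => /(_ e e0) hU.
have [n] := @filter_ex _ U _ _ hU.
rewrite sub0r normrN ltNge; have [_ _ ->] := uP n; by [].
Qed.

(** The Poisson kernel of the half-plane, up to the factor 1/pi. *)
Definition poisson (y u : R) : R := y / (u ^+ 2 + y ^+ 2).

Lemma poissonE (y a x : R) : poisson y (x - a) = - Im ((a +i* y) - x%:C)^-1.
Proof.
rewrite ImV opprK sqr_normcE ReB ImB/= subr0 /poisson.
by rewrite -[(a - x) ^+ 2]sqrrN opprB.
Qed.

Lemma poisson_ge0 (y u : R) : 0 < y -> 0 <= poisson y u.
Proof. by move=> y0; rewrite divr_ge0 ?(ltW y0)// addr_ge0 ?sqr_ge0. Qed.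

Lemma poisson_lipschitz (y u v : R) : 0 < y ->
  `|poisson y u - poisson y v| <= (y ^+ 2)^-1 * `|u - v|.
Proof.
move=> y0; have hz : uhp (0 +i* y : R[i]) by [].
have pE w : poisson y w = - Im ((0 +i* y) - w%:C)^-1.
  by rewrite -poissonE subr0.
have -> : poisson y u - poisson y v =
    Im (((0 +i* y) - v%:C)^-1 - ((0 +i* y) - u%:C)^-1).
  by rewrite ImB !pE; ring.
by rewrite (le_trans (normr_Im_le _))// distrC; exact: pole_lipschitz hz.
Qed.

Lemma poisson_far (y u dl : R) : 0 < y -> 0 < dl -> dl <= `|u| -> poisson y u <= y / dl ^+ 2.
Proof.
move=> y0 d0 du; rewrite /poisson ler_wpM2l ?(ltW y0)//.
rewrite lef_pV2 ?posrE ?exprn_gt0//; last by rewrite ltr_wpDl ?sqr_ge0 ?exprn_gt0.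
rewrite (le_trans (y := u ^+ 2)) ?lerDl ?sqr_ge0//.
by rewrite -[leRHS]real_normK ?num_real// lerXn2r ?nnegrE ?(ltW d0)// (le_trans _ du)// ltW.
Qed.

Lemma is_derive_poisson (y x a : R) : 0 < y ->
  is_derive a 1 (fun a => atan ((a - x) / y)) (poisson y (x - a)).
Proof.
move=> y0.
have h1 : is_derive a 1 (fun a => (a - x) / y) y^-1.
  by apply: is_derive_eq; rewrite scaler0 add0r subr0; exact: mulr1.
have := @is_derive1_comp R atan (fun a => (a - x) / y) a _ _ (is_derive1_atan ((a - x) / y)) h1.
have -> : (1 + ((a - x) / y) ^+ 2)^-1 * y^-1 = poisson y (x - a); last exact.
rewrite /poisson -[(x - a) ^+ 2]sqrrN opprB.
move: (a - x) => u; field.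
by rewrite !gt_eqF// ?ltr_wpDl ?sqr_ge0 ?exprn_gt0.
Qed.

(** arctan is a primitive of the kernel: by the mean value theorem, each term of
    the Riemann sum is close to an increment of arctan. *)
Lemma poisson_sum (y x a dl : R) (n : nat) : 0 < y -> 0 < dl ->
  `|\sum_(i < n) poisson y (x - (a + i%:R * dl)) * dl
    - (atan ((a + n%:R * dl - x) / y) - atan ((a - x) / y))| <=
  n%:R * dl * (dl / y ^+ 2).
Proof.
move=> y0 d0; elim: n => [|n IH].
  by rewrite big_ord0 !mul0r addr0 subrr subrr normr0.
pose an := a + n%:R * dl.
have an1 : a + n.+1%:R * dl = an + dl by rewrite /an -natr1; ring.
have [|||c cin cE] := @MVT R (fun a => atan ((a - x) / y)) (fun a => poisson y (x - a)) an (an + dl).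
- by rewrite ltrDl.
- by move=> b _; exact: is_derive_poisson.
- by apply: derivable_within_continuous => b _; have [] := is_derive_poisson x b y0.
have hc : `|poisson y (x - an) * dl - poisson y (x - c) * dl| <= dl * (dl / y ^+ 2).
  rewrite -mulrBl normrM (gtr0_norm d0) mulrC ler_wpM2l ?(ltW d0)//.
  rewrite (le_trans (poisson_lipschitz _ _ y0))// mulrC ler_wpM2r ?invr_ge0 ?sqr_ge0//.
  rewrite opprB addrC addrA subrK; move: cin; rewrite in_itv/= => /andP[h1 h2].
  by rewrite ger0_norm ?subr_ge0 ?(ltW h1)// lerBlDl ltW.
rewrite big_ord_recr/= an1 -/an.
have -> : n.+1%:R * dl * (dl / y ^+ 2) = n%:R * dl * (dl / y ^+ 2) + dl * (dl / y ^+ 2).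
  by rewrite -natr1; ring.
set S := \sum_(i < n) _ in IH *.
have {}cE : atan ((an + dl - x) / y) = atan ((an - x) / y) + poisson y (x - c) * dl.
  apply/eqP; rewrite [X in _ == X]addrC -subr_eq cE; apply/eqP.
  by rewrite (_ : an + dl - an = dl)//; ring.
have -> : S + poisson y (x - an) * dl - (atan ((an + dl - x) / y) - atan ((a - x) / y)) =
    (S - (atan ((an - x) / y) - atan ((a - x) / y))) +
    (poisson y (x - an) * dl - poisson y (x - c) * dl).
  by rewrite cE; ring.
by rewrite (le_trans (ler_normD _ _))// lerD.
Qed.

(** Continuous functions of compact support are uniform limits of linear
    combinations of the functions Im 1/(z-x): discretize their Poisson
    integrals.  The total mass of the discretized Poisson kernel is an increment
    of arctan, up to a small error. *)
Lemma poisson_approximation (h : R -> R) (B M : R) : continuous h -> 0 < B ->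
  0 < M -> (forall x, B <= `|x| -> h x = 0) -> (forall x, `|h x| <= M) ->
  forall e : R, 0 < e -> exists n (z : 'I_n -> R[i]) (c : 'I_n -> R),
    (forall i, uhp (z i)) /\
    forall x : R, `|h x - \sum_i c i * Im (z i - x%:C)^-1| <= e.
Proof.
move=> ch B0 M0 hB hM e e0.
have pi2 : 2 <= pi :> R by have := pi_ge2 R.
pose e1 := e / 8.
have e10 : 0 < e1 by rewrite divr_gt0.
have [dl0 dl00 dlP0] := @uniform_continuity_segment h (- (B + 1)) (B + 1) e1 ch e10.
pose dl := Num.min 1 dl0.
have dl_0 : 0 < dl by rewrite lt_min ltr01.
have dlP x a : `|a - x| <= dl -> `|h a - h x| <= e1.
  rewrite le_min => /andP[ax1 ax].
  have [aB|aB] := leP `|a| (B + 1).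
    by apply/ltW/dlP0 => //; rewrite -ler_norml.
  have xB : B <= `|x|.
    have := ler_normD (a - x) x; rewrite subrK; lra.
  rewrite (hB x xB) (hB a) ?subrr ?normr0 ?(ltW e10)//.
  by rewrite (le_trans _ (ltW aB))// lerDl.
pose L := B + 1.
have L0 : 0 < L by rewrite addr_gt0.
(* the height y is so small that the kernel centred at any x with |x| <= B has
   almost all of its mass in [-L, L], and little of it at distance dl from x *)
have [y [y0 ya yb]] : exists y : R, [/\ 0 < y, 4 * M * L * y / dl ^+ 2 <= e / 4 &
    M * (pi - 2 * atan (1 / y)) <= e / 8].
  have /cvgrPdist_le/(_ (e / (16 * M))) := @cvgy_atan R.
  have eM : 0 < e / (16 * M) by rewrite divr_gt0// mulr_gt0.
  move=> /(_ eM)[K [_ KP]].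
  pose K' := Num.max 1 (Num.max (K + 1) ((16 * M * L) / (e * dl ^+ 2))).
  have K'0 : 0 < K' by rewrite lt_max ltr01.
  exists K'^-1; split; first by rewrite invr_gt0.
    rewrite ler_pdivrMr ?exprn_gt0// ler_pdivrMr//.
    have : (16 * M * L) / (e * dl ^+ 2) <= K' by rewrite !le_max lexx !orbT.
    by rewrite ler_pdivrMr ?mulr_gt0 ?exprn_gt0//; lra.
  have := KP K' _; rewrite invrK mul1r => /(_ _)/wrap[].
    by rewrite /K' !lt_max ltrDl ltr01 orbT.
  rewrite ler_norml => /andP[_ h1].
  have : M * (pi / 2 - atan K') <= M * (e / (16 * M)) by rewrite ler_wpM2l// ltW.
  have -> : M * (e / (16 * M)) = e / 16 by field; rewrite gt_eqF.
  by lra.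
pose eta := Num.min 1 (e / (8 * M)).
have eta0 : 0 < eta by rewrite lt_min ltr01 divr_gt0// mulr_gt0.
pose n := (Num.trunc ((2 * L) * (2 * L) / (eta * y ^+ 2))).+1.
pose D := 2 * L / n%:R.
have n0 : 0 < n%:R :> R by rewrite ltr0n.
have D0 : 0 < D by rewrite divr_gt0// mulr_gt0.
have nD : n%:R * D = 2 * L by rewrite /D mulrCA divff ?gt_eqF// mulr1.
have Deta : 2 * L * (D / y ^+ 2) <= eta.
  rewrite mulrA ler_pdivrMr ?exprn_gt0// /D mulrA ler_pdivrMr//.
  rewrite -ler_pdivrMl ?mulr_gt0 ?exprn_gt0// mulrC ltW//.
  exact: truncnS_gt.
pose a (i : 'I_n) := - L + i%:R * D.
pose p (i : 'I_n) (x : R) := poisson y (x - a i).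
pose A x := atan ((L - x) / y) - atan ((- L - x) / y).
have SA x : `|\sum_i p i x * D - A x| <= eta.
  have := @poisson_sum y x (- L) D n y0 D0; rewrite nD.
  rewrite (_ : - L + 2 * L - x = L - x); last by ring.
  by move=> /le_trans; exact.
have Api x : A x <= pi.
  by rewrite /A; have := atan_ltpi2 ((L - x) / y); have := atan_gtNpi2 ((- L - x) / y); lra.
have Alo x : `|x| <= B -> 2 * atan (1 / y) <= A x.
  rewrite ler_norml => /andP[x1 x2].
  have h1 : atan (1 / y) <= atan ((L - x) / y).
    by apply: le_atan; rewrite ler_wpM2r ?invr_ge0 ?(ltW y0)// /L; lra.
  have h2 : atan ((- L - x) / y) <= - atan (1 / y).
    by rewrite -atanN -mulNr; apply: le_atan; rewrite ler_wpM2r ?invr_ge0 ?(ltW y0)// /L; lra.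
  by rewrite /A; lra.
have eta1 : eta <= 1 by rewrite ge_min lexx.
have etaM : M * eta <= e / 8.
  have : eta <= e / (8 * M) by rewrite ge_min lexx orbT.
  by rewrite ler_pdivlMr ?mulr_gt0//; lra.
exists n, (fun i => a i +i* y), (fun i => - (D / pi) * h (a i)); split => // x.
have -> : \sum_i - (D / pi) * h (a i) * Im ((a i +i* y) - x%:C)^-1 =
    pi^-1 * \sum_i h (a i) * (p i x * D).
  by rewrite mulr_sumr; apply: eq_bigr => i _; rewrite /p poissonE; ring.
have pi0 : 0 < pi :> R by lra.
rewrite -[h x]mul1r -(mulVf (lt0r_neq0 pi0)) -mulrA -mulrBr normrM.
rewrite gtr0_norm ?invr_gt0// ler_pdivrMl//.
set S := \sum_i p i x * D in SA *.
have SAx := SA x; rewrite -/S in SAx.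
have piS : S <= pi + 1.
  by move: SAx (Api x); rewrite ler_norml => /andP[_]; lra.
have hS : `|\sum_i h (a i) * (p i x * D) - h x * S| <= e1 * (pi + 1) + e / 4.
  rewrite /S mulr_sumr -sumrB (le_trans (ler_norm_sum _ _ _))//.
  apply: (@le_trans _ _ (\sum_i (e1 * (p i x * D) + 2 * M * (y / dl ^+ 2) * D))).
    apply: ler_sum => i _; rewrite -mulrBl normrM.
    have p0 : 0 <= p i x := poisson_ge0 _ y0.
    have pD0 : 0 <= p i x * D by rewrite mulr_ge0// ltW.
    rewrite [X in _ * X]ger0_norm//.
    have q0 : 0 <= 2 * M * (y / dl ^+ 2) * D.
      have M2 : 0 <= 2 * M by rewrite mulr_ge0// ltW.
      exact: (mulr_ge0 (mulr_ge0 M2 (divr_ge0 (ltW y0) (sqr_ge0 dl))) (ltW D0)).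
    have q1 : 0 <= e1 * (p i x * D) by rewrite mulr_ge0// ltW.
    have [ax|ax] := leP `|a i - x| dl.
      apply: (@le_trans _ _ (e1 * (p i x * D))); last by rewrite lerDl.
      by rewrite ler_wpM2r// dlP.
    apply: (@le_trans _ _ (2 * M * (y / dl ^+ 2) * D)); last by rewrite lerDr.
    rewrite [leLHS]mulrA ler_wpM2r ?(ltW D0)// ler_pM//.
      rewrite (le_trans (ler_normB _ _))//; have := hM (a i); have := hM x; lra.
    by apply: poisson_far => //; rewrite distrC ltW.
  rewrite big_split/= -mulr_sumr -/S lerD//; first by rewrite ler_wpM2l// ltW.
  rewrite sumr_const card_ord -[leLHS]mulr_natl.
  rewrite (_ : n%:R * _ = 2 * M * (y / dl ^+ 2) * (n%:R * D)); last by ring.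
  rewrite nD; move: ya; move: (dl ^+ 2) => dd; congr (_ <= _); ring.
have hpi : `|h x * S - pi * h x| <= e / 4.
  have [xB|xB] := leP B `|x|; first by rewrite hB// mul0r mulr0 subrr normr0 divr_ge0 ?ltW.
  rewrite (mulrC pi) -mulrBr normrM.
  apply: (@le_trans _ _ (M * (eta + (pi - 2 * atan (1 / y))))).
    rewrite ler_pM// ler_norml; move: SAx (Alo x (ltW xB)) (Api x); rewrite ler_norml => /andP[? ?] ? ?.
    by apply/andP; split; lra.
  by rewrite mulrDr; lra.
rewrite distrC (_ : _ - pi * h x = (\sum_i h (a i) * (p i x * D) - h x * S) + (h x * S - pi * h x)); last by ring.
rewrite (le_trans (ler_normD _ _))//.
have : e1 * (pi + 1) <= pi * e / 4 by rewrite /e1; nra.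
have : 2 * e <= pi * e by rewrite ler_wpM2r// ltW.
by lra.
Qed.

End PoissonApproximation.

Section WeakConvergence.
Context {R : realType}.
Implicit Types (mu nu : borel_probability R).

Lemma Rintegral_sum_poles mu n (z : 'I_n -> R[i]) (c : 'I_n -> R) :
  (forall i, uhp (z i)) ->
  \int[mu]_x (\sum_i c i * Im (z i - x%:C)^-1) =
  \sum_i c i * Im (cauchy_transform mu (z i)).
Proof.
move=> hz; rewrite Rintegral_sum//.
  by apply: eq_bigr => i _; rewrite RintegralZl//; exact/integrable_Im_pole/hz.
move=> i; exact: (@integrableZl _ _ _ _ _ measurableT (c i) _ (integrable_Im_pole mu (hz i))).
Qed.

Lemma integrable_bounded_continuous mu (f : R -> R) (K : R) : continuous f ->
  (forall x, `|f x| <= K) -> mu.-integrable setT (EFin \o (f : measurableTypeR R -> R)).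
Proof.
move=> cf fK; apply: integrable_bounded_prob fK.
exact: continuous_borel_measurable.
Qed.

Lemma Rintegral_close mu (f g : R -> R) (k : R -> R) (e : R) :
  mu.-integrable setT (EFin \o (f : measurableTypeR R -> R)) ->
  mu.-integrable setT (EFin \o (g : measurableTypeR R -> R)) ->
  mu.-integrable setT (EFin \o (k : measurableTypeR R -> R)) ->
  (forall x, `|f x - g x| <= k x) -> \int[mu]_x k x <= e ->
  `|\int[mu]_x f x - \int[mu]_x g x| <= e.
Proof.
move=> fi gi ki fgk ke.
have di : mu.-integrable setT (EFin \o (fun x : measurableTypeR R => f x - g x)).
  exact: (@integrableB _ _ _ _ _ measurableT _ _ fi gi).
rewrite -RintegralB// (le_trans (le_normr_Rintegral _ _))// (le_trans _ ke)//.
apply: le_Rintegral => //; first exact: integrable_norm.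
Qed.

(** Tightness comes from the bounded second moments, so it is enough to test
    against continuous functions of compact support. *)
Theorem weakly_cvg_of_cauchy_transform (T : Type) (F : set_system T) (FF : Filter F)
    (mu_ : T -> borel_probability R) (mu : borel_probability R) (V : R) :
  (forall z, uhp z -> forall e : R, 0 < e -> \forall t \near F,
    normc (cauchy_transform (mu_ t) z - cauchy_transform mu z) <= e) ->
  (\forall t \near F,
    (mu_ t).-integrable setT (fun x : measurableTypeR R => (x ^+ 2)%:E) /\
    \int[mu_ t]_x (x ^+ 2) <= V) ->
  mu.-integrable setT (fun x : measurableTypeR R => (x ^+ 2)%:E) ->
  \int[mu]_x (x ^+ 2) <= V ->
  weakly_cvg F mu_ mu.
Proof.
move=> Gcvg tight mi mV f cf [M0 [_ fM0]]; apply/cvgrPdist_le => e e0.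
pose M := `|M0| + 1.
have M1 : 0 < M by rewrite ltr_wpDl.
have fM x : `|f x| <= M.
  by apply: fM0 => //; rewrite /M (le_lt_trans (ler_norm _))// ltrDl.
have V0 : 0 <= V by rewrite (le_trans _ mV)//; apply: Rintegral_ge0 => x _; rewrite sqr_ge0.
pose K := Num.max 1 (6 * M * V / e).
have K1 : 1 <= K by rewrite le_max lexx.
have K0 : 0 < K by rewrite (lt_le_trans _ K1).
have KV : M / K ^+ 2 * V <= e / 6.
  have h1 : 6 * M * V <= K * e by rewrite -ler_pdivrMr// le_max lexx orbT.
  rewrite mulrAC ler_pdivrMr ?exprn_gt0//.
  have : K * e <= K ^+ 2 * e by rewrite ler_wpM2r ?(ltW e0)// expr2 ler_peMl// ltW.
  by lra.
pose chi (x : R) := Num.max 0 (Num.min (K + 1 - `|x|) 1).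
have chi_cont : continuous chi.
  apply: (@lipschitz_continuous _ _ 1) => x y; rewrite mul1r /chi.
  rewrite (le_trans (maxr_lipschitz _ _ _))// (le_trans (minr_lipschitz _ _ _))//.
  have -> : K + 1 - `|x| - (K + 1 - `|y|) = `|y| - `|x| by ring.
  by rewrite (distrC x y); exact: ler_dist_dist.
have chi01 x : 0 <= chi x <= 1 by rewrite /chi le_max lexx/= ge_max ler01/= ge_min lexx orbT.
pose h x := f x * chi x.
have ch : continuous h by move=> x; apply: continuousM; [exact: cf|exact: chi_cont].
have hM x : `|h x| <= M.
  have /andP[c0 c1] := chi01 x.
  by rewrite normrM (ger0_norm c0) -[leRHS]mulr1 ler_pM.
have hB x : K + 1 <= `|x| -> h x = 0.
  move=> Kx; rewrite /h /chi (max_idPl _) ?mulr0//.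
  by rewrite ge_min subr_le0 Kx.
have fh x : `|f x - h x| <= M / K ^+ 2 * x ^+ 2.
  have /andP[c0 c1] := chi01 x.
  have -> : f x - h x = f x * (1 - chi x) by rewrite /h; ring.
  have c1' : 0 <= 1 - chi x by rewrite subr_ge0.
  rewrite normrM (ger0_norm c1') -[leRHS]mulrA ler_pM//.
  have [xK|Kx] := leP `|x| K.
    have h1 : 1 <= K + 1 - `|x| by lra.
    rewrite /chi (min_idPr h1) (max_idPr (@ler01 R)) subrr.
    by rewrite mulr_ge0 ?invr_ge0 ?sqr_ge0.
  rewrite (le_trans (y := 1)) ?gerBl// ler_pdivlMl ?exprn_gt0// mulr1.
  by rewrite -[leRHS]real_normK ?num_real// lerXn2r ?nnegrE ?(ltW K0)// ltW.
have K10 : 0 < K + 1 by rewrite addr_gt0.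
have e6 : 0 < e / 6 by rewrite divr_gt0.
have [n [z [c [hz hc]]]] := poisson_approximation ch K10 M1 hB hM e6.
have main nu : nu.-integrable setT (fun x : measurableTypeR R => (x ^+ 2)%:E) ->
    \int[nu]_x (x ^+ 2) <= V ->
    `|\int[nu]_x f x - \sum_i c i * Im (cauchy_transform nu (z i))| <= e / 3.
  move=> ni nV.
  have fi := integrable_bounded_continuous nu cf fM.
  have hi := integrable_bounded_continuous nu ch hM.
  have h1 : `|\int[nu]_x f x - \int[nu]_x h x| <= e / 6.
    apply: (Rintegral_close fi hi (k := fun x => M / K ^+ 2 * x ^+ 2)) => //.
      exact: (@integrableZl _ _ _ _ _ measurableT (M / K ^+ 2) _ ni).
    rewrite RintegralZl// (le_trans _ KV)// ler_wpM2l//.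
    by rewrite divr_ge0 ?exprn_ge0// ltW.
  have gi : nu.-integrable setT (EFin \o (fun x : measurableTypeR R => \sum_i c i * Im (z i - x%:C)^-1)).
    have := @integrable_sum _ _ _ nu setT measurableT _ (index_enum 'I_n) predT
      (fun i => EFin \o (fun x : measurableTypeR R => c i * Im (z i - x%:C)^-1))
      (fun i _ => @integrableZl _ _ _ _ _ measurableT (c i) _ (integrable_Im_pole nu (hz i))).
    by apply: eq_integrable => // x _; rewrite /= sumEFin.
  have h2 : `|\int[nu]_x h x - \sum_i c i * Im (cauchy_transform nu (z i))| <= e / 6.
    rewrite -Rintegral_sum_poles//.
    apply: (Rintegral_close hi gi (k := cst (e / 6))) => //.
      by apply: (integrable_bounded_prob _ (K := `|e / 6|)).
    by rewrite Rintegral_cst_prob.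
  rewrite (le_trans (ler_distD (\int[nu]_x h x) _ _))//.
  by rewrite (le_trans (lerD h1 h2))//; lra.
pose C := \sum_i `|c i| + 1.
have C0 : 0 < C by rewrite ltr_wpDl// sumr_ge0.
have Gall : \forall t \near F, forall i, i \in enum 'I_n ->
    normc (cauchy_transform (mu_ t) (z i) - cauchy_transform mu (z i)) <= e / (3 * C).
  by apply: near_all_seq => i _; apply: Gcvg => //; rewrite divr_gt0// mulr_gt0.
move: Gall tight; apply: filterS2 => t Gt [ti tV].
have h1 := main _ mi mV; have h2 := main _ ti tV.
have h3 : `|\sum_i c i * Im (cauchy_transform mu (z i)) -
    \sum_i c i * Im (cauchy_transform (mu_ t) (z i))| <= e / 3.
  rewrite -sumrB (le_trans (ler_norm_sum _ _ _))//.
  apply: (@le_trans _ _ (\sum_i `|c i| * (e / (3 * C)))).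
    apply: ler_sum => i _; rewrite -mulrBr normrM ler_wpM2l// -ImB.
    by rewrite (le_trans (normr_Im_le _))// normcB Gt// mem_enum.
  rewrite -mulr_suml (le_trans (y := C * (e / (3 * C))))//.
    by rewrite ler_wpM2r ?lerDl// divr_ge0 ?mulr_ge0 ?(ltW e0) ?(ltW C0).
  by rewrite (_ : C * _ = e / 3)//; field; rewrite gt_eqF.
move: h1 h2 h3; rewrite !ler_norml => /andP[? ?] /andP[? ?] /andP[? ?].
by apply/andP; split; lra.
Qed.

End WeakConvergence.

(** * Absolutely continuous and Lipschitz functions *)

Section AbsoluteContinuity.
Context {R : realType}.
Notation leb := (@lebesgue_measure R).

Lemma lebesgue_itv_oc (x y : R) : x <= y -> leb `]x, y]%classic = (y - x)%:E.
Proof.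
move=> xy; rewrite /lebesgue_measure /lebesgue_stieltjes_measure /measure_extension.
by rewrite measurable_mu_extE/=; [rewrite wlength_itv_bnd|exact: is_ocitv].
Qed.

Lemma derivative_increment (f : R -> R) (s v K : R) : is_derive s 1 f v -> `|v| < K ->
  exists2 d, 0 < d & forall x, `|x - s| < d -> `|f x - f s| <= K * `|x - s|.
Proof.
move=> [df dv] vK.
have h : (fun h => h^-1 *: ((f \o shift s) (h *: (1 : R)) - f s)) @ 0^' --> v.
  by rewrite -dv; exact: df.
have Kv : 0 < K - `|v| by rewrite subr_gt0.
move/cvgrPdist_lt : h => /(_ _ Kv)[d /= d0 hd].
exists d => // x xd; have [->|xs] := eqVneq x s.
  by rewrite !subrr normr0 mulr0.
have xs0 : x - s != 0 by rewrite subr_eq0.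
have := hd (x - s); rewrite /ball/= sub0r normrN => /(_ xd xs0).
rewrite [_%:A]mulr1 subrK => /ltW h.
have : `|(x - s)^-1 *: (f x - f s)| <= K.
  rewrite -[X in `|X|](subrK v) (le_trans (ler_normD _ _))// distrC.
  by rewrite -lerBrDr.
rewrite normrZ normfV ler_pdivrMl ?normr_gt0//.
by rewrite mulrC.
Qed.

(** Real induction: the set of points reachable from a by finitely many steps is
    closed and open to the right.  A step is either controlled by the derivative
    or lies in a small open set covering the exceptional null set, where absolute
    continuity bounds the total variation. *)
Lemma absolutely_continuous_increment (f : R -> R) (a b K : R) : a <= b -> 0 <= K ->
  absolutely_continuous a b f ->
  {ae leb, forall s, s \in `[a, b] -> exists2 v, is_derive s 1 f v & `|v| <= K} ->
  `|f b - f a| <= K * (b - a).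
Proof.
move=> ab K0 acf [N [mN N0 hN]].
suff H e : 0 < e -> `|f b - f a| <= (K + e) * (b - a) + e.
  apply/ler_addgt0Pl => e e0.
  have e'0 : 0 < e / (b - a + 1) by rewrite divr_gt0// ltr_wpDl// subr_ge0.
  rewrite (le_trans (H _ e'0))//.
  rewrite [leLHS](_ : _ = K * (b - a) + e / (b - a + 1) * (b - a + 1)); last by ring.
  have ba : b - a + 1 != 0 by rewrite gt_eqF// ltr_wpDl// subr_ge0.
  by rewrite (divfK ba) addrC.
move=> e0; have [d d0 acd] := acf e e0.
have [|O [oO NO Od]] := @lebesgue_regularity_outer R N d mN _ d0.
  exact: (eq_ind_r (fun m => (m < +oo)%E) (ltry (0 : R)) N0).
have mO : measurable O by exact: open_measurable.
have OD : (leb O < d%:E)%E.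
  have mOD : measurable (O `\` N) by exact: measurableD.
  rewrite -(setDUK NO); apply: le_lt_trans (measureU2 leb mN mOD) _.
  have := N0 => /= ->; by rewrite add0e.
pose good x := exists n (u v : 'I_n -> R),
  [/\ forall i, [/\ a <= u i, u i <= v i & v i <= x],
      forall i j, i != j -> v i <= u j \/ v j <= u i,
      ((\sum_i (v i - u i))%:E <= leb (O `&` `]a, x]%classic))%E &
      `|f x - f a| <= (K + e) * (x - a) + \sum_i `|f (v i) - f (u i)|].
have mOx x : measurable (O `&` `]a, x]%classic) by apply: measurableI => //; exact: measurable_itv.
have Ke x y : good x -> x <= y -> `|f y - f x| <= (K + e) * (y - x) -> good y.
  move=> [n [u [v [h1 h2 h3 h4]]]] xy fxy; exists n, u, v; split => //.
  - by move=> i; have [? ? vx] := h1 i; split => //; rewrite (le_trans vx).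
  - rewrite (le_trans h3)//; apply: le_measure; rewrite ?inE; [exact: mOx|exact: mOx|].
    by apply: setIS; apply: subset_itvl; rewrite bnd_simp.
  - rewrite (le_trans (ler_distD (f x) _ _))//; lra.
have On x y : a <= x -> good x -> x <= y -> `]x, y]%classic `<=` O -> good y.
  move=> ax [n [u [v [h1 h2 h3 h4]]]] xy xyO.
  exists n.+1, (fun i => oapp u x (unlift ord_max i)), (fun i => oapp v y (unlift ord_max i)).
  have sumE (F : R -> R -> R) : \sum_(i < n.+1) F (oapp u x (unlift ord_max i)) (oapp v y (unlift ord_max i)) =
      \sum_i F (u i) (v i) + F x y.
    rewrite big_ord_recr/= unlift_none/=; congr (_ + _); apply: eq_bigr => i _.
    have -> : widen_ord (leqnSn n) i = lift ord_max i.
      by apply: val_inj; rewrite /= /bump leqNgt ltn_ord.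
    by rewrite liftK.
  split.
  - move=> i; case: unliftP => [j|] _ /=; last by split.
    by have [? ? vx] := h1 j; split => //; rewrite (le_trans vx).
  - move=> i j; case: unliftP => [i'|] ->; case: unliftP => [j'|] -> //=.
    + by rewrite (inj_eq (@lift_inj _ _)) => /h2.
    + by move=> _; left; have [] := h1 i'.
    + by move=> _; right; have [] := h1 j'.
    + by rewrite eqxx.
  - rewrite (sumE (fun p q => q - p)).
    have -> : O `&` `]a, y]%classic = (O `&` `]a, x]%classic) `|` `]x, y]%classic.
      apply/seteqP; split => z /=.
        move=> [Oz]; rewrite !in_itv/= => /andP[az zy].
        by have [zx|xz] := leP z x; [left; split => //; apply/andP|right; apply/andP].
      move=> [[Oz]|]; rewrite !in_itv/=.
        by move=> /andP[az zx]; split => //; rewrite az (le_trans zx).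
      move=> /andP[xz zy]; split; first by apply: xyO => /=; rewrite in_itv/=; apply/andP.
      by apply/andP; split => //; exact: le_lt_trans ax xz.
    rewrite (measureU leb (mOx x) (measurable_itv `]x, y])); last first.
      apply/seteqP; split => z //= -[[_]]; rewrite !in_itv/= => /andP[_ zx] /andP[xz _].
      by have := lt_le_trans xz zx; rewrite ltxx.
    have yx : ((y - x)%:E <= leb `]x, y]%classic)%E by rewrite lebesgue_itv_oc.
    by rewrite EFinD; apply: leeD => //; exact: yx.
  - rewrite (sumE (fun p q => `|f q - f p|)) addrA.
    rewrite (le_trans (ler_distD (f x) _ _))// [leLHS]addrC lerD//.
    rewrite (le_trans h4)// lerD2r ler_wpM2l// ?lerD2r//.
    by rewrite addr_ge0// ltW.
have step c : a <= c <= b -> exists2 dl, 0 < dl & forall x y, a <= x -> x <= y ->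
    `|x - c| < dl -> `|y - c| < dl -> (x = c \/ y = c) -> good x -> good y.
  move=> cab; have [Nc|Nc] := pselect (N c).
    have /nbhs_ballP[dl /= dl0 dlO] := open_nbhs_nbhs (conj oO (NO _ Nc)).
    exists dl => // x y ax xy xc yc _ gx; apply: (On x y) => // w /=.
    rewrite in_itv/= => /andP[xw wy]; apply: dlO; rewrite /ball/= distrC.
    move: xc yc; rewrite !ltr_norml => /andP[? ?] /andP[? ?].
    by apply/andP; split; lra.
  have [v dv vK] : exists2 v, is_derive c 1 f v & `|v| <= K.
    apply: contrapT => h; apply: Nc; apply: hN => /= h'.
    by apply: h; apply: h'; rewrite in_itv.
  have vKe : `|v| < K + e by rewrite (le_lt_trans vK)// ltrDl.
  have [dl dl0 dlP] := derivative_increment dv vKe.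
  exists dl => // x y ax xy xc yc [xE|yE] gx; apply: (Ke x y) => //.
    by have := dlP y yc; rewrite -xE (ger0_norm (_ : 0 <= y - x)) ?subr_ge0.
  have := dlP x xc; rewrite -yE distrC => h; rewrite (le_trans h)//.
  by rewrite distrC ger0_norm ?subr_ge0.
have ga : good a.
  exists 0%N, (fun=> 0), (fun=> 0); split; [by case|by case| |].
    by rewrite big_ord0.
  by rewrite !subrr normr0 mulr0 big_ord0 addr0.
pose S : set R := [set x | a <= x <= b /\ good x].
have Sa : S a by split => //; rewrite lexx.
have supS : has_sup S by split; [exists a|exists b => x [/andP[]]].
set c := sup S.
have ac : a <= c by apply: ub_le_sup => //; case: supS.
have cb : c <= b by apply: ge_sup; [exists a|move=> x [/andP[]]].
have cab : a <= c <= b by rewrite ac.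
have [dl dl0 dlP] := step c cab.
have gc : good c.
  have [x [/andP[ax xb] gx] cx] := sup_adherent dl0 supS.
  have xc : x <= c by apply: ub_le_sup; [case: supS|split => //; rewrite ax].
  apply: (dlP x c) => //; last by right.
    by rewrite ler0_norm ?subr_le0// opprB ltrBlDl -ltrBlDr.
  by rewrite subrr normr0.
have cE : c = b.
  apply/eqP; rewrite eq_le cb leNgt; apply/negP => cltb.
  pose y := Num.min b (c + dl / 2).
  have cy : c < y by rewrite lt_min cltb ltrDl divr_gt0.
  have gy : good y.
    apply: (dlP c y) => //; [exact: ltW|by rewrite subrr normr0| |by left].
    rewrite gtr0_norm ?subr_gt0// ltrBlDl gt_min; apply/orP; right.
    by rewrite ltrD2l ltr_pdivrMr// ltr_pMr// ltr1n.
  have : y <= c.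
    apply: ub_le_sup; [by case: supS|split => //].
    by rewrite (le_trans ac (ltW cy)) ge_min lexx.
  by rewrite leNgt cy.
have [n [u [v [h1 h2 h3 h4]]]] : good b by rewrite -cE.
rewrite (le_trans h4)// lerD2l ltW//; apply: acd => //.
rewrite -lte_fin (le_lt_trans h3)// (le_lt_trans _ OD)//.
by apply: le_measure; rewrite ?inE; [exact: mOx|exact: mO|exact: subIsetl].
Qed.

End AbsoluteContinuity.

Section LipschitzDensity.
Context {R : realType}.
Notation leb := (@lebesgue_measure R).

Lemma integrable_itv (g : R -> R) (A : set R) : measurable A ->
  leb.-integrable setT (EFin \o g) -> leb.-integrable A (EFin \o g).
Proof. by move=> mA; apply: integrableS. Qed.

(** The Stieltjes measure of F and that of the complementary function id - F add
    up to Lebesgue measure, so the former has a Radon-Nikodym density. *)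
Lemma stieltjes_density (F : R -> R) (C : R) :
  (forall x y, x <= y -> 0 <= F y - F x <= y - x) -> (forall x, 0 <= F x <= C) ->
  exists g : R -> R, [/\ leb.-integrable setT (EFin \o g),
    forall a b, a <= b -> \int[leb]_(x in `]a, b]) g x = F b - F a &
    {ae leb, forall x : R, is_derive x 1 F (g x)}].
Proof.
move=> FL F01.
have Flip x y : `|F x - F y| <= 1 * `|x - y|.
  wlog xy : x y / x <= y => [h|].
    by have [/h//|/ltW/h] := leP x y; rewrite distrC (distrC x y).
  have /andP[h1 h2] := FL x y xy.
  by rewrite mul1r distrC (distrC x y) !ger0_norm// subr_ge0.
have cF := lipschitz_continuous Flip.
have Glip x y : `|(x - F x) - (y - F y)| <= 2 * `|x - y|.
  rewrite (_ : _ - _ = (x - y) - (F x - F y)); last by ring.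
  by rewrite (le_trans (ler_normB _ _))// mulrDl mul1r lerD// -[leRHS]mul1r.
have cG := lipschitz_continuous Glip.
have Fnd : {homo F : x y / x <= y}.
  by move=> x y xy; have /andP[h _] := FL x y xy; rewrite -subr_ge0.
have Gnd : {homo (fun x => x - F x) : x y / x <= y}.
  by move=> x y xy; have /andP[_ h] := FL x y xy; lra.
pose CF : cumulative R R := HB.pack F
  (@isCumulative.Build R _ R F Fnd (right_continuousW cF)).
pose CG : cumulative R R := HB.pack (fun x => x - F x)
  (@isCumulative.Build R _ R (fun x => x - F x) Gnd (right_continuousW cG)).
pose mF : {measure set (measurableTypeR R) -> \bar R} := lebesgue_stieltjes_measure CF.
pose mG : {measure set (measurableTypeR R) -> \bar R} := lebesgue_stieltjes_measure CG.
have mE (f : cumulative R R) a b : a <= b ->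
    lebesgue_stieltjes_measure f `]a, b]%classic = (f b - f a)%:E.
  move=> ab; rewrite /lebesgue_stieltjes_measure /measure_extension.
  by rewrite measurable_mu_extE/=; [rewrite wlength_itv_bnd|exact: is_ocitv].
have lebE A : measurable A -> leb A = (mF A + mG A)%E.
  move=> mA; rewrite -(measure_addE mF mG).
  apply: lebesgue_measure_unique => // X [[a b] _ <-] /=.
  have [ab|ba] := leP a b; last by rewrite set_itv_ge ?bnd_simp ?measure0// -leNgt ltW.
  have e1 := lebesgue_itv_oc ab; have e2 := mE CF a b ab; have e3 := mE CG a b ab.
  have e4 : (b - a)%:E = ((F b - F a)%:E + ((b - F b) - (a - F a))%:E)%E.
    by rewrite -EFinD; congr EFin; ring.
  have e5 := measure_addE mF mG `]a, b]%classic.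
  exact: (etrans e1 (etrans e4 (etrans (f_equal2 adde (esym e2) (esym e3)) (esym e5)))).
have mFfin : fin_num_fun mF.
  move=> A mA; rewrite ge0_fin_numE// (le_lt_trans (y := mF setT))//.
    by rewrite le_measure ?inE.
  rewrite (le_lt_trans (y := C%:E)) ?ltry//.
  pose I n : set R := `](- n%:R), n%:R]%classic.
  have cI : mF (I n) @[n --> \oo] --> mF (\bigcup_n I n).
    apply: nondecreasing_cvg_mu; rewrite /I//; first exact: bigcup_measurable.
    by move=> *; apply/subsetPset/subset_itv; rewrite leBSide/= ?lerN2 ler_nat.
  rewrite -(bigcup_itvT false false) -(cvg_lim _ cI)//.
  apply: lime_le; first by apply/cvg_ex; eexists; exact: cI.
  have eqle (p q r : \bar R) : p = q -> (q <= r)%E -> (p <= r)%E by move=> ->.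
  near=> n; have nn : - n%:R <= n%:R :> R by rewrite ge0_cp.
  apply: (eqle _ _ _ (mE CF _ _ nn)).
  rewrite lee_fin/=; by have /andP[_ h1] := F01 n%:R; have /andP[h2 _] := F01 (- n%:R); lra.
pose nF : {finite_measure set (measurableTypeR R) -> \bar R} :=
  HB.pack (lebesgue_stieltjes_measure CF)
    (Measure_isFinite.Build _ _ _ (lebesgue_stieltjes_measure CF) mFfin).
have dom : nF `<< leb.
  apply/null_content_dominatesP => A mA A0.
  have := lebE A mA; rewrite A0 => /esym/eqP.
  by rewrite padde_eq0// => /andP[/eqP].
have [G [G0 Gfin Gint GE]] := radon_nikodym_sigma_finite dom.
pose g x := fine (G x).
have gE : EFin \o g = G by apply/funext => x; rewrite /g/= fineK.
have gint : leb.-integrable setT (EFin \o g) by rewrite gE.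
have gab a b : a <= b -> \int[leb]_(x in `]a, b]) g x = F b - F a.
  move=> ab; rewrite /Rintegral; under eq_integral do rewrite -[(g _)%:E]/((EFin \o g) _) gE.
  rewrite -GE; last exact: measurable_itv.
  exact: (congr1 fine (mE CF _ _ ab)).
exists g; split => //.
pose Phi y := \int[leb]_(t in `]-oo, y]) g t.
have PhiB x y : x <= y -> Phi y - Phi x = F y - F x.
  move=> xy; rewrite -gab// /Phi.
  apply: (@Rintegral_itvB R g -oo%O (BRight y) x) => //.
  by apply: integrable_itv => //; exact: measurable_itv.
have PhiE y : F y = Phi y - (Phi 0 - F 0).
  by have [/PhiB|/ltW/PhiB] := leP 0 y; lra.
have : {ae leb, forall x : R, derivable Phi x 1 /\ derive1 Phi x = g x}.
  apply: FTC1Ny; first by move=> y; apply: integrable_itv => //; exact: measurable_itv.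
  exact: open_integrable_locally openT gint.
apply: filterS; first exact: (ae_filter_ringOfSetsType leb).
move=> x [dPhi dE].
have -> : F = (fun y => Phi y - (Phi 0 - F 0)) by apply/funext => y; rewrite {1}PhiE.
have h : is_derive x 1 Phi (g x) by split; [exact: dPhi|rewrite -dE derive1E].
by apply: is_derive_eq; rewrite subr0.
Unshelve. all: by end_near. Qed.

End LipschitzDensity.

Section LipschitzDerivative.
Context {R : realType}.
Notation leb := (@lebesgue_measure R).

Lemma ae_and (P Q : R -> Prop) :
  {ae leb, forall x, P x} -> {ae leb, forall x, Q x} ->
  {ae leb, forall x, P x /\ Q x}.
Proof.
by apply: filterS2; [exact: (ae_filter_ringOfSetsType leb)|move=> x].
Qed.

Lemma ae_imp (P Q : R -> Prop) : (forall x, P x -> Q x) ->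
  {ae leb, forall x, P x} -> {ae leb, forall x, Q x}.
Proof. by move=> PQ; apply: filterS; first exact: (ae_filter_ringOfSetsType leb). Qed.

Lemma ae_foralln (P : nat -> R -> Prop) :
  (forall n, {ae leb, forall x, P n x}) -> {ae leb, forall x, forall n, P n x}.
Proof.
move=> h; rewrite /prop_near1/= /nbhs/= /almost_everywhere.
have : leb.-negligible (\bigcup_n ~` [set x | P n x]) by apply: negligible_bigcup => n; exact: h.
apply: negligibleS => x /=; rewrite -existsNP => -[n hn].
by exists n.
Qed.

Lemma is_derive_affine (k c : R) (x : R) : is_derive x 1 (fun y => k * y + c) k.
Proof.
have h := is_deriveD (is_deriveZ k (is_derive_id x (1 : R))) (is_derive_cst c x (1 : R)).
by apply: is_derive_eq h _; rewrite addr0; exact: mulr1.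
Qed.

Lemma integrable_bounded_oc (g : R -> R) (a b K : R) : a <= b ->
  measurable_fun setT (g : measurableTypeR R -> R) -> (forall x, `|g x| <= K) ->
  leb.-integrable `]a, b]%classic (EFin \o g).
Proof.
move=> ab mg gK.
have mI : measurable (`]a, b]%classic : set (measurableTypeR R)) by exact: measurable_itv.
apply: (@bounded_Rintegrable R _ (measurableTypeR R) leb _ (b - a) g K mI).
- exact: lebesgue_itv_oc.
- exact: (@measurable_funS _ _ (measurableTypeR R) _ setT).
- by move=> t _; exact: gK.
Qed.

(** Adding a linear function and rescaling make f nondecreasing, with increments
    bounded by those of the identity: this is the case of stieltjes_density. *)
Lemma lipschitz_ae_derive (f : R -> R) (a b K : R) : a <= b ->
  (forall x y, a <= x <= b -> a <= y <= b -> `|f x - f y| <= K * `|x - y|) ->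
  exists g : R -> R, [/\ measurable_fun setT (g : measurableTypeR R -> R),
    leb.-integrable `]a, b]%classic (EFin \o g),
    forall s, a <= s <= b -> \int[leb]_(x in `]a, s]) g x = f s - f a &
    {ae leb, forall x : R, a < x < b -> is_derive x 1 f (g x)}].
Proof.
move=> ab fK.
pose c (x : R) := Num.max a (Num.min x b).
have cab x : a <= c x <= b by rewrite /c le_max lexx/= ge_max ab ge_min lexx orbT.
have cid x : a <= x <= b -> c x = x.
  by move=> /andP[h1 h2]; rewrite /c (min_idPl h2) (max_idPr h1).
have cnd x y : x <= y -> 0 <= c y - c x <= y - x.
  move=> xy; rewrite /c; case: (leP x b) => ?; case: (leP y b) => ?;
  by case: (leP a x) => ?; case: (leP a y) => ?; rewrite ?(max_idPr ab); apply/andP; split; lra.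
pose L := `|K| + 1.
have L0 : 0 < L by rewrite ltr_wpDl.
have fL x y : a <= x -> x <= y -> y <= b -> - (L * (y - x)) <= f y - f x <= L * (y - x).
  move=> ax xy yb; rewrite -ler_norml.
  have := fK y x; rewrite (le_trans ax xy) yb ax (le_trans xy yb) => /(_ isT isT).
  move=> /le_trans; apply; rewrite ger0_norm ?subr_ge0// ler_wpM2r ?subr_ge0//.
  by rewrite (le_trans (ler_norm _))// lerDl.
pose F x := (f (c x) - f a + L * (c x - a)) / (2 * L).
have FL x y : x <= y -> 0 <= F y - F x <= y - x.
  move=> xy; have /andP[h1 h2] := cnd x y xy.
  have /andP[ax xb] := cab x; have /andP[ay yb] := cab y.
  have cxy : c x <= c y by rewrite -subr_ge0.
  have /andP[h3 h4] := fL _ _ ax cxy yb.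
  have -> : F y - F x = (f (c y) - f (c x) + L * (c y - c x)) / (2 * L) by rewrite /F; ring.
  rewrite divr_ge0 ?mulr_ge0 ?(ltW L0)//=; last by lra.
  rewrite ler_pdivrMr ?mulr_gt0//.
  have : L * (c y - c x) <= L * (y - x) by rewrite ler_wpM2l// ltW.
  by lra.
have Fa x : x <= a -> F x = 0.
  by move=> xa; rewrite /F /c (min_idPl (le_trans xa ab)) (max_idPl xa); ring.
have F01 x : 0 <= F x <= b - a.
  have /andP[ax xb] := cab x.
  have /andP[h3 h4] := fL _ _ (lexx a) ax xb.
  rewrite divr_ge0 ?mulr_ge0 ?(ltW L0)//=; last by lra.
  rewrite ler_pdivrMr ?mulr_gt0//.
  have : L * (c x - a) <= L * (b - a) by rewrite ler_wpM2l ?lerD2r// ltW.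
  by lra.
have [g [gi gI gae]] := stieltjes_density FL F01.
have mg : measurable_fun setT (g : measurableTypeR R -> R).
  by apply/measurable_EFinP; exact: (measurable_int leb gi).
have fE s : a <= s <= b -> f s = 2 * L * F s - L * (s - a) + f a.
  by move=> sab; rewrite /F (cid s sab); field; rewrite gt_eqF.
have gab s : a <= s -> leb.-integrable `]a, s]%classic (EFin \o g).
  by move=> _; apply: integrable_itv gi; exact: measurable_itv.
have fin s : a <= s -> leb `]a, s]%classic = (s - a)%:E by exact: lebesgue_itv_oc.
have icst s (k : R) : a <= s -> leb.-integrable `]a, s]%classic (EFin \o cst k).
  by move=> as_; apply: (@integrable_bounded_oc _ _ _ `|k|).
have mI s : measurable (`]a, s]%classic : set (measurableTypeR R)) by exact: measurable_itv.
have i2 s : a <= s -> leb.-integrable `]a, s]%classic (EFin \o (fun x => 2 * L * g x)).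
  move=> as_.
  exact: (@integrableZl _ (measurableTypeR R) R leb _ (mI s) (2 * L) _ (gab s as_)).
exists (fun x => 2 * L * g x - L); split.
- by apply: measurable_funB => //; apply: measurable_funM.
- exact: (@integrableB _ (measurableTypeR R) R leb _ (mI b) _ _ (i2 b ab) (icst b L ab)).
- move=> s /andP[as_ sb].
  rewrite (@RintegralB _ (measurableTypeR R) R leb _ _ _ (mI s) (i2 s as_) (icst s L as_)).
  rewrite (@RintegralZl _ (measurableTypeR R) R leb _ g (2 * L) (mI s) (gab s as_)).
  rewrite gI// (@Rintegral_cst _ (measurableTypeR R) R leb _ (mI s)).
  rewrite (_ : fine _ = s - a); last exact: (congr1 fine (fin s as_)).
  by rewrite (fE s) ?as_// (Fa a)//; ring.
- apply: ae_imp gae => x dF /andP[ax xb].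
  apply: (@near_eq_is_derive _ _ _ (fun y => 2 * L * F y - (L * y + (- L * a - f a)))).
    near=> y; rewrite [RHS]fE; first by ring.
    apply/andP; split; apply: ltW; near: y; [exact: lt_nbhsr|exact: lt_nbhsl].
  have h2 := is_derive_affine L (- L * a - f a) x.
  have h1 : is_derive x 1 (fun y => 2 * L * F y) (2 * L * g x).
    exact: (is_deriveZ (2 * L) dF).
  exact: is_deriveB.
Unshelve. all: by end_near. Qed.

Lemma Rintegral_oc_split (g : R -> R) (a b c K : R) : a <= b -> b <= c ->
  measurable_fun setT (g : measurableTypeR R -> R) -> (forall x, `|g x| <= K) ->
  \int[leb]_(x in `]a, c]) g x =
  \int[leb]_(x in `]a, b]) g x + \int[leb]_(x in `]b, c]) g x.
Proof.
move=> ab bc mg gK.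
rewrite -(@Rintegral_itvB R g (BRight a) (BRight c) b) ?bnd_simp//.
  by rewrite addrC subrK.
exact: integrable_bounded_oc (le_trans ab bc) mg gK.
Qed.

Lemma Rintegral_oc_le (g : R -> R) (a b K : R) : a <= b ->
  measurable_fun setT (g : measurableTypeR R -> R) -> (forall x, `|g x| <= K) ->
  `|\int[leb]_(x in `]a, b]) g x| <= K * (b - a).
Proof.
move=> ab mg gK; have gi := integrable_bounded_oc ab mg gK.
have K0 : 0 <= K := le_trans (normr_ge0 _) (gK 0).
have mI : measurable (`]a, b]%classic : set (measurableTypeR R)) by exact: measurable_itv.
rewrite (le_trans (@le_normr_Rintegral _ (measurableTypeR R) R leb _ _ mI gi))//.
have h : \int[leb]_(x in `]a, b]) K = K * fine (leb `]a, b]%classic).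
  exact: (Rintegral_cst leb (measurable_itv `]a, b]) K).
have e : fine (leb `]a, b]%classic) = b - a := congr1 fine (lebesgue_itv_oc ab).
rewrite e in h; rewrite -h; apply: le_Rintegral => //.
- exact: integrable_norm.
- by apply: (@integrable_bounded_oc (fun=> K) _ _ `|K|).
Qed.

Lemma integral_ae_derive (g : R -> R) (a b K : R) : a <= b ->
  measurable_fun setT (g : measurableTypeR R -> R) -> (forall x, `|g x| <= K) ->
  {ae leb, forall s : R, a < s < b ->
    is_derive s 1 (fun s => \int[leb]_(x in `]s, b]) g x) (- g s)}.
Proof.
move=> ab mg gK; have gi := integrable_bounded_oc ab mg gK.
have loc := integrable_locally (measurable_itv `]a, b]) gi.
have := lebesgue_differentiation loc; apply: ae_imp => x lx /andP[ax xb].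
set h := g \_ _ in loc lx.
have hi : leb.-integrable `]a, b]%classic (EFin \o h).
  apply: eq_integrable gi; first exact: measurable_itv.
  by move=> y yab; rewrite /= /h patchE yab.
have [dh eh] := @FTC1_lebesgue_pt R h (BRight a) x b xb hi ax lx.
have hx : h x = g x by rewrite /h patchE mem_set//= in_itv/= ax ltW.
have dP : is_derive x 1 (fun y => \int[leb]_(t in `]a, y]) h t) (g x).
  by split => //; rewrite -hx -eh derive1E.
apply: (@near_eq_is_derive _ _ _ (fun y => \int[leb]_(t in `]a, b]) g t - \int[leb]_(t in `]a, y]) h t)).
  near=> y.
  have ay : a <= y by apply: ltW; near: y; exact: lt_nbhsr.
  have yb : y <= b by apply: ltW; near: y; exact: lt_nbhsl.
  have -> : \int[leb]_(t in `]a, y]) h t = \int[leb]_(t in `]a, y]) g t.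
    apply: (@eq_Rintegral _ (measurableTypeR R) R leb) => t; rewrite inE/= in_itv/= => /andP[ta ty].
    by rewrite /h patchE mem_set//= in_itv/= ta (le_trans ty).
  by rewrite (Rintegral_oc_split ay yb mg gK) addrC addKr.
have hc := is_derive_cst (\int[leb]_(t in `]a, b]) g t) x (1 : R).
by apply: is_derive_eq (is_deriveB hc dP) _; rewrite sub0r.
Unshelve. all: by end_near. Qed.

End LipschitzDerivative.

(** * Lebesgue and Borel measurability *)

Section LebesgueMeasurability.
Context {R : realType}.
Notation leb := (@lebesgue_measure R).

Lemma lebesgue_measurable_of_ae (D : set R) (f g : R -> R) : measurable D ->
  @measurable_fun _ _ (measurableTypeR R) R D g ->
  {ae leb, forall s, D s -> f s = g s} -> lebesgue_measurable_fun D f.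
Proof.
move=> mD mg [N [mN N0 hN]] _ Y mY.
apply: sub_sigma_algebra.
exists ((D `&` g @^-1` Y) `\` N); first by apply: measurableD => //; exact: mg.
exists ((D `&` f @^-1` Y) `&` N); first by exists N; split => // x [].
have fg x : ~ N x -> D x -> f x = g x.
  by move=> Nx Dx; apply: contrapT => h; apply: Nx; apply: hN => /= h'; apply: h; exact: h'.
apply/seteqP; split => x /=.
  by move=> [[[Dx Yx] Nx]|[]//]; split => //; rewrite fg.
move=> [Dx Yx]; have [Nx|Nx] := pselect (N x); first by right.
by left; split => //; split => //; rewrite -fg.
Qed.

Lemma lebesgue_measurable_of_cvg (D : set R) (f : R -> R) (h : nat -> R -> R) :
  measurable D -> (forall n, measurable_fun setT (h n : measurableTypeR R -> R)) ->
  {ae leb, forall s, D s -> h n s @[n --> \oo] --> f s} ->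
  lebesgue_measurable_fun D f.
Proof.
move=> mD mh [N [mN N0 hN]].
have mDN : measurable (D `\` N) by exact: measurableD.
have mdn : @measurable_fun _ _ (measurableTypeR R) R (D `\` N) f.
  apply: (@measurable_fun_cvg _ (measurableTypeR R) R (D `\` N) h).
    by move=> n; apply: measurable_funS (mh n).
  move=> x [Dx Nx]; apply: contrapT => hx; apply: Nx; apply: hN => /= h'.
  exact/hx/h'.
apply: (@lebesgue_measurable_of_ae D f (f \_ (D `\` N))) => //.
  apply: (@measurable_funS _ _ (measurableTypeR R) _ setT) => //.
  by apply/(measurable_restrictT _ _).1.
exists N; split => // x /= hx; apply: contrapT => Nx; apply: hx => Dx.
by rewrite patchE mem_set.
Qed.

(** Countably many rays determine f, and the preimage of each of them is Borel up
    to a null set. *)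
Lemma borel_of_lebesgue_measurable (D : set R) (f : R -> R) : measurable D ->
  lebesgue_measurable_fun D f ->
  exists N : set R, [/\ measurable N, leb N = 0 &
    @measurable_fun _ _ (measurableTypeR R) R (D `\` N) f].
Proof.
move=> mD mf.
have mDc : measurable (D : set (g_sigma_algebraType (completed_algebra_gen leb))).
  by apply: sub_sigma_algebra; exists D => //; exists set0; rewrite ?setU0//; exact: negligible_set0.
pose q (n : nat) : R := ratr (odflt 0 (unpickle n : option rat)).
have mq n : measurable (`]q n, +oo[%classic : set R) by exact: measurable_itv.
have h n : exists AB : set R * set R, [/\ measurable AB.1, measurable AB.2, leb AB.2 = 0,
    (D `&` f @^-1` `]q n, +oo[%classic) `\` AB.2 `<=` AB.1 &
    AB.1 `<=` D `&` f @^-1` `]q n, +oo[%classic].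
  have : completed_algebra_gen leb (D `&` f @^-1` `]q n, +oo[%classic).
    by rewrite -g_sigma_completed_algebra_genE; exact: mf mDc _ (mq n).
  move=> [A mA [Z [B [mB B0 ZB]] e]]; exists (A, B); split => //=.
    by rewrite -e => x [[//|/ZB]].
  by rewrite -e => x Ax; left.
have [AB hAB] := choice h.
pose N := \bigcup_n (AB n).2.
have mN : measurable N by apply: bigcupT_measurable => n; have [] := hAB n.
exists N; split => //.
  have /negligibleP : leb.-negligible N.
    apply: negligible_bigcup => n; have [_ m0 l0 _ _] := hAB n.
    by exists (AB n).2; split.
  exact.
apply: (@measurability _ _ (measurableTypeR R) (measurableTypeR R) _ _ _ (RGenOInfty.measurableE R)) => _ [_ [x ->] <-].
rewrite (_ : _ `&` _ = \bigcup_(n in [set n | x < q n]) ((AB n).1 `\` N)).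
  by apply: bigcup_measurable => n _; apply: measurableD => //; have [] := hAB n.
apply/seteqP; split => y /=.
  rewrite in_itv/= andbT => -[[Dy Ny] xy].
  have [r] := rat_in_itvoo xy; rewrite in_itv/= => /andP[xr ry].
  have qr : q (pickle r) = ratr r by rewrite /q pickleK.
  exists (pickle r); first by rewrite /= qr.
  split => //; have [_ _ _ hs _] := hAB (pickle r); apply: hs; split.
    by split => //=; rewrite in_itv/= andbT qr.
  by move=> By; apply: Ny; exists (pickle r).
move=> [n /= xq [Ay Ny]]; have [_ _ _ _ hs] := hAB n.
have [Dy] := hs _ Ay; rewrite /= !in_itv/= !andbT => qf.
by split => //; exact: lt_trans qf.
Qed.

(** The line is cut into countably many intervals on each of which the function
    is one of the G j. *)
Lemma measurable_trunc (G : nat -> R -> R) (k : nat) (c : R) :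
  (forall j, measurable_fun setT (G j : measurableTypeR R -> R)) ->
  measurable_fun setT ((fun s => G (Num.trunc (k%:R * (s + c))) s) : measurableTypeR R -> R).
Proof.
move=> mG.
have mk : measurable_fun setT (fun s : measurableTypeR R => k%:R * (s + c) : R).
  by apply: measurable_funM => //; apply: measurable_funD.
have mc j : measurable [set s : measurableTypeR R | Num.trunc (k%:R * (s + c) : R) = j].
  have [->|j0] := eqVneq j 0%N.
    rewrite (_ : [set _ | _] = setT `&` (fun s : R => k%:R * (s + c)) @^-1` `]-oo, 1[%classic).
      exact: mk.
    apply/seteqP; split => s /=; rewrite in_itv/=; first by move/truncn0Pn; rewrite -ltNge.
    by move=> [_]; rewrite ltNge => /truncn0Pn.
  rewrite (_ : [set _ | _] = setT `&` (fun s : R => k%:R * (s + c)) @^-1` `[j%:R, j.+1%:R[%classic).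
    exact: mk.
  apply/seteqP; split => s /=; rewrite in_itv/=.
    move=> h; split => //; rewrite -h; apply: truncn_itv.
    rewrite leNgt; apply/negP => s0; move: j0; rewrite -h => /eqP; apply.
    by apply/truncn0Pn; rewrite -ltNge (lt_trans s0).
  by move=> [_]; exact: truncn_def.
move=> _ Y mY.
rewrite (_ : _ `&` _ = \bigcup_j ([set s : measurableTypeR R | Num.trunc (k%:R * (s + c) : R) = j] `&` (setT `&` G j @^-1` Y))).
  apply: bigcupT_measurable => j; apply: measurableI; first exact: mc.
  exact: mG.
apply/seteqP; split => s /=.
  by move=> [_ h]; exists (Num.trunc (k%:R * (s + c))).
by move=> [j _ [<- [_ h]]].
Qed.

End LebesgueMeasurability.

(** * Estimates for curves *)

Section Curves.
Context {R : realType}.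
Notation leb := (@lebesgue_measure R).

Lemma lipschitz_absolutely_continuous (a b K : R) (f : R -> R) :
  (forall x y, a <= x <= b -> a <= y <= b -> `|f x - f y| <= K * `|x - y|) ->
  absolutely_continuous a b f.
Proof.
move=> fK e e0; have K1 : 0 < `|K| + 1 by rewrite ltr_wpDl.
exists (e / (`|K| + 1)); first by rewrite divr_gt0.
move=> n x y xy _ sd; apply: (@le_lt_trans _ _ ((`|K| + 1) * \sum_(i < n) (y i - x i))).
  rewrite mulr_sumr; apply: ler_sum => i _; have [ax xiy yb] := xy i.
  apply: le_trans (fK (y i) (x i) _ _) _.
  - by rewrite (le_trans ax xiy) yb.
  - by rewrite ax (le_trans xiy yb).
  - rewrite ger0_norm ?subr_ge0// ler_wpM2r ?subr_ge0//.
    by rewrite (le_trans (ler_norm K))// lerDl.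
by rewrite mulrC -ltr_pdivlMr.
Qed.

Lemma absolutely_continuousB (a b : R) (f g : R -> R) :
  absolutely_continuous a b f -> absolutely_continuous a b g ->
  absolutely_continuous a b (fun x => f x - g x).
Proof.
move=> af ag e e0; have e20 : 0 < e / 2 by rewrite divr_gt0.
have [d1 d10 h1] := af _ e20; have [d2 d20 h2] := ag _ e20.
exists (Num.min d1 d2); first by rewrite lt_min d10.
move=> n x y xy disj; rewrite lt_min => /andP[s1 s2].
apply: (@le_lt_trans _ _ (\sum_(i < n) `|f (y i) - f (x i)| + \sum_(i < n) `|g (y i) - g (x i)|)).
  rewrite -big_split/=; apply: ler_sum => i _.
  rewrite (_ : _ - _ = (f (y i) - f (x i)) - (g (y i) - g (x i))); last by ring.
  exact: ler_normB.
by rewrite (splitr e) ltrD// ?h1// h2.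
Qed.

Lemma absolutely_continuousS (a b c d : R) (f : R -> R) : a <= c -> d <= b ->
  absolutely_continuous a b f -> absolutely_continuous c d f.
Proof.
move=> ac db af e /af[dl dl0 h]; exists dl => // n x y xy; apply: h => i.
by have [? ? ?] := xy i; split => //; [exact: le_trans ac _|exact: le_trans _ db].
Qed.

Lemma absolutely_continuous_min (a b : R) (f : R -> R) : a <= b ->
  absolutely_continuous a b f ->
  exists2 c, a <= c <= b & forall s, a <= s <= b -> f c <= f s.
Proof.
move=> ab af.
pose c (x : R) := Num.max a (Num.min x b).
have cab x : a <= c x <= b by rewrite /c le_max lexx/= ge_max ab ge_min lexx orbT.
have cid x : a <= x <= b -> c x = x.
  by move=> /andP[h1 h2]; rewrite /c (min_idPl h2) (max_idPr h1).
have cL x y : `|c x - c y| <= `|x - y|.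
  rewrite /c.
  exact: le_trans (maxr_lipschitz _ _ _) (minr_lipschitz _ _ _).
have cont : continuous (f \o c).
  move=> x; apply/cvgrPdist_lt => e e0; have [d d0 h] := af e e0.
  near=> y.
  have h1 (u v : R) : a <= u -> u <= v -> v <= b -> v - u < d -> `|f v - f u| < e.
    move=> au uv vb uvd; have := h 1%N (fun=> u) (fun=> v); rewrite !big_ord1; apply => //.
    by move=> i j; rewrite !ord1 eqxx.
  have xyd : `|c x - c y| < d.
    apply: le_lt_trans (cL x y) _; near: y.
    by apply: (cvgr_dist_lt (F := nbhs x)) => //; exact: cvg_id.
  have /andP[ax xb] := cab x; have /andP[ay yb] := cab y.
  rewrite /=; have [xy|/ltW xy] := leP (c x) (c y).
    rewrite distrC; apply: h1 => //; move: xyd.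
    by rewrite distrC ger0_norm ?subr_ge0.
  by apply: h1 => //; move: xyd; rewrite ger0_norm ?subr_ge0.
have [x xab hx] := @EVT_min R (f \o c) a b ab (continuous_subspaceT cont).
exists (c x) => // s sab; have := hx s; rewrite in_itv/= => /(_ sab).
by rewrite (cid s sab).
Unshelve. all: by end_near. Qed.

Lemma geometric_cvg (u : nat -> R) (C : R) :
  (forall k, `|u k.+1 - u k| <= C / 2 ^+ k) ->
  exists l, forall k, `|u k - l| <= 2 * C / 2 ^+ k.
Proof.
move=> uC; pose lo k := u k - 2 * C / 2 ^+ k; pose hi k := u k + 2 * C / 2 ^+ k.
have C0 : 0 <= C by rewrite (le_trans (normr_ge0 _) (le_trans (uC 0%N) _))// expr0 divr1.
have e k : 2 * C / 2 ^+ k.+1 = C / 2 ^+ k.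
  by rewrite exprS invfM mulrA; congr (_ / _); rewrite mulrAC mulfV ?mul1r.
have e2 k : 2 * C / 2 ^+ k = C / 2 ^+ k + C / 2 ^+ k by rewrite -mulrA mulr2n mulrDl mul1r.
have lo_nd : {homo lo : i j / (i <= j)%N >-> i <= j}.
  apply: homo_leq; [exact: lexx|exact: le_trans|move=> k].
  have := uC k; rewrite ler_norml => /andP[h _].
  by rewrite /lo (e k) e2; lra.
have hi_ni : {homo hi : i j / (i <= j)%N >-> i >= j}.
  apply: (@homo_leq _ hi (fun x y => y <= x)); [by move=> ?; exact: lexx|by move=> y x z xy yz; exact: le_trans yz xy|move=> k].
  have := uC k; rewrite ler_norml => /andP[_ h].
  by rewrite /hi (e k) e2; lra.
have lohi j k : lo j <= hi k.
  apply: (@le_trans _ _ (lo (maxn j k))); first by apply: lo_nd; rewrite leq_maxl.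
  apply: (@le_trans _ _ (hi (maxn j k))); last by apply: hi_ni; rewrite leq_maxr.
  have : 0 <= 2 * C / 2 ^+ (maxn j k) by rewrite divr_ge0 ?mulr_ge0 ?exprn_ge0.
  by rewrite /lo /hi; lra.
have hs : has_sup (range lo).
  by split; [exists (lo 0%N); exists 0%N|exists (hi 0%N) => _ [k _ <-]].
exists (sup (range lo)) => k; rewrite ler_distl; apply/andP; split.
  by rewrite lerBlDr; apply: ge_sup; [case: hs|move=> _ [j _ <-]; exact: lohi].
by rewrite -lerBlDr; apply: ub_le_sup; [case: hs|exists k].
Qed.

Lemma primitive_lipschitz (g : R -> R) (v K s r : R) :
  measurable_fun setT (g : measurableTypeR R -> R) -> (forall x, `|g x| <= K) ->
  `|\int[leb]_(x in `]s, v]) g x - \int[leb]_(x in `]r, v]) g x| <= K * `|s - r|.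
Proof.
move=> mg gK; have K0 : 0 <= K := le_trans (normr_ge0 _) (gK 0).
wlog sr : s r / s <= r => [h|].
  by have [/h//|/ltW/h] := leP s r; rewrite distrC (distrC s).
have minE (x : R) : \int[leb]_(y in `]x, v]) g y = \int[leb]_(y in `](Num.min x v), v]) g y.
  have [//|vx] := leP x v.
  by rewrite !set_itv_ge// bnd_simp -leNgt// ltW.
rewrite (minE s) (minE r).
have mm : Num.min s v <= Num.min r v by rewrite le_min ge_min sr ge_min lexx orbT.
rewrite (Rintegral_oc_split (c := v) mm _ mg gK) ?ge_min ?lexx ?orbT// addrK.
apply: le_trans (Rintegral_oc_le mm mg gK) _; rewrite ler_wpM2l//.
by rewrite -(ger0_norm (_ : 0 <= _ - _)) ?subr_ge0// (le_trans (minr_lipschitz _ _ _))// distrC.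
Qed.

Lemma is_derive_expR_affine (a v x : R) :
  is_derive x 1 (fun r => expR (a * (v - r))) (- (a * expR (a * (v - x)))).
Proof.
have h := is_derive_affine (- a) (a * v) x.
have -> : (fun r => expR (a * (v - r))) = expR \o (fun r => - a * r + a * v).
  by apply/funext => r /=; congr expR; ring.
have := @is_derive1_comp _ expR (fun r => - a * r + a * v) x _ _ (is_derive_expR _) h.
by move/is_derive_eq; apply; rewrite (_ : - a * x + a * v = a * (v - x)); ring.
Qed.

Lemma Rintegral_expR (a s v : R) : 0 < a -> s <= v ->
  leb.-integrable `]s, v]%classic (EFin \o (fun r => expR (a * (v - r)))) /\
  \int[leb]_(r in `]s, v]) expR (a * (v - r)) = (expR (a * (v - s)) - 1) / a.
Proof.
move=> a0 sv.
pose f (r : R) := expR (a * (v - r)).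
have df x := is_derive_expR_affine a v x.
have cf : continuous f by move=> x; apply: differentiable_continuous; apply/derivable1_diffP; case: (df x).
have fi : leb.-integrable `[s, v]%classic (EFin \o f).
  apply: continuous_compact_integrable; first exact: segment_compact.
  exact: continuous_subspaceT.
have fi' : leb.-integrable `]s, v]%classic (EFin \o f).
  apply: integrableS fi; [exact: measurable_itv|exact: measurable_itv|].
  by apply: subset_itvr; rewrite bnd_simp.
split=> //; move: sv fi fi'; rewrite le_eqVlt => /predU1P[->|sv] fi fi'.
  by rewrite set_itv_ge ?bnd_simp ?ltxx// Rintegral_set0 subrr mulr0 expR0 subrr mul0r.
pose F (r : R) := - a^-1 * f r.
have dF (x : R) : is_derive x 1 F (f x).
  have h := is_deriveZ (- a^-1) (df x); apply: is_derive_eq h _.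
  by rewrite scalerN -scaleNr opprK /f /GRing.scale/=; rewrite mulKf// gt_eqF.
have cF : continuous F by move=> x; apply: differentiable_continuous; apply/derivable1_diffP; case: (dF x).
have h : (\int[leb]_(x in `[s, v]) (f x)%:E = (F v)%:E - (F s)%:E)%E.
  apply: continuous_FTC2 => //; first exact: continuous_subspaceT.
    split; [by move=> x _; case: (dF x)|exact: cvg_at_right_filter (cF s)|exact: cvg_at_left_filter (cF v)].
  by move=> x _; rewrite derive1E; case: (dF x).
rewrite Rintegral_itv_obnd_cbnd// /Rintegral h /= /F /f subrr mulr0 expR0.
by field; rewrite gt_eqF.
Qed.

(** Integration divides the exponential weight of rate a by a, which makes the
    Picard map a contraction for this weight. *)
Lemma Rintegral_expR_le (g : R -> R) (a s v K C : R) : 0 < a -> 0 <= C -> s <= v ->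
  measurable_fun setT (g : measurableTypeR R -> R) -> (forall x, `|g x| <= K) ->
  (forall r, s < r <= v -> `|g r| <= C * expR (a * (v - r))) ->
  `|\int[leb]_(r in `]s, v]) g r| <= C / a * expR (a * (v - s)).
Proof.
move=> a0 C0 sv mg gK gC; have gi := integrable_bounded_oc sv mg gK.
have [ei eI] := Rintegral_expR a0 sv.
have mI : measurable (`]s, v]%classic : set (measurableTypeR R)) by exact: measurable_itv.
rewrite (le_trans (@le_normr_Rintegral _ (measurableTypeR R) R leb _ _ mI gi))//.
apply: (@le_trans _ _ (\int[leb]_(r in `]s, v]) (C * expR (a * (v - r))))).
  apply: (@le_Rintegral _ (measurableTypeR R) R leb _ _ _ mI).
  - exact: integrable_norm.
  - exact: (@integrableZl _ (measurableTypeR R) R leb _ mI C _ ei).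
  - by move=> r /=; rewrite in_itv/= => /gC.
rewrite (@RintegralZl _ (measurableTypeR R) R leb _ (fun r => expR (a * (v - r))) C mI ei) eI.
rewrite mulrAC -mulrA ler_wpM2l// ler_wpM2r ?invr_ge0 ?(ltW a0)//.
by rewrite lerBlDr lerDl.
Qed.

End Curves.

(** * The time-dependent vector field *)

Section VectorField.
Context {R : realType} (M : R -> R[i] -> R[i]).
Notation leb := (@lebesgue_measure R).
Hypothesis ML : forall s, cauchy_limit (M s).

Lemma field_le (e s : R) w : 0 < e -> e <= Im w -> normc (M s w) <= e^-1.
Proof.
move=> e0 ew; have w0 : uhp w by exact: lt_le_trans ew.
by rewrite (le_trans (cauchy_limit_le (ML s) w0))// lef_pV2.
Qed.

Lemma field_lipschitz (e s : R) w w' : 0 < e -> e <= Im w -> e <= Im w' ->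
  normc (M s w - M s w') <= normc (w - w') / (e * e).
Proof.
move=> e0 ew ew'; have w0 : uhp w by exact: lt_le_trans ew.
have w'0 : uhp w' by exact: lt_le_trans ew'.
rewrite (le_trans (cauchy_limit_lipschitz (ML s) w0 w'0))//.
rewrite ler_wpM2l ?normc_ge0// lef_pV2 ?posrE ?mulr_gt0//.
by rewrite ler_pM// ltW.
Qed.

(** On an interval of length at most c^2 / 4 at whose right end the curves agree,
    absolutely_continuous_increment bounds their distance by half of any bound
    of it, so that they agree; then proceed backwards from b by such steps. *)
Lemma loewner_curve_unique (a b c : R) (p q : R -> R[i]) : a <= b -> 0 < c ->
  complex_absolutely_continuous a b p -> complex_absolutely_continuous a b q ->
  (forall s, a <= s <= b -> c <= Im (p s)) -> (forall s, a <= s <= b -> c <= Im (q s)) ->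
  {ae leb, forall s : R, s \in `[a, b] -> complex_is_derive s p (M s (p s))} ->
  {ae leb, forall s : R, s \in `[a, b] -> complex_is_derive s q (M s (q s))} ->
  p b = q b -> forall s, a <= s <= b -> p s = q s.
Proof.
move=> ab c0 [acp1 acp2] [acq1 acq2] pc qc op oq pqb.
have inc s0 b' K : a <= s0 -> s0 <= b' -> b' <= b -> p b' = q b' -> 0 <= K ->
    (forall s, s0 <= s <= b' -> normc (M s (p s) - M s (q s)) <= K) ->
    normc (p s0 - q s0) <= 2 * K * (b' - s0).
  move=> as0 s0b bb Db K0 hK.
  have sub s : s \in `[s0, b'] -> s \in `[a, b].
    by rewrite !in_itv/= => /andP[h1 h2]; rewrite (le_trans as0)//= (le_trans h2).
  have comp (f g : R -> R) (f' g' : R -> R) : absolutely_continuous a b f ->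
      absolutely_continuous a b g -> f b' = g b' ->
      (forall s, s0 <= s <= b' -> `|f' s - g' s| <= K) ->
      {ae leb, forall s : R, s \in `[a, b] -> is_derive s 1 f (f' s)} ->
      {ae leb, forall s : R, s \in `[a, b] -> is_derive s 1 g (g' s)} ->
      `|f s0 - g s0| <= K * (b' - s0).
    move=> af ag fgb fgK df dg.
    have := @absolutely_continuous_increment R (fun s => f s - g s) s0 b' K s0b K0.
    rewrite fgb subrr sub0r normrN; apply.
      by apply: (@absolutely_continuousS _ a b) => //; exact: absolutely_continuousB.
    apply: ae_imp (ae_and df dg) => s [h1 h2] sI; exists (f' s - g' s).
      have i1 := h1 (sub _ sI); have i2 := h2 (sub _ sI).
      exact: is_deriveB.
    by apply: fgK; move: sI; rewrite in_itv.
  rewrite (le_trans (normc_leD _))// ReB ImB -mulrA mulr2n mulrDl mul1r.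
  apply: lerD.
    apply: (comp (fun s => Re (p s)) (fun s => Re (q s)) (fun s => Re (M s (p s))) (fun s => Re (M s (q s)))) => //.
    - by rewrite Db.
    - by move=> s /hK; apply: le_trans; rewrite -ReB normr_Re_le.
    - by apply: ae_imp op => s h /h[].
    - by apply: ae_imp oq => s h /h[].
  apply: (comp (fun s => Im (p s)) (fun s => Im (q s)) (fun s => Im (M s (p s))) (fun s => Im (M s (q s)))) => //.
  - by rewrite Db.
  - by move=> s /hK; apply: le_trans; rewrite -ImB normr_Im_le.
  - by apply: ae_imp op => s h /h[].
  - by apply: ae_imp oq => s h /h[].
have half s0 b' : a <= s0 -> s0 <= b' -> b' <= b -> b' - s0 <= c * c / 4 ->
    p b' = q b' -> p s0 = q s0.
  move=> as0 s0b bb hb Db.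
  have H n : forall s, s0 <= s <= b' -> normc (p s - q s) <= c / 2 ^+ n.
    elim: n => [|n IH] s /andP[s0s sb].
      have bsc : b' - s <= c * c / 4 by lra.
      apply: le_trans (inc s b' (c^-1 + c^-1) _ sb bb Db _ _) _.
      - exact: le_trans s0s.
      - by rewrite addr_ge0 ?invr_ge0 ?(ltW c0).
      - move=> r /andP[sr rb]; have rab : a <= r <= b by apply/andP; split; lra.
        apply: le_trans (le_normcD _ _) _; rewrite normcN.
        by rewrite lerD// field_le// ?pc ?qc.
      - apply: (@le_trans _ _ (2 * (c^-1 + c^-1) * (c * c / 4))).
          by rewrite ler_wpM2l// mulr_ge0// addr_ge0 ?invr_ge0 ?(ltW c0).
        by rewrite [leLHS](_ : _ = c / 2 ^+ 0)//; field; rewrite gt_eqF.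
    have bsc : b' - s <= c * c / 4 by lra.
    have K0 : 0 <= c / 2 ^+ n / (c * c) by rewrite !divr_ge0 ?mulr_ge0 ?exprn_ge0 ?(ltW c0).
    apply: le_trans (inc s b' (c / 2 ^+ n / (c * c)) _ sb bb Db K0 _) _.
    - exact: le_trans s0s.
    - move=> r /andP[sr rb]; have rab : a <= r <= b by apply/andP; split; lra.
      apply: le_trans (field_lipschitz r c0 (pc _ rab) (qc _ rab)) _.
      rewrite ler_wpM2r ?invr_ge0 ?mulr_ge0 ?(ltW c0)//; apply: IH.
      by apply/andP; split; lra.
    - apply: (@le_trans _ _ (2 * (c / 2 ^+ n / (c * c)) * (c * c / 4))).
        by rewrite ler_wpM2l// mulr_ge0.
      rewrite [leLHS](_ : _ = c / 2 ^+ n.+1)// exprS; field.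
      by rewrite ?gt_eqF ?exprn_gt0.
  apply/eqP; rewrite -subr_eq0; apply/eqP/eq0_normc/eqP.
  rewrite eq_le normc_ge0 andbT; apply/ler_addgt0Pl => e e0; rewrite addr0.
  apply: le_trans (H (Num.trunc (c / e)).+1 s0 _) _; first by rewrite lexx.
  rewrite ler_pdivrMr ?exprn_gt0// mulrC -ler_pdivrMr//.
  apply: le_trans (ltW (truncnS_gt _)) _.
  by rewrite -natrX ler_nat ltnW// ltn_expl.
pose h := c * c / 4; have h0 : 0 < h by rewrite divr_gt0// mulr_gt0.
have main (k : nat) : forall s, a <= s <= b -> b - k%:R * h <= s -> p s = q s.
  elim: k => [|k IH] s /andP[as_ sb] bs.
    by have -> : s = b by apply/eqP; rewrite eq_le sb; move: bs; rewrite mul0r subr0.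
  pose b' := Num.max s (b - k%:R * h).
  have sb' : s <= b' by rewrite le_max lexx.
  have b'b : b' <= b by rewrite ge_max sb gerBl mulr_ge0// ltW.
  apply: (half s b') => //.
    rewrite lerBlDr ge_max lerDr (ltW h0)/=.
    by move: bs; rewrite -natr1 mulrDl mul1r -/h; lra.
  by apply: IH; [rewrite b'b (le_trans as_ sb')|rewrite le_max lexx orbT].
move=> s sab; apply: (main (Num.trunc ((b - a) / h)).+1 s sab).
have /andP[as_ _] := sab; rewrite lerBlDr -lerBlDl (@le_trans _ _ (b - a)) ?lerD2l ?lerN2//.
by rewrite -ler_pdivrMr// ltW// truncnS_gt.
Qed.

Hypothesis MRe : forall z, uhp z ->
  measurable_fun setT ((fun s => Re (M s z)) : measurableTypeR R -> R).
Hypothesis MIm : forall z, uhp z ->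
  measurable_fun setT ((fun s => Im (M s z)) : measurableTypeR R -> R).

(** The space of curves for the Picard iteration: at height e the field is
    bounded by e^-1. *)
Definition tame (e : R) (phi : R -> R[i]) :=
  [/\ forall s, e <= Im (phi s),
      forall s r, `|Re (phi s) - Re (phi r)| <= e^-1 * `|s - r| &
      forall s r, `|Im (phi s) - Im (phi r)| <= e^-1 * `|s - r|].

Lemma staircase_approx (n : nat) (s : R) : `|s| <= n%:R ->
  `|- n%:R + (Num.trunc (n.+1%:R * (s + n%:R)))%:R / n.+1%:R - s| <= n.+1%:R^-1.
Proof.
move=> sn; have n0 : 0 < n.+1%:R :> R by rewrite ltr0n.
have s0 : 0 <= n.+1%:R * (s + n%:R).
  by rewrite mulr_ge0// -lerBlDr sub0r; move: sn; rewrite ler_norml => /andP[].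
have /andP[] := truncn_itv s0; set j := Num.trunc _ => h1 h2.
have h1' : j%:R / n.+1%:R <= s + n%:R by rewrite ler_pdivrMr// mulrC.
have h2' : s + n%:R <= j%:R / n.+1%:R + n.+1%:R^-1.
  have -> : j%:R / n.+1%:R + n.+1%:R^-1 = j.+1%:R / n.+1%:R :> R.
    by rewrite -[j.+1%:R]natr1 mulrDl mul1r.
  by rewrite ler_pdivlMr// mulrC ltW.
have i0 : 0 <= n.+1%:R^-1 :> R by rewrite invr_ge0.
rewrite ler_norml; move: h1' h2' i0; move: (_^-1) => w; move: (j%:R * w) => u h1' h2' i0.
by apply/andP; split; lra.
Qed.

(** The field is Lipschitz in space, so composing it with the staircase
    approximations of the curve and passing to the limit keeps measurability. *)
Lemma measurable_field (e : R) phi : 0 < e -> tame e phi ->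
  measurable_fun setT ((fun s => Re (M s (phi s))) : measurableTypeR R -> R) /\
  measurable_fun setT ((fun s => Im (M s (phi s))) : measurableTypeR R -> R).
Proof.
move=> e0 [pe pR pI].
pose x n (j : nat) : R := - n%:R + j%:R / n.+1%:R.
pose y n (s : R) := x n (Num.trunc (n.+1%:R * (s + n%:R))).
have pu s : uhp (phi s) by exact: lt_le_trans (pe s).
have lip s r : normc (phi s - phi r) <= 2 * e^-1 * `|s - r|.
  by rewrite (le_trans (normc_leD _))// ReB ImB -mulrA mulr2n mulrDl mul1r lerD.
have key s n : normc (M s (phi (y n s)) - M s (phi s)) <=
    (2 * e^-1 / (e * e) + 2 * e^-1 * (`|s| + 1)) / n.+1%:R.
  have A0 : 0 <= 2 * e^-1 / (e * e) by rewrite divr_ge0 ?mulr_ge0 ?invr_ge0 ?(ltW e0).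
  have B0 : 0 <= 2 * e^-1 * (`|s| + 1) by rewrite !mulr_ge0 ?invr_ge0 ?(ltW e0)// addr_ge0.
  have n0 : 0 < n.+1%:R :> R by rewrite ltr0n.
  have [sn|ns] := leP `|s| n%:R.
    apply: le_trans (field_lipschitz s e0 (pe _) (pe _)) _.
    rewrite mulrDl ler_wpDr ?divr_ge0// [leRHS]mulrAC ler_wpM2r ?invr_ge0 ?mulr_ge0 ?(ltW e0)//.
    apply: le_trans (lip _ _) _; rewrite ler_wpM2l ?mulr_ge0 ?invr_ge0 ?(ltW e0)//.
    exact: staircase_approx.
  apply: (@le_trans _ _ (2 * e^-1)).
    apply: le_trans (le_normcD _ _) _; rewrite normcN mulr2n mulrDl mul1r.
    by apply: lerD; apply: field_le.
  apply: (@le_trans _ _ (2 * e^-1 * (`|s| + 1) / n.+1%:R)); last first.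
    by rewrite ler_wpM2r ?invr_ge0 ?(ltW n0)// lerDr.
  rewrite -[leRHS]mulrA ler_peMr ?mulr_ge0 ?invr_ge0 ?(ltW e0)//.
  by rewrite ler_pdivlMr// mul1r -natr1 lerD2r ltW.
split.
  apply: (@measurable_fun_cvg _ (measurableTypeR R) R setT (fun n s => Re (M s (phi (y n s))))).
    by move=> n; apply: (measurable_trunc (G := fun j s => Re (M s (phi (x n j))))) => j; exact: MRe.
  move=> s _; apply: cvg_by_harmonic => n; rewrite -ReB.
  exact: le_trans (normr_Re_le _) (key s n).
apply: (@measurable_fun_cvg _ (measurableTypeR R) R setT (fun n s => Im (M s (phi (y n s))))).
  by move=> n; apply: (measurable_trunc (G := fun j s => Im (M s (phi (x n j))))) => j; exact: MIm.
move=> s _; apply: cvg_by_harmonic => n; rewrite -ImB.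
exact: le_trans (normr_Im_le _) (key s n).
Qed.

End VectorField.

(** * Picard iteration *)

Section Limits.
Context {R : realType}.

Lemma normc_cvg0 (T : Type) (F : set_system T) (FF : Filter F) (u : T -> R[i]) (l : R[i]) :
  Re (u t) @[t --> F] --> Re l -> Im (u t) @[t --> F] --> Im l ->
  forall e : R, 0 < e -> \forall t \near F, normc (u t - l) < e.
Proof.
move=> hR hI e e0; have e20 : 0 < e / 2 by rewrite divr_gt0.
near=> t; rewrite (le_lt_trans (normc_leD _))// ReB ImB (splitr e) ltrD//.
  by near: t; move/cvgrPdistC_lt : hR; exact.
by near: t; move/cvgrPdistC_lt : hI; exact.
Unshelve. all: by end_near. Qed.

Lemma cauchy_limit_cvg (T : Type) (F : set_system T) (FF : ProperFilter F)
    (G : T -> R[i] -> R[i]) (g : R[i] -> R[i]) :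
  (forall t, cauchy_limit (G t)) ->
  (forall z, uhp z -> Re (G t z) @[t --> F] --> Re (g z)) ->
  (forall z, uhp z -> Im (G t z) @[t --> F] --> Im (g z)) ->
  cauchy_limit g.
Proof.
move=> GP hR hI; apply: cauchy_limit_closed => zs zsP e e0.
have /filter_ex[t ht] : \forall t \near F, forall z, z \in zs -> normc (G t z - g z) < e.
  apply: near_all_seq => z /zsP hz.
  by apply: normc_cvg0 => //; [exact: hR|exact: hI].
by exists (G t).
Qed.

End Limits.

Section Picard.
Context {R : realType} (M : R -> R[i] -> R[i]).
Notation leb := (@lebesgue_measure R).
Hypothesis ML : forall s, cauchy_limit (M s).
Hypothesis MRe : forall z, uhp z ->
  measurable_fun setT ((fun s => Re (M s z)) : measurableTypeR R -> R).
Hypothesis MIm : forall z, uhp z ->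
  measurable_fun setT ((fun s => Im (M s z)) : measurableTypeR R -> R).

Definition picard (v : R) (z : R[i]) (phi : R -> R[i]) (s : R) : R[i] :=
  z - ((\int[leb]_(r in `]s, v]) Re (M r (phi r))) +i*
       (\int[leb]_(r in `]s, v]) Im (M r (phi r)))).

Lemma tame_field_le (e : R) phi s : 0 < e -> tame e phi ->
  `|Re (M s (phi s))| <= e^-1 /\ `|Im (M s (phi s))| <= e^-1.
Proof.
move=> e0 [pe _ _]; have h := field_le ML s e0 (pe s).
by split; [exact: le_trans (normr_Re_le _) h|exact: le_trans (normr_Im_le _) h].
Qed.

Lemma picard_tame v z phi : uhp z -> tame (Im z) phi -> tame (Im z) (picard v z phi).
Proof.
move=> hz tp; have [mR mI] := measurable_field ML MRe MIm hz tp.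
have cancel (x a b : R) : (x - a) - (x - b) = b - a by ring.
split.
- move=> s; rewrite ImB lerBrDr gerDl /=.
  apply: (@le_trans _ _ (\int[leb]_(r in `]s, v]) 0)); last first.
    by rewrite Rintegral_cst ?mul0r//; exact: measurable_itv.
  have [vs|sv] := leP v s.
    by rewrite set_itv_ge ?bnd_simp -?leNgt// !Rintegral_set0.
  have mJ : measurable (`]s, v]%classic : set (measurableTypeR R)) by exact: measurable_itv.
  apply: (@le_Rintegral _ (measurableTypeR R) R leb _ _ _ mJ).
  + by apply: (integrable_bounded_oc (K := (Im z)^-1) (ltW sv) mI) => r; have [] := tame_field_le r hz tp.
  + apply: (@integrable_bounded_oc R (fun=> 0) s v 0 (ltW sv)); first exact: measurable_cst.
    by move=> _; rewrite normr0.
  + move=> r _; apply: cauchy_limit_Im_le0 => //; have [h _ _] := tp.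
    exact: lt_le_trans (h r).
- move=> s r; rewrite !ReB /= cancel distrC.
  by apply: primitive_lipschitz => // x; have [] := tame_field_le x hz tp.
- move=> s r; rewrite !ImB /= cancel distrC.
  by apply: primitive_lipschitz => // x; have [] := tame_field_le x hz tp.
Qed.

(** The field is 1/e^2-Lipschitz at height e, and the rate of the exponential
    weight is 4/e^2: each of the two components contributes C/4. *)
Lemma picard_contraction v (e C : R) phi psi z : 0 < e -> 0 <= C -> tame e phi -> tame e psi ->
  (forall s, normc (phi s - psi s) <= C * expR (4 / (e * e) * (v - s))) ->
  forall s, normc (picard v z phi s - picard v z psi s) <=
    C / 2 * expR (4 / (e * e) * (v - s)).
Proof.
move=> e0 C0 tp tq hC s.
have [mpR mpI] := measurable_field ML MRe MIm e0 tp.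
have [mqR mqI] := measurable_field ML MRe MIm e0 tq.
have [vs|sv] := leP v s.
  rewrite /picard !set_itv_ge ?bnd_simp -?leNgt// !Rintegral_set0 subrr normc0.
  by rewrite mulr_ge0 ?divr_ge0 ?expR_ge0.
set a := 4 / (e * e) in hC *; have a0 : 0 < a by rewrite divr_gt0// mulr_gt0.
have comp (f g : R -> R) : measurable_fun setT (f : measurableTypeR R -> R) ->
    measurable_fun setT (g : measurableTypeR R -> R) ->
    (forall r, `|f r| <= e^-1) -> (forall r, `|g r| <= e^-1) ->
    (forall r, `|f r - g r| <= normc (M r (phi r) - M r (psi r))) ->
    `|\int[leb]_(r in `]s, v]) f r - \int[leb]_(r in `]s, v]) g r| <= C / 4 * expR (a * (v - s)).
  move=> mf mg fe ge fg.
  have mJ : measurable (`]s, v]%classic : set (measurableTypeR R)) by exact: measurable_itv.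
  rewrite -(@RintegralB _ (measurableTypeR R) R leb _ _ _ mJ (integrable_bounded_oc (ltW sv) mf fe) (integrable_bounded_oc (ltW sv) mg ge)).
  rewrite (_ : C / 4 = C / (e * e) / a); last first.
    by rewrite /a; field; rewrite gt_eqF.
  apply: (@Rintegral_expR_le _ _ _ _ _ (e^-1 + e^-1)) => //.
  - by rewrite divr_ge0 ?mulr_ge0 ?(ltW e0).
  - exact: ltW.
  - exact: measurable_funB.
  - by move=> r; rewrite (le_trans (ler_normB _ _))// lerD.
  - move=> r _; apply: le_trans (fg r) _.
    have [pe _ _] := tp; have [qe _ _] := tq.
    apply: le_trans (field_lipschitz ML r e0 (pe r) (qe r)) _.
    by rewrite mulrAC ler_wpM2r ?invr_ge0 ?mulr_ge0 ?(ltW e0).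
rewrite (_ : C / 2 = C / 4 + C / 4); last by field.
rewrite mulrDl (le_trans (normc_leD _))// /picard !ReB !ImB /=.
have cancel (x c d : R) : (x - c) - (x - d) = - (c - d) by ring.
rewrite !cancel !normrN; apply: lerD; apply: comp => //.
- by move=> r; have [] := tame_field_le r e0 tp.
- by move=> r; have [] := tame_field_le r e0 tq.
- by move=> r; rewrite -ReB normr_Re_le.
- by move=> r; have [] := tame_field_le r e0 tp.
- by move=> r; have [] := tame_field_le r e0 tq.
- by move=> r; rewrite -ImB normr_Im_le.
Qed.

Definition iterate (v : R) (z : R[i]) (k : nat) : R -> R[i] := iter k (picard v z) (fun=> z).

Lemma iterate_tame v z k : uhp z -> tame (Im z) (iterate v z k).
Proof.
move=> hz; elim: k => [|k IH]; last exact: picard_tame.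
have e0 : 0 <= (Im z)^-1 by rewrite invr_ge0 ltW.
by split => //= s r; rewrite subrr normr0 mulr_ge0.
Qed.

Lemma iterate_step v z k s : uhp z -> normc (iterate v z k.+1 s - iterate v z k s) <=
  Im z / 2 / 2 ^+ k * expR (4 / (Im z * Im z) * (v - s)).
Proof.
move=> hz; have e0 : 0 < Im z := hz; set a := 4 / _.
have a0 : 0 < a by rewrite divr_gt0// mulr_gt0.
elim: k s => [|k IH] s.
  rewrite /iterate /= /picard addrAC subrr add0r expr0 divr1.
  have [mR mI] := measurable_field ML MRe MIm hz (iterate_tame v 0 hz).
  have bd r := tame_field_le r hz (iterate_tame v 0 hz).
  have [vs|sv] := leP v s.
    rewrite /picard !set_itv_ge ?bnd_simp -?leNgt// !Rintegral_set0 normcN normc0.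
    by rewrite mulr_ge0 ?divr_ge0 ?expR_ge0// ltW.
  apply: (@le_trans _ _ (2 * (Im z)^-1 * (v - s))).
    rewrite normcN (le_trans (normc_leD _))// -mulrA mulr2n mulrDl mul1r.
    apply: lerD; apply: Rintegral_oc_le => //; try exact: ltW; by move=> r; have [] := bd r.
  apply: (@le_trans _ _ (Im z / 2 * (a * (v - s)))).
    by rewrite [leRHS](_ : _ = 2 * (Im z)^-1 * (v - s))// /a; field; rewrite gt_eqF.
  rewrite ler_wpM2l ?divr_ge0 ?(ltW e0)// (le_trans _ (expR_ge1Dx _))//.
  by rewrite lerDr.
have := @picard_contraction v (Im z) (Im z / 2 / 2 ^+ k) _ _ z e0 _
  (iterate_tame v k.+1 hz) (iterate_tame v k hz) IH s.
rewrite !divr_ge0 ?exprn_ge0 ?(ltW e0)// => /(_ isT) /le_trans; apply.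
by rewrite exprSr (invfM (2 ^+ k) 2) (mulrA _ _ 2^-1).
Qed.

Definition flow (v : R) (z : R[i]) (s : R) : R[i] :=
  lim (Re (iterate v z k s) @[k --> \oo]) +i* lim (Im (iterate v z k s) @[k --> \oo]).

Lemma flow_cvg v z s : uhp z ->
  Re (iterate v z k s) @[k --> \oo] --> Re (flow v z s) /\
  Im (iterate v z k s) @[k --> \oo] --> Im (flow v z s).
Proof.
move=> hz; pose C := Im z / 2 * expR (4 / (Im z * Im z) * (v - s)).
have step (u : nat -> R) : (forall k, `|u k.+1 - u k| <=
    normc (iterate v z k.+1 s - iterate v z k s)) -> u k @[k --> \oo] --> lim (u k @[k --> \oo]).
  move=> hu; have [|l hl] := @geometric_cvg R u C.
    by move=> k; apply: le_trans (hu k) (le_trans (iterate_step v k s hz) _); rewrite mulrAC.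
  have C0 : 0 <= 2 * C by rewrite !mulr_ge0 ?invr_ge0 ?expR_ge0// ltW.
  have h : u k @[k --> \oo] --> l.
    apply: (@cvg_by_harmonic _ _ _ (2 * C)) => n; apply: le_trans (hl n) _.
    by rewrite ler_wpM2l// lef_pV2 ?posrE ?ltr0n ?exprn_gt0// -natrX ler_nat ltn_expl.
  by rewrite (cvg_lim _ h).
by split; apply: step => k; [rewrite -ReB normr_Re_le|rewrite -ImB normr_Im_le].
Qed.

Lemma flow_tame v z : uhp z -> tame (Im z) (flow v z).
Proof.
move=> hz; have it k := iterate_tame v k hz; have fc s := flow_cvg v s hz.
split.
- move=> s; apply: (cvgr_to_ge (fc s).2); apply: nearW => k.
  by have [h _ _] := it k; exact: h.
- move=> s r; apply: (cvgr_to_le (cvg_norm (cvgB (fc s).1 (fc r).1))); apply: nearW => k.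
  by have [_ h _] := it k; exact: h.
- move=> s r; apply: (cvgr_to_le (cvg_norm (cvgB (fc s).2 (fc r).2))); apply: nearW => k.
  by have [_ _ h] := it k; exact: h.
Qed.

Lemma flow_picard v z s : uhp z -> flow v z s = picard v z (flow v z) s.
Proof.
move=> hz; have it k := iterate_tame v k hz; have ft := flow_tame v hz.
have mit k := measurable_field ML MRe MIm hz (it k).
have [vs|sv] := leP v s.
  have [h1 h2] := flow_cvg v s hz.
  have iE k : iterate v z k s = z.
    case: k => [//|k]; rewrite /iterate iterS /picard !set_itv_ge ?bnd_simp -?leNgt// !Rintegral_set0.
    by rewrite subr0.
  rewrite /picard !set_itv_ge ?bnd_simp -?leNgt// !Rintegral_set0 subr0.
  have cst (f : R[i] -> R) : f (iterate v z k s) @[k --> \oo] --> f z.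
    by under eq_fun do rewrite iE; exact: cvg_cst.
  apply: eqC_ReIm; first exact: (cvg_unique _ h1 (cst _)).
  exact: (cvg_unique _ h2 (cst _)).
have Mcvg r : Re (M r (iterate v z k r)) @[k --> \oo] --> Re (M r (flow v z r)) /\
    Im (M r (iterate v z k r)) @[k --> \oo] --> Im (M r (flow v z r)).
  have close (e : R) : 0 < e -> \forall k \near \oo,
      normc (M r (iterate v z k r) - M r (flow v z r)) <= e.
    move=> e0; have zz : 0 < Im z * Im z by rewrite mulr_gt0.
    have [h1 h2] := flow_cvg v r hz.
    have ez : 0 < e * (Im z * Im z) by rewrite mulr_gt0.
    have FF : Filter (\oo : set_system nat) by exact: _.
    have := @normc_cvg0 R nat \oo FF (fun k => iterate v z k r) (flow v z r) h1 h2 _ ez.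
    apply: filterS => k hk; have [ie _ _] := it k; have [fe _ _] := ft.
    apply: le_trans (field_lipschitz ML r hz (ie r) (fe r)) _.
    by rewrite ler_pdivrMr// ltW.
  split; apply/cvgrPdist_le => e e0; apply: filterS (close e e0) => k; apply: le_trans.
    by rewrite distrC -ReB normr_Re_le.
  by rewrite distrC -ImB normr_Im_le.
have mJ : measurable (`]s, v]%classic : set (measurableTypeR R)) by exact: measurable_itv.
have ic : leb.-integrable `]s, v]%classic (EFin \o (fun=> (Im z)^-1)).
  by apply: (@integrable_bounded_oc R (fun=> (Im z)^-1) s v `|(Im z)^-1| (ltW sv)).
have IR : \int[leb]_(r in `]s, v]) Re (M r (iterate v z k r)) @[k --> \oo] -->
    \int[leb]_(r in `]s, v]) Re (M r (flow v z r)).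
  apply: (@Rintegral_dominated_cvg _ _ (measurableTypeR R) leb _ _ _ (fun=> (Im z)^-1) mJ _ _ ic).
  - by move=> k; apply: (@measurable_funS _ _ (measurableTypeR R) _ setT) => //; case: (mit k).
  - by move=> r _; case: (Mcvg r).
  - by move=> k r _; case: (tame_field_le r hz (it k)).
have II : \int[leb]_(r in `]s, v]) Im (M r (iterate v z k r)) @[k --> \oo] -->
    \int[leb]_(r in `]s, v]) Im (M r (flow v z r)).
  apply: (@Rintegral_dominated_cvg _ _ (measurableTypeR R) leb _ _ _ (fun=> (Im z)^-1) mJ _ _ ic).
  - by move=> k; apply: (@measurable_funS _ _ (measurableTypeR R) _ setT) => //; case: (mit k).
  - by move=> r _; case: (Mcvg r).
  - by move=> k r _; case: (tame_field_le r hz (it k)).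
have [h1 h2] := flow_cvg v s hz.
have h1' := cvgB (cvg_cst (Re z)) IR; have h2' := cvgB (cvg_cst (Im z)) II.
rewrite -cvg_shiftS in h1; rewrite -cvg_shiftS in h2.
have ReP phi : Re (picard v z phi s) = Re z - \int[leb]_(r in `]s, v]) Re (M r (phi r)).
  by rewrite /picard ReB.
have ImP phi : Im (picard v z phi s) = Im z - \int[leb]_(r in `]s, v]) Im (M r (phi r)).
  by rewrite /picard ImB.
have h1'' : Re (iterate v z k.+1 s) @[k --> \oo] --> Re (picard v z (flow v z) s).
  rewrite ReP (_ : (fun k => Re (iterate v z k.+1 s)) =
      (fun k => Re z - \int[leb]_(r in `]s, v]) Re (M r (iterate v z k r)))); first exact: h1'.
  by apply/funext => k; rewrite -ReP.
have h2'' : Im (iterate v z k.+1 s) @[k --> \oo] --> Im (picard v z (flow v z) s).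
  rewrite ImP (_ : (fun k => Im (iterate v z k.+1 s)) =
      (fun k => Im z - \int[leb]_(r in `]s, v]) Im (M r (iterate v z k r)))); first exact: h2'.
  by apply/funext => k; rewrite -ImP.
apply: eqC_ReIm; first exact: (cvg_unique _ h1 h1'').
exact: (cvg_unique _ h2 h2'').
Qed.

End Picard.

(** * The flow of the vector field *)

Section Flow.
Context {R : realType} (M : R -> R[i] -> R[i]).
Notation leb := (@lebesgue_measure R).
Hypothesis ML : forall s, cauchy_limit (M s).
Hypothesis MRe : forall z, uhp z ->
  measurable_fun setT ((fun s => Re (M s z)) : measurableTypeR R -> R).
Hypothesis MIm : forall z, uhp z ->
  measurable_fun setT ((fun s => Im (M s z)) : measurableTypeR R -> R).

(** The F-transforms of centred measures of variance w have this form, and so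
    do the maps of the flow, with w the time to run. *)
Definition shift_map (f : R[i] -> R[i]) (w : R) :=
  exists2 g, cauchy_limit g & forall z, uhp z -> f z = z - w%:C * g z.

(** At each time r, the integrand is M_r composed with a shift map, and the
    integral is v - s times an average. *)
Lemma picard_shift_map (phi : R[i] -> R -> R[i]) (v s : R) : s < v ->
  (forall z, uhp z -> tame (Im z) (phi z)) ->
  (forall r, exists2 w, 0 <= w & shift_map (phi ^~ r) w) ->
  shift_map (fun z => picard M v z (phi z) s) (v - s).
Proof.
move=> sv tp sh; have vs : 0 < v - s by rewrite subr_gt0.
pose A (f : R -> R) := (v - s)^-1 * \int[leb]_(r in `]s, v]) f r.
exists (fun z => A (fun r => Re (M r (phi z r))) +i* A (fun r => Im (M r (phi z r)))).
  have mJ : measurable (`]s, v]%classic : set (measurableTypeR R)) by exact: measurable_itv.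
  apply: (@cauchy_limit_average _ _ (measurableTypeR R) leb _ (v - s) (fun r z => M r (phi z r)) _ mJ) => //.
  - exact: lebesgue_itv_oc (ltW sv).
  - move=> r _; have [w w0 [g gP gE]] := sh r.
    apply: eq_cauchy_limit (cauchy_limit_comp gP (ML r) w0) => z hz.
    by rewrite gE.
  - move=> z hz; apply: (@measurable_funS _ _ (measurableTypeR R) _ setT) => //.
    by have [] := measurable_field ML MRe MIm hz (tp z hz).
  - move=> z hz; apply: (@measurable_funS _ _ (measurableTypeR R) _ setT) => //.
    by have [] := measurable_field ML MRe MIm hz (tp z hz).
move=> z hz; apply: eqC_ReIm; rewrite /picard ?ReB ?ImB ?ReZ ?ImZ /= /A.
  by rewrite mulrA mulfV ?mul1r// gt_eqF.
by rewrite mulrA mulfV ?mul1r// gt_eqF.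
Qed.

Lemma flow_terminal v z s : uhp z -> v <= s -> flow M v z s = z.
Proof.
move=> hz vs; rewrite flow_picard// /picard !set_itv_ge ?bnd_simp -?leNgt//.
by rewrite !Rintegral_set0 subr0.
Qed.

Lemma flow_shift_map v s : s < v -> shift_map (fun z => flow M v z s) (v - s).
Proof.
move=> sv; have vs : 0 < v - s by rewrite subr_gt0.
have step k r : exists2 w, 0 <= w & shift_map (fun z => iterate M v z k r) w.
  elim: k r => [|k IH] r.
    exists 0 => //; exists (fun z => (z - 0%:C)^-1); first exact: cauchy_limit_pole.
    by move=> z _; rewrite mul0r subr0.
  have [rv|vr] := ltP r v.
    exists (v - r); first by rewrite subr_ge0 ltW.
    by apply: (picard_shift_map (phi := fun z => iterate M v z k)) => // z; exact: iterate_tame.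
  exists 0 => //; exists (fun z => (z - 0%:C)^-1); first exact: cauchy_limit_pole.
  move=> z _; rewrite mul0r subr0 /= /picard.
  by rewrite !set_itv_ge ?bnd_simp -?leNgt// !Rintegral_set0 subr0.
have it k : exists g, cauchy_limit g /\
    forall z, uhp z -> iterate M v z k.+1 s = z - (v - s)%:C * g z.
  have [g gP gE] := @picard_shift_map (fun z => iterate M v z k) v s sv
    (fun z => @iterate_tame R M ML MRe MIm v z k) (step k).
  by exists g.
have [G hG] := choice it.
have solve (x y w : R) : x = y - (v - s) * w -> w = (v - s)^-1 * (y - x).
  by move=> ->; rewrite subKr mulrA mulVf ?mul1r// gt_eqF.
exists (fun z => (v - s)^-1%:C * (z - flow M v z s)); last first.
  move=> z _; rewrite mulrA -rmorphM/= mulfV ?gt_eqF// mul1r.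
  by rewrite subKr.
apply: (@cauchy_limit_cvg _ _ \oo _ G).
- by move=> k; have [] := hG k.
- move=> z hz; rewrite ReZ ReB.
  rewrite (_ : (fun k => Re (G k z)) = (fun k => (v - s)^-1 * (Re z - Re (iterate M v z k.+1 s)))).
    apply: cvgMl_tmp; apply: cvgB; first exact: cvg_cst.
    by have [h _] := flow_cvg ML MRe MIm v s hz; move: h; rewrite -cvg_shiftS.
  apply/funext => k; have [_ /(_ z hz) h] := hG k.
  by apply: solve; rewrite -ReZ -ReB -h.
- move=> z hz; rewrite ImZ ImB.
  rewrite (_ : (fun k => Im (G k z)) = (fun k => (v - s)^-1 * (Im z - Im (iterate M v z k.+1 s)))).
    apply: cvgMl_tmp; apply: cvgB; first exact: cvg_cst.
    by have [_ h] := flow_cvg ML MRe MIm v s hz; move: h; rewrite -cvg_shiftS.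
  apply/funext => k; have [_ /(_ z hz) h] := hG k.
  by apply: solve; rewrite -ImZ -ImB -h.
Qed.

Lemma ae_neq (x : R) : {ae leb, forall s : R, s <> x}.
Proof.
exists [set x]; split; [exact: measurable_set1|exact: lebesgue_measure_set1|].
by move=> s /= /contrapT.
Qed.

Lemma flow_ode a v z : uhp z ->
  {ae leb, forall s : R, s \in `[a, v] ->
    complex_is_derive s (flow M v z) (M s (flow M v z s))}.
Proof.
move=> hz; have ft := flow_tame ML MRe MIm v hz.
have [mR mI] := measurable_field ML MRe MIm hz ft.
have [av|va] := leP a v; last first.
  by apply: aeW => s; rewrite in_itv/= => /andP[as_ sv]; have := le_lt_trans (le_trans as_ sv) va; rewrite ltxx.
have a1v : a - 1 <= v by lra.
have bR r : `|Re (M r (flow M v z r))| <= (Im z)^-1 by have [] := tame_field_le ML r hz ft.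
have bI r : `|Im (M r (flow M v z r))| <= (Im z)^-1 by have [] := tame_field_le ML r hz ft.
have h1 := integral_ae_derive a1v mR bR; have h2 := integral_ae_derive a1v mI bI.
apply: ae_imp (ae_and (ae_and h1 h2) (ae_neq v)) => s [[d1 d2] sv].
rewrite in_itv/= => /andP[as_ sv'].
have asv : a - 1 < s < v.
  by apply/andP; split; [lra|rewrite lt_neqAle sv' andbT; exact/eqP].
have {d1}d1 := d1 asv; have {d2}d2 := d2 asv.
split.
  rewrite (_ : (fun r => Re (flow M v z r)) = (fun r => Re z - \int[leb]_(x in `]r, v]) Re (M x (flow M v z x)))).
    by apply: is_derive_eq (is_deriveB (is_derive_cst (Re z) s (1 : R)) d1) _; rewrite sub0r opprK.
  by apply/funext => r; rewrite {1}flow_picard// /picard ReB.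
rewrite (_ : (fun r => Im (flow M v z r)) = (fun r => Im z - \int[leb]_(x in `]r, v]) Im (M x (flow M v z x)))).
  by apply: is_derive_eq (is_deriveB (is_derive_cst (Im z) s (1 : R)) d2) _; rewrite sub0r opprK.
by apply/funext => r; rewrite {1}flow_picard// /picard ImB.
Qed.

Lemma flow_Im_ge v z s : uhp z -> Im z <= Im (flow M v z s).
Proof. by move=> hz; have [h _ _] := flow_tame ML MRe MIm v hz. Qed.

Lemma uhp_flow v z s : uhp z -> uhp (flow M v z s).
Proof. by move=> hz; exact: lt_le_trans (flow_Im_ge v s hz). Qed.

Lemma flow_abs_cont a b v z : uhp z -> complex_absolutely_continuous a b (flow M v z).
Proof.
move=> hz; have [_ h1 h2] := flow_tame ML MRe MIm v hz.
by split; apply: (@lipschitz_absolutely_continuous _ _ _ (Im z)^-1) => x y _ _; [exact: h1|exact: h2].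
Qed.

Lemma ae_subset_itv (P : R -> Prop) (a b c d : R) : a <= c -> d <= b ->
  {ae leb, forall s : R, s \in `[a, b] -> P s} ->
  {ae leb, forall s : R, s \in `[c, d] -> P s}.
Proof.
move=> ac db; apply: ae_imp => s h; rewrite in_itv/= => /andP[cs sd].
by apply: h; rewrite in_itv/= (le_trans ac)//= (le_trans sd).
Qed.

(** Both sides solve the same equation with the same value at time u. *)
Lemma flow_semigroup s u v z : uhp z -> s <= u -> u <= v ->
  flow M v z s = flow M u (flow M v z u) s.
Proof.
move=> hz su uv; have hw := uhp_flow v u hz.
apply: (@loewner_curve_unique _ _ ML s u (Im z) (flow M v z) (flow M u (flow M v z u)) su hz).
- exact: flow_abs_cont.
- exact: flow_abs_cont.
- by move=> r _; exact: flow_Im_ge.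
- by move=> r _; apply: le_trans (flow_Im_ge v u hz) (flow_Im_ge u r hw).
- exact: ae_subset_itv (lexx s) uv (flow_ode s v hz).
- exact: flow_ode.
- by rewrite (flow_terminal hw).
- by rewrite lexx.
Qed.

Lemma flow_dist s v z : uhp z -> s <= v -> normc (flow M v z s - z) <= (v - s) / Im z.
Proof.
move=> hz; rewrite le_eqVlt => /predU1P[->|sv].
  by rewrite (flow_terminal hz)// subrr normc0 subrr mul0r.
have [g gP gE] := flow_shift_map sv.
rewrite gE// addrAC subrr add0r normcN normcM normc_real ger0_norm ?subr_ge0 ?(ltW sv)//.
by rewrite ler_wpM2l ?subr_ge0 ?(ltW sv)// cauchy_limit_le.
Qed.

End Flow.

Section EvolutionFamily.
Context {R : realType} (nu : R -> borel_probability R).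
Notation leb := (@lebesgue_measure R).
Notation M := (fun s => cauchy_transform (nu s)).
Hypothesis MRe : forall z, uhp z ->
  measurable_fun setT ((fun s => Re (M s z)) : measurableTypeR R -> R).
Hypothesis MIm : forall z, uhp z ->
  measurable_fun setT ((fun s => Im (M s z)) : measurableTypeR R -> R).
Let ML s : cauchy_limit (M s) := cauchy_limit_cauchy_transform (nu s).

(** No mass is lost: if g is the function such that the flow is z - (v - s) g,
    then y Im g(iy) is an average of y Im M_r at points close to iy, so that it
    tends to -1 by dominated convergence. *)
Lemma flow_cauchy_transform s v : s < v -> exists rho, forall z, uhp z ->
  flow M v z s = z - (v - s)%:C * cauchy_transform rho z.
Proof.
move=> sv; have vs : 0 < v - s by rewrite subr_gt0.
have [g gP gE] := flow_shift_map ML MRe MIm sv.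
suff [rho rE] : exists rho, forall z, uhp z -> g z = cauchy_transform rho z.
  by exists rho => z hz; rewrite gE// rE.
apply: cauchy_limit_prob => //.
have mJ : measurable (`]s, v]%classic : set (measurableTypeR R)) by exact: measurable_itv.
pose f n r : R := n.+1%:R * Im (M r (flow M v (iy n) r)).
have gI n : n.+1%:R * Im (g (iy n)) = (v - s)^-1 * \int[leb]_(r in `]s, v]) f n r.
  have hz := @uhp_iy R n; have ft := flow_tame ML MRe MIm v hz.
  have [_ mI] := measurable_field ML MRe MIm hz ft.
  have gi : leb.-integrable `]s, v]%classic (EFin \o (fun r => Im (M r (flow M v (iy n) r)))).
    apply: (integrable_bounded_oc (K := (Im (@iy R n))^-1) (ltW sv) mI) => r.
    by have [] := tame_field_le ML r hz ft.
  rewrite (@RintegralZl _ (measurableTypeR R) R leb _ (fun r => Im (M r (flow M v (iy n) r))) _ mJ gi).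
  have h1 := gE _ hz; have h2 := flow_picard ML MRe MIm v s hz.
  have : (v - s) * Im (g (iy n)) = \int[leb]_(r in `]s, v]) Im (M r (flow M v (iy n) r)).
    have : Im (iy n - (v - s)%:C * g (iy n)) = Im (picard M v (iy n) (flow M v (iy n)) s) by rewrite -h1 -h2.
    by rewrite /picard !ImB ImZ /= => /addrI/oppr_inj.
  by move=> <-; rewrite mulrCA; congr (_ * _); rewrite mulrA mulVf ?mul1r// gt_eqF.
under eq_fun do rewrite gI.
rewrite (_ : (-1 : R) = (v - s)^-1 * \int[leb]_(r in `]s, v]) (-1)); last first.
  rewrite (@Rintegral_cst _ (measurableTypeR R) R leb _ mJ).
  have -> : fine (leb `]s, v]%classic) = v - s := congr1 fine (lebesgue_itv_oc (ltW sv)).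
  by field; rewrite gt_eqF.
apply: cvgMl_tmp.
apply: (@Rintegral_dominated_cvg _ _ (measurableTypeR R) leb _ _ _ (fun=> 1) mJ).
- move=> n; have hz := @uhp_iy R n; have ft := flow_tame ML MRe MIm v hz.
  have [_ mI] := measurable_field ML MRe MIm hz ft.
  apply: (@measurable_funS _ _ (measurableTypeR R) _ setT) => //.
  by apply: measurable_funM => //; exact: measurable_cst.
- move=> r; rewrite /= in_itv/= => /andP[sr rv].
  have h := Im_cauchy_cvg (nu r).
  rewrite (_ : f ^~ r = fun n => n.+1%:R * Im (M r (iy n)) +
    n.+1%:R * (Im (M r (flow M v (iy n) r)) - Im (M r (iy n)))); last first.
    by apply/funext => n; rewrite /f; ring.
  rewrite -[X in _ --> X]addr0; apply: cvgD => //.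
  apply: (@cvg_by_harmonic _ _ _ (v - r)) => n; rewrite subr0 normrM ger0_norm//.
  have n0 : 0 < n.+1%:R :> R by rewrite ltr0n.
  have hz := @uhp_iy R n; have iI : Im (@iy R n) = n.+1%:R by [].
  rewrite mulrC -ler_pdivlMr// -ImB (le_trans (normr_Im_le _))//.
  apply: le_trans (field_lipschitz ML r hz (flow_Im_ge ML MRe MIm v r hz) (lexx _)) _.
  apply: (@le_trans _ _ ((v - r) / n.+1%:R / (n.+1%:R * n.+1%:R))).
    by rewrite iI ler_wpM2r ?invr_ge0 ?mulr_ge0//; exact: (flow_dist ML MRe MIm hz rv).
  rewrite ler_wpM2l ?divr_ge0 ?subr_ge0//; rewrite lef_pV2 ?posrE ?mulr_gt0//.
  by rewrite ler_peMr// ler1n.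
- by apply: (@integrable_bounded_oc R (fun=> 1) s v `|1| (ltW sv)).
- move=> n r _; have hz := @uhp_iy R n; have iI : Im (@iy R n) = n.+1%:R by [].
  rewrite /f normrM ger0_norm// -ler_pdivlMl ?ltr0n// mulr1.
  have [_] := tame_field_le ML r hz (flow_tame ML MRe MIm v hz).
  by rewrite iI.
Qed.

End EvolutionFamily.

(** * The evolution family of the flow *)

Section EvolutionFamilyExistence.
Context {R : realType}.
Notation leb := (@lebesgue_measure R).

Definition dirac0 : borel_probability R := @dirac _ (measurableTypeR R) (0 : R) R.

Lemma F_transform_dirac0 z : uhp z -> F_transform dirac0 z = z.
Proof.
move=> hz; rewrite /F_transform; suff -> : cauchy_transform dirac0 z = z^-1 by rewrite invrK.
have E (f : measurableTypeR R -> R) : measurable_fun setT f -> \int[dirac0]_x f x = f 0.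
  move=> mf; rewrite /Rintegral integral_dirac//.
    by rewrite diracT mul1e.
  exact/measurable_EFinP.
rewrite /cauchy_transform (E _ (measurable_Re_pole hz)) (E _ (measurable_Im_pole hz)).
by rewrite subr0; case: (z^-1).
Qed.

Lemma cauchy_transformE (mu : borel_probability R) z :
  cauchy_transform mu z = (F_transform mu z)^-1.
Proof. by rewrite /F_transform invrK. Qed.

Variable nu : R -> borel_probability R.
Notation M := (fun s => cauchy_transform (nu s)).
Hypothesis MRe : forall z, uhp z ->
  measurable_fun setT ((fun s => Re (M s z)) : measurableTypeR R -> R).
Hypothesis MIm : forall z, uhp z ->
  measurable_fun setT ((fun s => Im (M s z)) : measurableTypeR R -> R).
Let ML s : cauchy_limit (M s) := cauchy_limit_cauchy_transform (nu s).

(** For s >= t, the measure is set to the Dirac mass at 0, so that sigma t t is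
    this measure and not only one with the same F-transform. *)
Theorem evolution_family_exists : exists sigma : R -> R -> borel_probability R,
  normal_antimonotone_evolution_family sigma /\
  forall s t z, s <= t -> uhp z -> F_transform (sigma s t) z = flow M t z s.
Proof.
have h (st : R * R) : exists sg : borel_probability R,
    (if st.1 < st.2 then
      (exists rho, forall z, uhp z -> F_transform sg z = z - (st.2 - st.1)%:C * cauchy_transform rho z) /\
      (forall z, uhp z -> F_transform sg z = flow M st.2 z st.1)
    else sg = dirac0).
  have [st12|_] := boolP (st.1 < st.2); last by exists dirac0.
  have [rho rhoE] := flow_cauchy_transform MRe MIm st12.
  have [|sg sgE] := F_transform_exists rho (w := st.2 - st.1); first by rewrite subr_ge0 ltW.
  exists sg; split; first by exists rho.
  by move=> z hz; rewrite sgE// rhoE.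
have [sig hsig] := choice h; exists (fun s t => sig (s, t)).
have diag t : sig (t, t) = dirac0 by have := hsig (t, t); rewrite /= ltxx.
have FE s t z : s <= t -> uhp z -> F_transform (sig (s, t)) z = flow M t z s.
  rewrite le_eqVlt => /predU1P[->|st] hz.
    by rewrite diag F_transform_dirac0// flow_terminal.
  by have := hsig (s, t); rewrite /= st => -[_ ->].
have Frho s t : s <= t -> exists rho, forall z, uhp z ->
    F_transform (sig (s, t)) z = z - (t - s)%:C * cauchy_transform rho z.
  rewrite le_eqVlt => /predU1P[->|st].
    by exists dirac0 => z hz; rewrite diag F_transform_dirac0// subrr mul0r subr0.
  by have := hsig (s, t); rewrite /= st => -[].
have mom s t : s <= t -> [/\ (sig (s, t)).-integrable setT (fun x => x%:E),
    (sig (s, t)).-integrable setT (fun x => (x ^+ 2)%:E),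
    \int[sig (s, t)]_x x = 0 & \int[sig (s, t)]_x (x ^+ 2) = t - s].
  by move=> /Frho[rho rhoE]; exact: F_transform_moments rhoE.
have dist s u v z : s <= u -> u <= v -> uhp z ->
    normc (cauchy_transform (sig (s, u)) z - cauchy_transform (sig (s, v)) z) <=
    (v - u) / (Im z * Im z * Im z).
  move=> su uv hz; have z0 : 0 < Im z := hz.
  have hw := uhp_flow ML MRe MIm v u hz.
  (* both sides are values of the Cauchy transform of sig (s, u), at z and at a
     point close to z *)
  have -> : cauchy_transform (sig (s, v)) z = cauchy_transform (sig (s, u)) (flow M v z u).
    rewrite (cauchy_transformE _ z) (cauchy_transformE (sig (s, u))); congr (_^-1).
    rewrite (FE s v z (le_trans su uv) hz) (FE s u _ su hw).
    exact: (flow_semigroup ML MRe MIm hz su uv).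
  apply: le_trans (field_lipschitz (fun _ => cauchy_limit_cauchy_transform (sig (s, u))) (0 : R) z0 (lexx _) (flow_Im_ge ML MRe MIm v u hz)) _.
  rewrite normcB ler_pdivrMr ?mulr_gt0// (le_trans (flow_dist ML MRe MIm hz uv))//.
  by rewrite [leRHS](_ : _ = (v - u) / Im z)//; field; rewrite gt_eqF.
split=> //; split.
- by move=> t _ A mA; rewrite diag.
- move=> s u t _ su ut z hz; have hw := uhp_flow ML MRe MIm t u hz.
  rewrite (FE s t z (le_trans su ut) hz) (FE u t z ut hz) (FE s u _ su hw).
  exact: (flow_semigroup ML MRe MIm hz su ut).
- move=> s t _ st.
  have [_ mi _ mv] := mom s t st.
  apply: (@weakly_cvg_of_cauchy_transform R R _ _ _ _ (t + 1 - s)) => //.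
  + move=> z hz e e0; have z0 : 0 < Im z := hz.
    have d0 : 0 < e * (Im z * Im z * Im z) by rewrite !mulr_gt0.
    rewrite near_withinE; near=> u => su.
    have ud : `|t - u| < e * (Im z * Im z * Im z).
      near: u; apply: (cvgr_dist_lt (F := nbhs t)) => //; exact: cvg_id.
    have [ut|/ltW tu] := leP u t.
      apply: le_trans (dist s u t z su ut hz) _.
      rewrite ler_pdivrMr ?mulr_gt0// (le_trans _ (ltW ud))//.
      exact: ler_norm.
    rewrite normcB; apply: le_trans (dist s t u z st tu hz) _.
    rewrite ler_pdivrMr ?mulr_gt0// (le_trans _ (ltW ud))//.
    by rewrite distrC ler_norm.
  + rewrite near_withinE; near=> u => su.
    have [_ ui _ uv] := mom s u su; split => //; rewrite uv lerD2r ltW//.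
    by near: u; apply: lt_nbhsl; rewrite ltrDl.
  + by rewrite mv lerD2r lerDl.
- by move=> s t _ st; exact: mom.
Unshelve. all: by end_near. Qed.

End EvolutionFamilyExistence.

(** * The Loewner equation with Lebesgue measurable data *)

Section BorelModification.
Context {R : realType}.
Notation leb := (@lebesgue_measure R).

(** An enumeration of the points of the half-plane with rational coordinates. *)
Definition rational_point (n : nat) : R[i] :=
  if (unpickle n : option (rat * rat)) is Some (a, b) then
    if (0 : R) < ratr b then ratr a +i* ratr b else 0 +i* 1
  else 0 +i* 1.

Lemma uhp_rational_point n : uhp (rational_point n).
Proof.
rewrite /rational_point; case: unpickle => [[a b]|]; last exact: ltr01.
by case: ifPn => // _; exact: ltr01.
Qed.

Lemma rational_point_dense z (e : R) : uhp z -> 0 < e -> exists n,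
  Im z <= Im (rational_point n) /\ normc (rational_point n - z) <= e.
Proof.
move=> hz e0; have e20 : 0 < e / 2 by rewrite divr_gt0.
have [a] : exists a, ratr a \in `](Re z), (Re z + e / 2)[ by apply: rat_in_itvoo; rewrite ltrDl.
have [b] : exists b, ratr b \in `](Im z), (Im z + e / 2)[ by apply: rat_in_itvoo; rewrite ltrDl.
rewrite !in_itv/= => /andP[b1 b2] /andP[a1 a2].
exists (pickle (a, b)); rewrite /rational_point pickleK.
have z0 : 0 < Im z := hz.
have -> : (0 : R) < ratr b by exact: lt_trans b1.
split; first exact: ltW.
rewrite (le_trans (normc_leD _))// ReB ImB /= (splitr e) lerD//.
  by rewrite ger0_norm ?subr_ge0 ?(ltW a1)// lerBlDl ltW.
by rewrite ger0_norm ?subr_ge0 ?(ltW b1)// lerBlDl ltW.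
Qed.

(** Cauchy transforms being Lipschitz, it is enough to take care of countably
    many points of the half-plane. *)
Lemma borel_modification (nu : R -> borel_probability R) (D : set R) : measurable D ->
  (forall z, uhp z ->
    complex_lebesgue_measurable D (fun s => cauchy_transform (nu s) z)) ->
  exists (nu' : R -> borel_probability R) (N : set R),
    [/\ measurable N, leb N = 0, forall s, D s -> ~ N s -> nu' s = nu s,
     forall z, uhp z -> measurable_fun setT
       ((fun s => Re (cauchy_transform (nu' s) z)) : measurableTypeR R -> R) &
     forall z, uhp z -> measurable_fun setT
       ((fun s => Im (cauchy_transform (nu' s) z)) : measurableTypeR R -> R)].
Proof.
move=> mD mnu.
have [N1 hN1] := choice (fun n => borel_of_lebesgue_measurable mD (mnu _ (uhp_rational_point n)).1).
have [N2 hN2] := choice (fun n => borel_of_lebesgue_measurable mD (mnu _ (uhp_rational_point n)).2).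
pose N := \bigcup_n (N1 n `|` N2 n).
have mN : measurable N.
  apply: bigcupT_measurable => n; have [m1 _ _] := hN1 n; have [m2 _ _] := hN2 n.
  exact: measurableU.
have mE : measurable (D `\` N) by exact: measurableD.
have q1 n : @measurable_fun _ _ (measurableTypeR R) R (D `\` N) (fun s => Re (cauchy_transform (nu s) (rational_point n))).
  have [m1 _] := hN1 n; apply: measurable_funS; first exact: measurableD.
  by apply: setDS => x Nx; exists n => //; left.
have q2 n : @measurable_fun _ _ (measurableTypeR R) R (D `\` N) (fun s => Im (cauchy_transform (nu s) (rational_point n))).
  have [m2 _] := hN2 n; apply: measurable_funS; first exact: measurableD.
  by apply: setDS => x Nx; exists n => //; right.
have mz (f : R[i] -> R) z : uhp z -> (forall x y, f (x - y) = f x - f y) -> (forall x, `|f x| <= normc x) ->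
    (forall n, @measurable_fun _ _ (measurableTypeR R) R (D `\` N) (fun s => f (cauchy_transform (nu s) (rational_point n)))) ->
    @measurable_fun _ _ (measurableTypeR R) R (D `\` N) (fun s => f (cauchy_transform (nu s) z)).
  move=> hz fB fle mf; have z0 : 0 < Im z := hz.
  have i0 k : 0 < k.+1%:R^-1 :> R by rewrite invr_gt0.
  have [n hn] := choice (fun k => rational_point_dense hz (i0 k)).
  apply: (@measurable_fun_cvg _ (measurableTypeR R) R _ (fun k s => f (cauchy_transform (nu s) (rational_point (n k))))) => //.
  move=> s _; apply: (@cvg_by_harmonic _ _ _ (Im z * Im z)^-1) => k.
  have [h1 h2] := hn k; rewrite -fB (le_trans (fle _))//.
  apply: le_trans (field_lipschitz (fun _ => cauchy_limit_cauchy_transform (nu s)) (0 : R) z0 h1 (lexx _)) _.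
  by rewrite mulrC ler_wpM2l// invr_ge0 mulr_ge0// ltW.
pose nu' s := if s \in D `\` N then nu s else dirac0.
have mnu' (f : R[i] -> R) z :
    @measurable_fun _ _ (measurableTypeR R) R (D `\` N) (fun s => f (cauchy_transform (nu s) z)) ->
    measurable_fun setT ((fun s => f (cauchy_transform (nu' s) z)) : measurableTypeR R -> R).
  move=> mf; rewrite -(setUv (D `\` N)); apply/measurable_funU => //.
    exact: measurableC.
  split.
    by apply: eq_measurable_fun mf => s; rewrite /nu' => ->.
  apply: (@eq_measurable_fun _ _ (measurableTypeR R) R _ (fun=> f (cauchy_transform dirac0 z))); last exact: measurable_cst.
  by move=> s; rewrite /nu' in_setC => /negbTE ->.
exists nu', N; split; first exact: mN.
- suff : leb.-negligible N by move/negligibleP; exact.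
  apply: negligible_bigcup => n; have [m1 l1 _] := hN1 n; have [m2 l2 _] := hN2 n.
  by apply: negligibleU; [exists (N1 n)|exists (N2 n)]; split.
- by move=> s Ds Ns; rewrite /nu' mem_set.
- by move=> z hz; apply: mnu'; apply: mz => // [x y|x]; [exact: ReB|exact: normr_Re_le].
- by move=> z hz; apply: mnu'; apply: mz => // [x y|x]; [exact: ImB|exact: normr_Im_le].
Qed.

Theorem loewner_equation_solution (t : R) (nu : R -> borel_probability R) : 0 < t ->
  (forall z, uhp z ->
    complex_lebesgue_measurable `[0, t] (fun s => cauchy_transform (nu s) z)) ->
  exists (phi : R -> R[i] -> R[i]) (sigma : R -> R -> borel_probability R),
    [/\ solves_loewner t (fun s => cauchy_transform (nu s)) phi,
      normal_antimonotone_evolution_family sigma &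
      forall s z, s \in `[0, t] -> uhp z -> phi s z = F_transform (sigma s t) z].
Proof.
move=> t0 mnu; have [nu' [N [mN N0 nuE mR mI]]] := borel_modification (measurable_itv _) mnu.
have ML s : cauchy_limit (cauchy_transform (nu' s)) := cauchy_limit_cauchy_transform _.
have [sigma [nsigma FE]] := evolution_family_exists mR mI.
exists (fun s z => flow (fun s => cauchy_transform (nu' s)) t z s), sigma; split => //.
  split.
  - by move=> s z _ hz; exact: uhp_flow.
  - by move=> z hz; exact: flow_abs_cont.
  - move=> z hz.
    have aeN : {ae leb, forall s, ~ N s}.
      by exists N; split => // s /= /contrapT.
    apply: ae_imp (ae_and aeN (flow_ode ML mR mI 0 t hz)) => s [Ns h] st.
    by rewrite -nuE//; exact: h.
  - by move=> z hz; exact: flow_terminal.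
by move=> s z; rewrite in_itv/= => /andP[_ st] hz; rewrite FE.
Qed.

(** The imaginary part of a solution has a positive minimum on [0, t], by
    compactness, so that loewner_curve_unique applies. *)
Theorem loewner_equation_unique (t : R) (M phi psi : R -> R[i] -> R[i]) : 0 <= t ->
  (forall s, cauchy_limit (M s)) -> solves_loewner t M phi -> solves_loewner t M psi ->
  forall s z, s \in `[0, t] -> uhp z -> psi s z = phi s z.
Proof.
move=> t0 ML hp hq s z; rewrite in_itv/= => st hz.
have bound (f : R -> R[i] -> R[i]) : solves_loewner t M f ->
    exists2 c, 0 < c & forall s, 0 <= s <= t -> c <= Im (f s z).
  move=> hf; have [_ ac] := solves_abs_cont hf hz.
  have [r rt hr] := absolutely_continuous_min t0 ac.
  by exists (Im (f r z)) => //; apply: (solves_half_plane hf) => //; rewrite in_itv.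
have [c1 c10 h1] := bound _ hp; have [c2 c20 h2] := bound _ hq.
apply: (@loewner_curve_unique _ M ML 0 t (Num.min c1 c2) (psi ^~ z) (phi ^~ z) t0) => //.
- by rewrite lt_min c10.
- exact: solves_abs_cont hq _ hz.
- exact: solves_abs_cont hp _ hz.
- by move=> r rt; rewrite ge_min h2 ?orbT.
- by move=> r rt; rewrite ge_min h1.
- exact: solves_ode hq _ hz.
- exact: solves_ode hp _ hz.
- by rewrite (solves_terminal hq)// (solves_terminal hp).
Qed.

End BorelModification.

(** * The generator of an evolution family *)

Section Generator.
Context {R : realType} (sigma : R -> R -> borel_probability R).
Notation leb := (@lebesgue_measure R).
Hypothesis nsigma : normal_antimonotone_evolution_family sigma.
Notation phi q z := (fun s => F_transform (sigma s q) z).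

Lemma evolution_representation s t : 0 <= s -> s <= t -> exists rho, forall z, uhp z ->
  F_transform (sigma s t) z = z - (t - s)%:C * cauchy_transform rho z.
Proof.
move=> s0 st; have [i1 i2 m1 m2] := naef_moments nsigma s0 st.
exact: F_transform_representation i1 i2 m1 m2.
Qed.

Lemma evolution_Im_ge s t z : 0 <= s -> s <= t -> uhp z -> Im z <= Im (phi t z s).
Proof.
move=> s0 st hz; have [rho rE] := evolution_representation s0 st.
by rewrite rE// Im_shift_ge ?subr_ge0//; exact: cauchy_limit_cauchy_transform.
Qed.

Lemma evolution_uhp s t z : 0 <= s -> s <= t -> uhp z -> uhp (phi t z s).
Proof. by move=> s0 st hz; exact: lt_le_trans (evolution_Im_ge s0 st hz). Qed.

Lemma evolution_terminal t z : 0 <= t -> uhp z -> phi t z t = z.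
Proof.
move=> t0 hz; have [rho rE] := evolution_representation t0 (lexx t).
by rewrite rE// subrr mul0r subr0.
Qed.

Lemma evolution_dist s t z : 0 <= s -> s <= t -> uhp z ->
  normc (phi t z s - z) <= (t - s) / Im z.
Proof.
move=> s0 st hz; have [rho rE] := evolution_representation s0 st.
rewrite rE// addrAC subrr add0r normcN normcM normc_real ger0_norm ?subr_ge0//.
rewrite ler_wpM2l ?subr_ge0// cauchy_limit_le//.
exact: cauchy_limit_cauchy_transform.
Qed.

Lemma evolution_semigroup s u t z : 0 <= s -> s <= u -> u <= t -> uhp z ->
  phi t z s = phi u (phi t z u) s.
Proof. by move=> s0 su ut hz; exact: (naef_conv nsigma s0 su ut hz). Qed.

(** The semigroup property reduces the increment from s to r to the distance of
    the map from time r to time s to the identity. *)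
Lemma evolution_lipschitz t z s r : uhp z -> 0 <= s <= t -> 0 <= r <= t ->
  normc (phi t z s - phi t z r) <= (Im z)^-1 * `|s - r|.
Proof.
move=> hz; wlog sr : s r / s <= r => [h|/andP[s0 st] /andP[r0 rt]].
  have [/h//|/ltW/h] := leP s r => {}h st rt.
  by rewrite normcB distrC; exact: h.
rewrite (evolution_semigroup s0 sr rt hz).
apply: le_trans (evolution_dist s0 sr (evolution_uhp r0 rt hz)) _.
rewrite mulrC distrC ger0_norm ?subr_ge0// ler_wpM2r ?subr_ge0// lef_pV2 ?posrE//.
  exact: evolution_Im_ge.
exact: (evolution_uhp r0 rt hz).
Qed.

(** The difference quotients of the maps from time s + 1/n to time s are Cauchy
    transforms.  An ultrafilter gives them a limit M s for all s and z at once;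
    this limit is the derivative wherever there is one. *)
Lemma generator_exists : exists M : R -> R[i] -> R[i],
  (forall s, cauchy_limit (M s)) /\
  forall (s q : R) (z : R[i]) (v : R), 0 <= s -> s < q -> uhp z ->
    (is_derive s 1 (fun r => Re (phi q z r)) v -> v = Re (M s (phi q z s))) /\
    (is_derive s 1 (fun r => Im (phi q z r)) v -> v = Im (M s (phi q z s))).
Proof.
pose h (n : nat) : R := n.+1%:R^-1.
have h0 n : 0 < h n by rewrite invr_gt0.
have rep (p : R * nat) : exists rho : borel_probability R, 0 <= p.1 -> forall z, uhp z ->
    F_transform (sigma p.1 (p.1 + h p.2)) z = z - (h p.2)%:C * cauchy_transform rho z.
  have [p0|p0] := leP 0 p.1; last by exists dirac0.
  have [|rho rE] := @evolution_representation p.1 (p.1 + h p.2) p0; first by rewrite lerDl ltW.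
  by exists rho => _ z hz; rewrite rE// addrAC subrr add0r.
have [rho rhoE] := choice rep.
pose G s n := cauchy_transform (rho (s, n)).
have GP s n : cauchy_limit (G s n) by exact: cauchy_limit_cauchy_transform.
have FP : ProperFilter (\oo : set_system nat) by exact: _.
have [U [UU sU]] := ultraFilterLemma FP.
have UF : ProperFilter U by exact: _.
have lim (p : R * R[i]) : exists l : R[i], uhp p.2 ->
    Re (G p.1 n p.2) @[n --> U] --> Re l /\ Im (G p.1 n p.2) @[n --> U] --> Im l.
  have [hz|nz] := pselect (uhp p.2); last by exists 0.
  have bd (f : R[i] -> R) : (forall x, `|f x| <= normc x) ->
      \forall n \near U, - (Im p.2)^-1 <= f (G p.1 n p.2) <= (Im p.2)^-1.
    move=> fle; apply: nearW => n; rewrite -ler_norml (le_trans (fle _))//.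
    exact: cauchy_limit_le.
  have [l1 _ h1] := ultra_cvg_bounded UU (bd _ (@normr_Re_le R)).
  have [l2 _ h2] := ultra_cvg_bounded UU (bd _ (@normr_Im_le R)).
  by exists (l1 +i* l2).
have [M0 hM] := choice lim.
pose M s z := M0 (s, z).
exists M; split.
  move=> s; apply: (@cauchy_limit_cvg _ _ U _ (G s)) => // z hz.
    by have [] := hM (s, z) hz.
  by have [] := hM (s, z) hz.
move=> s q z v s0 sq hz.
have w0 := evolution_uhp s0 (ltW sq) hz.
have key (f : R[i] -> R) : (forall x y, f (x - y) = f x - f y) ->
    (forall a x, f (a%:C * x) = a * f x) -> (forall x, `|f x| <= normc x) ->
    is_derive s 1 (fun r => f (phi q z r)) v ->
    f (G s n (phi q z s)) @[n --> \oo] --> v.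
  move=> fB fZ fle [df dv].
  have hd : (fun x => x^-1 *: (((fun r => f (phi q z r)) \o shift s) (x *: (1 : R)) - f (phi q z s))) @ 0^' --> v.
    by rewrite -dv; exact: df.
  apply/cvgrPdist_le => e e0; have e20 : 0 < e / 2 by rewrite divr_gt0.
  move/cvgrPdist_le : hd => /(_ _ e20)[d /= d0 hd].
  have z0 : 0 < Im z := hz.
  have c0 : 0 < e / 2 * (Im z * Im z * Im z) by rewrite !mulr_gt0.
  have sq0 : 0 < q - s by rewrite subr_gt0.
  near=> n.
  have hn1 : h n < d by near: n; exact: (near_infty_natSinv_lt (PosNum d0)).
  have hn2 : h n < q - s by near: n; exact: (near_infty_natSinv_lt (PosNum sq0)).
  have hn3 : h n < e / 2 * (Im z * Im z * Im z).
    by near: n; exact: (near_infty_natSinv_lt (PosNum c0)).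
  have ssh : s <= s + h n by rewrite lerDl ltW.
  have shq : s + h n <= q by rewrite -lerBrDl ltW.
  have sh0 : 0 <= s + h n by exact: le_trans ssh.
  pose w := phi q z (s + h n).
  have hw : uhp w by exact: evolution_uhp.
  have wE : f (G s n w) = (h n)^-1 * (f w - f (phi q z s)).
    rewrite (evolution_semigroup s0 ssh shq hz) -/w (rhoE (s, n) s0 w hw) -fB subKr fZ mulKf//.
    by rewrite gt_eqF.
  have b1 : `|v - f (G s n w)| <= e / 2.
    have := hd (h n); rewrite /ball/= sub0r normrN gtr0_norm// => /(_ hn1).
    rewrite gt_eqF// => /(_ isT); rewrite [_%:A]mulr1 [_ + s]addrC wE; exact.
  have b2 : `|f (G s n w) - f (G s n (phi q z s))| <= e / 2.
    rewrite -fB (le_trans (fle _))//.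
    apply: le_trans (field_lipschitz (fun _ => GP s n) (0 : R) z0 (evolution_Im_ge sh0 shq hz) (evolution_Im_ge s0 (ltW sq) hz)) _.
    rewrite ler_pdivrMr ?mulr_gt0//.
    apply: (@le_trans _ _ ((Im z)^-1 * `|s + h n - s|)).
      by apply: evolution_lipschitz => //; apply/andP; split => //; exact: ltW.
    rewrite addrAC subrr add0r gtr0_norm// mulrC ler_pdivrMr//.
    by rewrite -!mulrA in hn3 *; exact: ltW.
  rewrite (splitr e); apply: le_trans (ler_distD (f (G s n w)) _ _) _.
  exact: lerD b1 b2.
have [h1 h2] := hM (s, phi q z s) w0.
split=> dv.
  have c := key _ (@ReB R) (@ReZ R) (@normr_Re_le R) dv.
  have c' : Re (G s n (phi q z s)) @[n --> U] --> v by apply: cvg_trans c; exact: cvg_app.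
  exact: (cvg_unique _ c' h1).
have c := key _ (@ImB R) (@ImZ R) (@normr_Im_le R) dv.
have c' : Im (G s n (phi q z s)) @[n --> U] --> v by apply: cvg_trans c; exact: cvg_app.
exact: (cvg_unique _ c' h2).
Unshelve. all: by end_near. Qed.

End Generator.

(** * Measures representing the generator *)

Section GeneratorMeasures.
Context {R : realType} (sigma : R -> R -> borel_probability R).
Notation leb := (@lebesgue_measure R).
Hypothesis nsigma : normal_antimonotone_evolution_family sigma.
Notation phi q z := (fun s => F_transform (sigma s q) z).
Variable M : R -> R[i] -> R[i].
Hypothesis ML : forall s, cauchy_limit (M s).
Hypothesis Mder : forall (s q : R) (z : R[i]) (v : R), 0 <= s -> s < q -> uhp z ->
  (is_derive s 1 (fun r => Re (phi q z r)) v -> v = Re (M s (phi q z s))) /\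
  (is_derive s 1 (fun r => Im (phi q z r)) v -> v = Im (M s (phi q z s))).

Lemma generator_density q z : 0 < q -> uhp z -> exists g : (R -> R) * (R -> R),
  [/\ measurable_fun setT (g.1 : measurableTypeR R -> R),
      measurable_fun setT (g.2 : measurableTypeR R -> R),
      leb.-integrable `]0, q]%classic (EFin \o g.2),
      \int[leb]_(r in `]0, q]) g.2 r = Im (phi q z q) - Im (phi q z 0) &
      {ae leb, forall s : R, 0 < s < q ->
        [/\ complex_is_derive s (phi q z) (M s (phi q z s)),
            g.1 s = Re (M s (phi q z s)) & g.2 s = Im (M s (phi q z s))]}].
Proof.
move=> q0 hz.
have [|g1 [mg1 _ _ ae1]] := @lipschitz_ae_derive R (fun s => Re (phi q z s)) 0 q (Im z)^-1 (ltW q0).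
  by move=> x y xq yq; rewrite -ReB (le_trans (normr_Re_le _))// (evolution_lipschitz nsigma hz xq yq).
have [|g2 [mg2 ig2 Ig2 ae2]] := @lipschitz_ae_derive R (fun s => Im (phi q z s)) 0 q (Im z)^-1 (ltW q0).
  by move=> x y xq yq; rewrite -ImB (le_trans (normr_Im_le _))// (evolution_lipschitz nsigma hz xq yq).
exists (g1, g2); split => //=; first by apply: Ig2; rewrite (ltW q0) lexx.
apply: ae_imp (ae_and ae1 ae2) => s [h1 h2] sq; have /andP[s0 sq'] := sq.
have d1 := h1 sq; have d2 := h2 sq.
have e1 := (Mder (g1 s) (ltW s0) sq' hz).1 d1; have e2 := (Mder (g2 s) (ltW s0) sq' hz).2 d2.
by split => //; split; [rewrite -e1|rewrite -e2].
Qed.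

(** The value M_s(w) is the limit of M_s along the curves that end at w shortly
    after time s; a grid of countably many such curves is enough. *)
Lemma generator_approx w : uhp w -> exists h : nat -> (R -> R) * (R -> R),
  [/\ forall k, measurable_fun setT ((h k).1 : measurableTypeR R -> R),
      forall k, measurable_fun setT ((h k).2 : measurableTypeR R -> R) &
      {ae leb, forall s : R, 0 <= s -> (h k).1 s @[k --> \oo] --> Re (M s w) /\
        (h k).2 s @[k --> \oo] --> Im (M s w)}].
Proof.
move=> hw; have w0 : 0 < Im w := hw.
pose q (k j : nat) : R := j.+1%:R / k.+1%:R.
have q0 k j : 0 < q k j by rewrite divr_gt0.
have [g hg] := choice (fun p : nat * nat => generator_density (q0 p.1 p.2) hw).
pose j k (s : R) := Num.trunc (k.+1%:R * (s + 0)).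
exists (fun k => ((fun s => (g (k, j k s)).1 s), (fun s => (g (k, j k s)).2 s))).
split=> [k|k|].
- by apply: (measurable_trunc (G := fun j => (g (k, j)).1)) => i; have [] := hg (k, i).
- by apply: (measurable_trunc (G := fun j => (g (k, j)).2)) => i; have [] := hg (k, i).
have aeg : {ae leb, forall s : R, forall k i, 0 < s < q k i ->
    (g (k, i)).1 s = Re (M s (phi (q k i) w s)) /\ (g (k, i)).2 s = Im (M s (phi (q k i) w s))}.
  apply: ae_foralln => k; apply: ae_foralln => i; have [_ _ _ _] := hg (k, i).
  by apply: ae_imp => s h /h[].
apply: ae_imp (ae_and aeg (ae_neq 0)) => s [h /eqP sn0] s0'.
have s0 : 0 < s by rewrite lt_neqAle eq_sym sn0.
have key k : [/\ 0 < s < q k (j k s) &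
    normc (M s (phi (q k (j k s)) w s) - M s w) <= (Im w * Im w * Im w)^-1 / k.+1%:R].
  have k0 : 0 < k.+1%:R :> R by rewrite ltr0n.
  have ks0 : 0 <= k.+1%:R * (s + 0) by rewrite addr0 mulr_ge0.
  have /andP[] := truncn_itv ks0.
  rewrite -/(j k s); set i := j k s; rewrite addr0 => h1 h2.
  have sq : s < q k i by rewrite ltr_pdivlMr// mulrC.
  have qs : q k i - s <= k.+1%:R^-1.
    rewrite lerBlDl /q -[i.+1%:R]natr1 mulrDl mul1r lerD2r.
    by rewrite ler_pdivrMr// mulrC.
  split; first by rewrite s0.
  apply: le_trans (field_lipschitz ML s w0 (evolution_Im_ge nsigma s0' (ltW sq) hw) (lexx _)) _.
  apply: (@le_trans _ _ (k.+1%:R^-1 / Im w / (Im w * Im w))).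
    rewrite ler_wpM2r ?invr_ge0 ?mulr_ge0 ?(ltW w0)//.
    apply: le_trans (evolution_dist nsigma s0' (ltW sq) hw) _.
    by rewrite ler_wpM2r ?invr_ge0 ?(ltW w0).
  by rewrite [leLHS](_ : _ = (Im w * Im w * Im w)^-1 / k.+1%:R)//; field; rewrite ?gt_eqF ?ltr0n.
split; apply: (@cvg_by_harmonic _ _ _ (Im w * Im w * Im w)^-1) => k /=.
  have [sq le] := key k; have [-> _] := h k _ sq.
  by rewrite -ReB (le_trans (normr_Re_le _)).
have [sq le] := key k; have [_ ->] := h k _ sq.
by rewrite -ImB (le_trans (normr_Im_le _)).
Qed.

(** As y grows, the integral over [0, t] of - y Im M_s along the curve that ends
    at iy tends to the integral of m.  It is also y times an increment of the
    imaginary part of the curve, which tends to the variance t of sigma 0 t.  As m <= 1, this forces m = 1. *)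
Lemma generator_mass (m : R -> R) (nu : R -> borel_probability R) (t : R) : 0 < t ->
  (forall s, 0 <= m s <= 1) ->
  (forall s z, uhp z -> M s z = (m s)%:C * cauchy_transform (nu s) z) ->
  {ae leb, forall s : R, 0 < s < t -> m s = 1}.
Proof.
move=> t0 m01 ME.
have [g hg] := choice (fun n => generator_density t0 (@uhp_iy R n)).
have aeg : {ae leb, forall s : R, forall n, 0 < s < t -> (g n).2 s = Im (M s (phi t (iy n) s))}.
  by apply: ae_foralln => n; have [_ _ _ _] := hg n; apply: ae_imp => s h /h[].
have [N [mN N0 hN]] := ae_and aeg (ae_neq t).
pose I : set (measurableTypeR R) := `]0, t]%classic.
have mI : measurable I by exact: measurable_itv.
pose D : set (measurableTypeR R) := I `\` N.
have mD : measurable D by exact: measurableD.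
have Dt s : D s -> 0 < s < t /\ forall n, (g n).2 s = Im (M s (phi t (iy n) s)).
  move=> [+ Ns]; rewrite /I/= in_itv/= => /andP[s0 st].
  have [h1 h2] : (forall n, 0 < s < t -> (g n).2 s = Im (M s (phi t (iy n) s))) /\ s <> t.
    by apply: contrapT => h; apply: Ns; apply: hN.
  have st' : 0 < s < t by rewrite s0 lt_neqAle st andbT; apply/eqP.
  by split => // n; exact: h1.
have lebI : leb I = t%:E by rewrite -[t in RHS]subr0; exact: lebesgue_itv_oc (ltW t0).
have lebD : leb D = t%:E.
  apply/eqP; rewrite eq_le; apply/andP; split.
    by rewrite -lebI le_measure ?inE//; exact: subDsetl.
  rewrite -lebI; apply: (@le_trans _ _ (leb (D `|` N))).
    rewrite le_measure ?inE//; first exact: measurableU.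
    by move=> x Ix; have [Nx|Nx] := pselect (N x); [right|left].
  apply: le_trans (measureU2 leb mD mN) _.
  by have := N0 => /= ->; rewrite adde0.
pose f n (s : measurableTypeR R) : R := n.+1%:R * (g n).2 s.
have mf n : measurable_fun setT (f n).
  by apply: measurable_funM; [exact: measurable_cst|have [] := hg n].
have fcvg s : D s -> f n s @[n --> \oo] --> - m s.
  move=> /Dt[/andP[s0 st] gE].
  have h := cvgMl_tmp (a := m s) (Im_cauchy_cvg (nu s)).
  rewrite mulrN1 in h.
  rewrite (_ : f ^~ s = fun n => m s * (n.+1%:R * Im (cauchy_transform (nu s) (iy n))) +
    n.+1%:R * (Im (M s (phi t (iy n) s)) - Im (M s (iy n)))); last first.
    apply/funext => n; rewrite /f gE (ME s (iy n) (@uhp_iy R n)) ImZ; ring.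
  rewrite -[X in _ --> X]addr0; apply: cvgD; first exact: h.
  apply: (@cvg_by_harmonic _ _ _ (t - s)) => n; rewrite subr0 normrM ger0_norm//.
  have n0 : 0 < n.+1%:R :> R by rewrite ltr0n.
  have hz := @uhp_iy R n; have iI : Im (@iy R n) = n.+1%:R by [].
  rewrite mulrC -ler_pdivlMr// -ImB (le_trans (normr_Im_le _))//.
  apply: le_trans (field_lipschitz ML s hz (evolution_Im_ge nsigma (ltW s0) (ltW st) hz) (lexx _)) _.
  apply: (@le_trans _ _ ((t - s) / n.+1%:R / (n.+1%:R * n.+1%:R))).
    by rewrite iI ler_wpM2r ?invr_ge0 ?mulr_ge0//; exact: (evolution_dist nsigma (ltW s0) (ltW st) hz).
  rewrite ler_wpM2l ?divr_ge0 ?subr_ge0 ?(ltW st)//; rewrite lef_pV2 ?posrE ?mulr_gt0//.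
  by rewrite ler_peMr// ler1n.
have fle n s : D s -> `|f n s| <= 1.
  move=> /Dt[/andP[s0 st] gE]; have hz := @uhp_iy R n; have iI : Im (@iy R n) = n.+1%:R by [].
  rewrite /f gE normrM ger0_norm// -ler_pdivlMl ?ltr0n// mulr1.
  rewrite (le_trans (normr_Im_le _))// -iI.
  by apply: field_le => //; exact: (evolution_Im_ge nsigma (ltW s0) (ltW st) hz).
have i1 : leb.-integrable D (EFin \o (fun=> 1)).
  by apply: (@bounded_Rintegrable R _ (measurableTypeR R) leb _ t _ `|1| mD lebD).
have mnm : measurable_fun D (fun s : measurableTypeR R => - m s).
  apply: (@measurable_fun_cvg _ (measurableTypeR R) R D f) => //.
  by move=> n; exact: measurable_funS (mf n).
have inm : leb.-integrable D (EFin \o (fun s => - m s)).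
  apply: (@bounded_Rintegrable R _ (measurableTypeR R) leb _ t _ 1 mD lebD mnm) => s _.
  by rewrite normrN; have /andP[? ?] := m01 s; rewrite ger0_norm.
have Icvg : \int[leb]_(s in D) f n s @[n --> \oo] --> \int[leb]_(s in D) (- m s).
  apply: (@Rintegral_dominated_cvg _ _ (measurableTypeR R) leb _ _ _ (fun=> 1) mD) => //.
  by move=> n; exact: measurable_funS (mf n).
have [rho rhoE] := evolution_representation nsigma (lexx 0) (ltW t0).
have IE n : \int[leb]_(s in D) f n s = t * (n.+1%:R * Im (cauchy_transform rho (iy n))).
  have hz := @uhp_iy R n; have [_ _ gi gI _] := hg n.
  have fi : leb.-integrable I (EFin \o f n).
    exact: (@integrableZl _ (measurableTypeR R) R leb _ mI n.+1%:R _ gi).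
  have -> : \int[leb]_(s in D) f n s = \int[leb]_(s in I) f n s.
    rewrite /Rintegral; congr fine; apply: esym.
    exact: (@negligible_integral _ (measurableTypeR R) R leb I N _ mN mI fi N0).
  rewrite (@RintegralZl _ (measurableTypeR R) R leb I (g n).2 n.+1%:R mI gi) gI.
  rewrite (evolution_terminal nsigma (ltW t0) hz) rhoE// ImB ImZ subr0 subKr.
  by rewrite mulrCA.
have Im_t : \int[leb]_(s in D) (- m s) = t * (-1).
  apply: (cvg_unique _ Icvg) => //; rewrite (_ : (fun n => \int[leb]_(s in D) f n s) = (fun n => t * (n.+1%:R * Im (cauchy_transform rho (iy n))))); last exact/funext.
  exact: cvgMl_tmp (Im_cauchy_cvg rho).
pose d (s : measurableTypeR R) : R := 1 + - m s.
have d0 s : 0 <= d s by have /andP[_ h] := m01 s; rewrite /d subr_ge0.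
have md : measurable_fun D d by apply: measurable_funD => //; exact: measurable_cst.
have id_ : leb.-integrable D (EFin \o d).
  exact: (@integrableD _ (measurableTypeR R) R leb _ mD _ _ i1 inm).
have Id : \int[leb]_(s in D) d s = 0.
  rewrite (@RintegralD _ (measurableTypeR R) R leb D _ _ mD i1 inm) Im_t.
  rewrite (@Rintegral_cst _ (measurableTypeR R) R leb _ mD).
  have -> : fine (leb D) = t by exact: (congr1 fine lebD).
  by ring.
have Iabs : (\int[leb]_(s in D) `|(d s)%:E| = 0)%E.
  under eq_integral do rewrite gee0_abs ?lee_fin//.
  have fin := @integrable_fin_num _ (measurableTypeR R) R leb D mD _ id_.
  by rewrite -(fineK fin) -[fine _]/(\int[leb]_(s in D) d s) Id.
have mdE : measurable_fun D (EFin \o d) by exact/measurable_EFinP.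
have := (@ae_eq_integral_abs _ (measurableTypeR R) R leb D mD _ mdE).1 Iabs.
have aeN : {ae leb, forall s : R, ~ N s} by exists N; split => // s /= /contrapT.
move=> /(ae_and aeN); apply: ae_imp => s [Ns h] /andP[s0 st].
have /h : D s by split => //; rewrite /I/= in_itv/= s0 ltW.
by rewrite /d /= => -[] /subr0_eq.
Qed.

End GeneratorMeasures.

Section EvolutionFamilyEquation.
Context {R : realType}.
Notation leb := (@lebesgue_measure R).

Theorem evolution_family_solves (sigma : R -> R -> borel_probability R) (t : R) :
  normal_antimonotone_evolution_family sigma -> 0 < t ->
  exists nu : R -> borel_probability R,
    (forall z, uhp z ->
       complex_lebesgue_measurable `[0, t] (fun s => cauchy_transform (nu s) z)) /\
    solves_loewner t (fun s => cauchy_transform (nu s)) (fun s => F_transform (sigma s t)).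
Proof.
move=> ns t0; have [M [ML Mder]] := generator_exists ns.
have rep s : exists p : R * borel_probability R, 0 <= p.1 <= 1 /\
    forall z, uhp z -> M s z = p.1%:C * cauchy_transform p.2 z.
  have [m [rho [m0 m1 E]]] := cauchy_limit_representation (ML s).
  by exists (m, rho); rewrite m0.
have [p hp] := choice rep; exists (fun s => (p s).2).
have m1 := @generator_mass R sigma ns M ML Mder (fun s => (p s).1) (fun s => (p s).2) t t0
  (fun s => (hp s).1) (fun s => (hp s).2).
have ME : {ae leb, forall s : R, 0 <= s <= t ->
    [/\ s <> 0, s <> t & forall z, uhp z -> M s z = cauchy_transform (p s).2 z]}.
  apply: ae_imp (ae_and (ae_and (ae_neq 0) (ae_neq t)) m1) => s [[s0 st] ms] /andP[s0' st'].
  split => // z hz; rewrite (hp s).2// ms ?mul1r//.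
  by rewrite !lt_neqAle s0' st' !andbT eq_sym; apply/andP; split; apply/eqP.
have mI : measurable (`[0, t]%classic : set (measurableTypeR R)) by exact: measurable_itv.
split.
  move=> z hz; have [h [mh1 mh2 hcvg]] := generator_approx ns ML Mder hz.
  split.
    apply: (@lebesgue_measurable_of_cvg R _ _ (fun k => (h k).1) mI mh1).
    apply: ae_imp (ae_and ME hcvg) => s [ms hs] /=; rewrite in_itv/= => st.
    have [_ _ E] := ms st; have /andP[s0 _] := st.
    by have := (hs s0).1; rewrite (E z hz).
  apply: (@lebesgue_measurable_of_cvg R _ _ (fun k => (h k).2) mI mh2).
  apply: ae_imp (ae_and ME hcvg) => s [ms hs] /=; rewrite in_itv/= => st.
  have [_ _ E] := ms st; have /andP[s0 _] := st.
  by have := (hs s0).2; rewrite (E z hz).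
split.
- by move=> s z; rewrite in_itv/= => /andP[s0 st] hz; exact: (evolution_uhp ns s0 st hz).
- move=> z hz; split; apply: (@lipschitz_absolutely_continuous _ _ _ (Im z)^-1) => x y xt yt.
    by rewrite -ReB (le_trans (normr_Re_le _))// (evolution_lipschitz ns hz xt yt).
  by rewrite -ImB (le_trans (normr_Im_le _))// (evolution_lipschitz ns hz xt yt).
- move=> z hz; have [g [_ _ _ _ hg]] := generator_density ns Mder t0 hz.
  apply: ae_imp (ae_and ME hg) => s [ms hs]; rewrite in_itv/= => st.
  have [s0 st' E] := ms st; have /andP[s0' st''] := st.
  have stt : 0 < s < t.
    by rewrite !lt_neqAle s0' st'' !andbT eq_sym; apply/andP; split; apply/eqP.
  have [d _ _] := hs stt; rewrite (E _ (evolution_uhp ns s0' st'' hz)) in d.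
  exact: d.
- by move=> z hz; exact: (evolution_terminal ns (ltW t0) hz).
Qed.

End EvolutionFamilyEquation.

(** * The Loewner equation and evolution families *)

Theorem theorem3p11 (R : realType) :
  (forall (t : R) (nu : R -> borel_probability R),
    0 < t ->
    (forall z : R[i], upper_half_plane z ->
       complex_lebesgue_measurable `[0, t]
         (fun s => cauchy_transform (nu s) z)) ->
    exists phi : R -> R[i] -> R[i],
      [/\ solves_loewner t (fun s => cauchy_transform (nu s)) phi,
          (forall psi : R -> R[i] -> R[i],
             solves_loewner t (fun s => cauchy_transform (nu s)) psi ->
             forall (s : R) (z : R[i]), s \in `[0, t] -> upper_half_plane z ->
               psi s z = phi s z) &
          exists sigma_t : R -> borel_probability R,
            (forall (s : R) (z : R[i]), s \in `[0, t] -> upper_half_plane z ->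
               phi s z = F_transform (sigma_t s) z) /\
            exists sigma : R -> R -> borel_probability R,
              normal_antimonotone_evolution_family sigma /\
              forall s : R, s \in `[0, t] ->
                eq_on_measurable (sigma s t) (sigma_t s)])
  /\
  (forall sigma : R -> R -> borel_probability R,
    normal_antimonotone_evolution_family sigma ->
    forall t : R, 0 < t ->
    exists nu : R -> borel_probability R,
      (forall z : R[i], upper_half_plane z ->
         complex_lebesgue_measurable `[0, t]
           (fun s => cauchy_transform (nu s) z)) /\
      solves_loewner t (fun s => cauchy_transform (nu s))
        (fun s => F_transform (sigma s t))).
Proof.
split=> [t nu t0 mnu|sigma nsigma t t0].
  have [phi [sigma [hphi nsigma phiE]]] := loewner_equation_solution t0 mnu.
  exists phi; split=> // [psi hpsi|].
    apply: (loewner_equation_unique (ltW t0) _ hphi hpsi) => s.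
    exact: cauchy_limit_cauchy_transform.
  exists (fun s => sigma s t); split; first exact: phiE.
  by exists sigma.
exact: evolution_family_solves.
Qed.
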